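(* Let $\Gamma$ be a smooth tropical $(3,3)$-curve. Each tritangent class $\Omega$ of $\Gamma$ is a connected rational polyhedral complex in $\mathbb{R}^3$. In general, these sets do not admit a coarsest structure as polyhedral complexes; that is, there exist a smooth tropical $(3,3)$-curve $\Gamma$ and a tritangent class of $\Gamma$ that admits no coarsest polyhedral complex structure.
   Context: Max convention. A smooth tropical $(3,3)$-curve $\Gamma\subset\mathbb{R}^2$ is the corner locus of a tropical polynomial $\max_{0\le i,j\le 3}(c_{ij}+ix+jy)$ with $c_{ij}\in\mathbb{R}$, whose dual (Newton) subdivision of $[0,3]^2$ is a unimodular triangulation. A tropical $(1,1)$-curve $\Lambda$ (with Newton polytope the full unit square) is encoded by a point $(v_0,l)\in\mathbb{R}^2\times\mathbb{R}=\mathbb{R}^3$: $v_0$ is its lowest vertex and $l$ the signed length of its bounded edge. If $l>0$ the other vertex is $v_1=v_0+l(1,1)$, the edge is $[v_0,v_1]$, and the legs are the rays from $v_0$ in directions $(-1,0),(0,-1)$ and from $v_1$ in directions $(1,0),(0,1)$. If $l<0$ then $v_1=v_0-l(-1,1)$, the edge is $[v_0,v_1]$, and the legs are the rays from $v_0$ in directions $(1,0),(0,-1)$ and from $v_1$ in directions $(-1,0),(0,1)$. If $l=0$ then $v_0=v_1$ and the four legs emanate from it. $\Lambda$ is tritangent to $\Gamma$ if the connected components of $\Lambda\cap\Gamma$ have total stable intersection multiplicities $(2,2,2)$, or $(2,4)$, or $(6)$. A tritangent class $\Omega$ of $\Gamma$ is a connected component of the set of all $(v_0,l)\in\mathbb{R}^3$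 encoding tropical $(1,1)$-curves tritangent to $\Gamma$. Saying that $\Omega$ is a rational polyhedral complex means that it is the support of a (finite) polyhedral complex all of whose cells are polyhedra with rational facet normals (cells may be unbounded, and the complex need not be pure). A polyhedral complex structure on $\Omega$ is coarsest if every other polyhedral complex structure on $\Omega$ is a refinement of it. *)

(* Defs.v *)
From HB Require Import structures.
From mathcomp Require Import all_boot all_order all_algebra.
From mathcomp Require Import all_classical all_reals all_analysis.
Set Implicit Arguments.
Unset Strict Implicit.
Unset Printing Implicit Defensive.
Import Order.TTheory GRing.Theory Num.Theory.
Import numFieldNormedType.Exports.
Local Open Scope classical_set_scope.
Local Open Scope ring_scope.

Section Polyhedra.
Variables (R : realType) (n : nat).
Implicit Types P Q F S : set 'rV[R]_n.

Definition polyhedron P : Prop :=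
  exists (m : nat) (A : 'M[R]_(n, m)) (b : 'rV[R]_m),
    P = [set x | forall j, (x *m A) 0 j <= b 0 j].

(* Only the normals are rational; the right-hand sides are arbitrary. *)
Definition rational_polyhedron P : Prop :=
  exists (m : nat) (A : 'M[rat]_(n, m)) (b : 'rV[R]_m),
    P = [set x | forall j, (x *m map_mx ratr A) 0 j <= b 0 j].

(* Nonempty faces; the functional [a = 0] gives [P] itself. *)
Definition face F P : Prop :=
  F !=set0 /\
  exists a : 'cV[R]_n,
    F = [set x | P x /\ forall y, P y -> (y *m a) 0 0 <= (x *m a) 0 0].

Record polyhedral_complex (K : set (set 'rV[R]_n)) : Prop := {
  complex_finite : finite_set K;
  complex_cell : forall P, K P -> polyhedron P /\ P !=set0;
  complex_face : forall P F, K P -> face F P -> K F;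
  complex_cap : forall P Q, K P -> K Q -> P `&` Q !=set0 ->
    face (P `&` Q) P /\ face (P `&` Q) Q }.

Definition support (K : set (set 'rV[R]_n)) : set 'rV[R]_n :=
  \bigcup_(P in K) P.

Definition complex_structure S (K : set (set 'rV[R]_n)) : Prop :=
  polyhedral_complex K /\ support K = S.

Definition rational_polyhedral_complex S : Prop :=
  exists K, complex_structure S K /\ forall P, K P -> rational_polyhedron P.

(* For complexes with the same support. *)
Definition refinement (K' K : set (set 'rV[R]_n)) : Prop :=
  forall P', K' P' -> exists2 P, K P & P' `<=` P.

Definition coarsest_structure S (K : set (set 'rV[R]_n)) : Prop :=
  complex_structure S K /\
  forall K', complex_structure S K' -> refinement K' K.

End Polyhedra.

Definition components (T : topologicalType) (X : set T) : set (set T) :=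
  connected_component X @` X.

Section StableIntersection.
Variable R : realType.
Implicit Types (X Y C : set 'rV[R]_2) (p q v : 'rV[R]_2) (u w : 'rV[int]_2).

Definition primitive u : Prop := coprimez (u 0 0) (u 0 1).

(* [q] lies in the relative interior of an edge of [X] of direction [u]. *)
Definition edge_direction X q u : Prop :=
  primitive u /\
  \forall x \near q, X x <-> exists t : R, x = q + t *: map_mx intr u.

(* Multiplicity of a transversal intersection point of two plane tropical
   curves all of whose edges have weight one; it is [0] if the curves do not
   meet transversally at [q]. *)
Definition transversal_mult X Y q : nat :=
  xget 0%N [set k | exists u w, [/\ edge_direction X q u,
    edge_direction Y q w & k = absz (u 0 0 * w 0 1 - u 0 1 * w 0 0)%R]].

Definition translate Y v : set 'rV[R]_2 := [set q | Y (q - v)].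

(* Among the intersection points of [X] with the translate of [Y] by [e *: v],
   exactly [m], counted with multiplicity, converge to [p] as [e > 0] tends to
   [0]; here [v] is generic, i.e. outside finitely many lines through [0]. *)
Definition is_stable_mult X Y p (m : nat) : Prop :=
  exists s : seq 'rV[R]_2, forall v,
    (forall r, r \in s -> forall t : R, v <> t *: r) ->
    \forall d \near 0^'+, \forall e \near 0^'+,
      let Y' := translate Y (e *: v) in
      let Z := X `&` Y' `&` ball p d in
      (forall q, Z q -> (0 < transversal_mult X Y' q)%N) /\
      \big[addn/0%N]_(q \in Z) transversal_mult X Y' q = m.

Definition stable_mult X Y p : nat := xget 0%N [set m | is_stable_mult X Y p m].

Definition total_stable_mult X Y C : nat :=
  \big[addn/0%N]_(p \in C) stable_mult X Y p.

End StableIntersection.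

Section TropicalCurves.
Variable R : realType.

Definition pt (x y : R) : 'rV[R]_2 := \row_j (if j == 0 then x else y).

Definition monomial_value (c : 'I_4 -> 'I_4 -> R) (p : 'rV[R]_2)
    (ij : 'I_4 * 'I_4) : R :=
  c ij.1 ij.2 + ij.1%:R * p 0 0 + ij.2%:R * p 0 1.

Definition maximizers (c : 'I_4 -> 'I_4 -> R) (p : 'rV[R]_2) :
    {set 'I_4 * 'I_4} :=
  [set a | [forall b, monomial_value c p b <= monomial_value c p a]]%SET.

Definition corner_locus (c : 'I_4 -> 'I_4 -> R) : set 'rV[R]_2 :=
  [set p | (1 < #|maximizers c p|)%N].

(* Twice the signed area of the lattice triangle [a b d]. *)
Definition area2 (a b d : 'I_4 * 'I_4) : int :=
  (b.1%:Z - a.1%:Z) * (d.2%:Z - a.2%:Z) - (b.2%:Z - a.2%:Z) * (d.1%:Z - a.1%:Z).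

Definition two_dimensional (s : {set 'I_4 * 'I_4}) : Prop :=
  exists a b d, [/\ a \in s, b \in s, d \in s & area2 a b d != 0].

Definition unimodular_triangle (s : {set 'I_4 * 'I_4}) : Prop :=
  exists a b d, s = [set a; b; d]%SET /\ absz (area2 a b d) = 1%N.

(* The cells of the Newton subdivision are the convex hulls of the sets
   [maximizers c p].  A unimodular triangle contains no lattice point besides
   its vertices, so such a hull is one iff [maximizers c p] consists of
   exactly its three vertices. *)
Definition unimodular_newton_subdivision (c : 'I_4 -> 'I_4 -> R) : Prop :=
  forall p, two_dimensional (maximizers c p) ->
    unimodular_triangle (maximizers c p).

Definition smooth_tropical_33_curve (G : set 'rV[R]_2) : Prop :=
  exists c, unimodular_newton_subdivision c /\ G = corner_locus c.

Definition segment (p q : 'rV[R]_2) : set 'rV[R]_2 :=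
  [set p + t *: (q - p) | t in `[0, 1]].

Definition ray (p u : 'rV[R]_2) : set 'rV[R]_2 :=
  [set p + t *: u | t in [set t : R | 0 <= t]].

(* A point of R^2 x R is a row vector of length [2 + 1].  For [l = 0] the
   second branch gives four legs from [v0]. *)
Definition tropical_11_curve (z : 'rV[R]_(2 + 1)) : set 'rV[R]_2 :=
  let v0 := lsubmx z in
  let l := rsubmx z 0 0 in
  if 0 < l then
    let v1 := v0 + l *: pt 1 1 in
    segment v0 v1 `|` ray v0 (pt (-1) 0) `|` ray v0 (pt 0 (-1))
                  `|` ray v1 (pt 1 0) `|` ray v1 (pt 0 1)
  else
    let v1 := v0 - l *: pt (-1) 1 in
    segment v0 v1 `|` ray v0 (pt 1 0) `|` ray v0 (pt 0 (-1))
                  `|` ray v1 (pt (-1) 0) `|` ray v1 (pt 0 1).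

Definition tritangent (G L : set 'rV[R]_2) : Prop :=
  exists s : seq (set 'rV[R]_2),
    [/\ uniq s, [set` s] = components (L `&` G) &
        [seq total_stable_mult G L C | C <- s]
          \in [:: [:: 2; 2; 2]; [:: 2; 4]; [:: 6]]%N].

Definition tritangent_class (G : set 'rV[R]_2) (W : set 'rV[R]_(2 + 1)) : Prop :=
  components [set z | tritangent G (tropical_11_curve z)] W.

End TropicalCurves.

(* Main.v *)
(** Restricted to a (1,1)-curve L, the tropical polynomial of Γ is piecewise linear, and the stable
    multiplicity at a point is the sum of its slopes along the rays of L leaving that point.  So the
    multiplicities telescope along L: they add up to 6, and a point q of L off Γ cuts off a part of
    total multiplicity determined by the exponent of the monomial that is dominant at q.  Since
    every component of L ∩ Γ has positive multiplicity, L is tritangent iff all these cuts are even,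
    i.e. iff no leg, nor the bounded edge, meets the region of a monomial of the wrong parity.

    That a piece of L meets a given region is the solvability in t of a system of strict linear
    inequalities in (v0, l, t); eliminating t by Fourier-Motzkin shows that the set of tritangent
    curves is a union of closed cells of an arrangement of finitely many rational planes.  Closed
    cells are convex, so its connected components are again such unions, hence polyhedral complexes.

    For the second part, an explicit Γ has, in the plane of the (0, y, l), the tritangent class
    { l >= 0, 0 <= y <= 2 } ∪ { l <= 0, y >= -1, 0 <= y - l <= 2 }.  One structure on it has these
    two sets among its cells, another one the parallelogram 0 <= y <= 2, 0 <= y - l <= 2.  The
    parallelogram meets either half in a two-dimensional set, so that a common coarsening has a
    single cell containing all three; but the class is not convex. *)
Require Import Defs.
From mathcomp Require Import all_boot all_order all_algebra.
From mathcomp Require Import all_classical all_reals all_analysis.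
From mathcomp Require Import ring lra zify.
Set Implicit Arguments.
Unset Strict Implicit.
Unset Printing Implicit Defensive.
Import Order.TTheory GRing.Theory Num.Theory.
Import numFieldNormedType.Exports.
Local Open Scope classical_set_scope.
Local Open Scope ring_scope.

(** That even cuts suffice requires totals of single components, which need not be cut off by one
    point. They come from the same telescoping sum, restricted to the points where a predicate holds
    that is constant along segments of the intersection. Such a predicate changes only across a
    point with a single dominant monomial, and there the cut condition makes the change cost an even
    amount. Smoothness turns slopes into multiplicities: after a generic translation every crossing
    has exactly two maximizers, with primitive exponent difference, so its lattice index is the jump
    of the slope.

    The constants of the example are read off its curve. On the line x = 0 the regions of (1,1) and
    (2,1) share an edge over -6 <= y <= -5; the down leg must contain it, whence x = 0. The left leg
    must cross the edge between the regions of (0,2) and (2,3), which spans the heights 0 to 2. That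
    leg starts at v0 for l >= 0 and at v1, of height y - l, for l <= 0: hence the bend of the class.
    Finally (0,-1) is a vertex of the curve; below it the right leg from v0 would enter the region
    of (2,2). *)

Lemma count_ltn (T : eqType) (P Q : pred T) (s : seq T) (x : T) :
  {in s, subpred P Q} -> x \in s -> Q x -> ~~ P x -> (count P s < count Q s)%N.
Proof.
move=> sPQ + Qx nPx; elim: s sPQ => //= y s IH sPQ.
have sPQ' : {in s, subpred P Q} by move=> z zs; apply: sPQ; rewrite inE zs orbT.
have le : (count P s <= count Q s)%N.
  have cE S : count S s = count (predI (mem s) S) s.
    by apply: eq_in_count => z /= ->.
  rewrite (cE P) (cE Q); apply: sub_count => z /= /andP[zs Pz].
  by rewrite zs (sPQ' z zs).
rewrite inE => /orP[/eqP xy|xs].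
  by rewrite -xy Qx (negbTE nPx) add0n add1n ltnS.
rewrite -addnS leq_add ?IH //.
by case Py : (P y) => //; rewrite (sPQ y (mem_head y s) Py).
Qed.

Lemma common_small (R : realType) (T : eqType) (s : seq T) (Q : T -> R -> Prop) :
  (forall x, x \in s -> exists2 d, 0 < d & forall e, 0 < e -> e <= d -> Q x e) ->
  exists2 d, 0 < d & forall x, x \in s -> Q x d.
Proof.
move=> sQ; suff [d d0 dQ] : exists2 d, 0 < d &
    forall x e, x \in s -> 0 < e -> e <= d -> Q x e.
  by exists d => // x xs; apply: dQ.
elim: s sQ => [|y s IH] sQ; first by exists 1.
have [|d d0 dQ] := IH; first by move=> x xs; apply: sQ; rewrite inE xs orbT.
have [d' d'0 dQ'] := sQ y (mem_head y s).
exists (Order.min d d'); first by rewrite lt_min d0.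
move=> x e; rewrite inE le_min => /orP[/eqP ->|xs] e0 /andP[ed ed'].
  exact: dQ'.
exact: dQ.
Qed.

(** * Unions of cells of a hyperplane arrangement *)

Section SignConditions.
Variables (R : realType) (n : nat).
Implicit Types (x y z : 'rV[R]_n) (W : set 'rV[R]_n).

(** The normal is rational but the offset real: the coefficients of the tropical polynomial are
    arbitrary reals and enter only the offsets. *)
Definition affine : Type := 'cV[rat]_n * R.
Implicit Types (h : affine) (hs : seq affine).

Definition eval_affine h x : R := (x *m map_mx ratr h.1) 0 0 - h.2.

Definition opp_affine h : affine := (- h.1, - h.2).

Lemma eval_opp_affine h x : eval_affine (opp_affine h) x = - eval_affine h x.
Proof.
by rewrite /eval_affine map_mxN mulmxN mxE opprK opprB addrC.
Qed.

Lemma eval_affine_combination h (t : R) x y :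
  eval_affine h (x + t *: (y - x)) =
  eval_affine h x + t * (eval_affine h y - eval_affine h x).
Proof.
rewrite /eval_affine mulmxDl -scalemxAl mulmxBl !mxE.
by ring.
Qed.

(* [weaker_signs hs x y]: [y] lies in the closed cell of [x] in the hyperplane
   arrangement [hs]. *)
Definition weaker_sign h x y : Prop :=
  (eval_affine h x <= 0 -> eval_affine h y <= 0) /\
  (0 <= eval_affine h x -> 0 <= eval_affine h y).

Definition weaker_signs hs x y : Prop :=
  forall h, h \in hs -> weaker_sign h x y.

Definition cell hs x : set 'rV[R]_n := [set y | weaker_signs hs x y].

Definition cell_closed hs W : Prop :=
  forall x y, weaker_signs hs x y -> W x -> W y.

Definition cells_in hs W : set (set 'rV[R]_n) := cell hs @` W.

Lemma weaker_signs_refl hs x : weaker_signs hs x x.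
Proof. by move=> h _; split. Qed.

Lemma weaker_signs_trans hs x y z :
  weaker_signs hs x y -> weaker_signs hs y z -> weaker_signs hs x z.
Proof. by move=> xy yz h hh; have [? ?] := xy h hh; have [? ?] := yz h hh; split; auto. Qed.

Lemma cell_closed_sub hs hs' W : {subset hs <= hs'} -> cell_closed hs W ->
  cell_closed hs' W.
Proof. by move=> sub cW x y xy; apply: cW => h hh; apply/xy/sub. Qed.

Lemma cell_closedI hs V W : cell_closed hs V -> cell_closed hs W ->
  cell_closed hs (V `&` W).
Proof. by move=> cV cW x y xy [Vx Wx]; split; [apply: cV Vx | apply: cW Wx]. Qed.

Lemma cell_closedU hs V W : cell_closed hs V -> cell_closed hs W ->
  cell_closed hs (V `|` W).
Proof. by move=> cV cW x y xy [Vx|Wx]; [left; apply: cV Vx | right; apply: cW Wx]. Qed.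

Lemma cell_convex hs x y z (t : R) : 0 <= t -> t <= 1 ->
  cell hs x y -> cell hs x z -> cell hs x (y + t *: (z - y)).
Proof.
move=> t0 t1 xy xz h hh; rewrite /weaker_sign eval_affine_combination.
have [xy1 xy2] := xy h hh; have [xz1 xz2] := xz h hh.
split=> hx.
  by move: (xy1 hx) (xz1 hx); nra.
by move: (xy2 hx) (xz2 hx); nra.
Qed.

Lemma rational_polyhedron_seq hs :
  rational_polyhedron [set x | forall h, h \in hs -> eval_affine h x <= 0].
Proof.
exists (size hs), (\matrix_(i, j) (nth (0, 0) hs j).1 i 0),
  (\row_j (nth (0, 0) hs j).2).
have colE x (j : 'I_(size hs)) :
    (x *m map_mx ratr (\matrix_(i, j) (nth (0, 0) hs j).1 i 0)) 0 j =
    (x *m map_mx ratr (nth (0, 0) hs j).1) 0 0.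
  by rewrite !mxE; apply: eq_bigr => k _; rewrite !mxE.
apply/seteqP; split=> x /= Hx.
  move=> j; rewrite colE !mxE -subr_le0.
  have := Hx _ (mem_nth (0, 0) (ltn_ord j)).
  by rewrite /eval_affine mxE.
move=> h /(nthP (0, 0)) [j jlt <-].
by have := Hx (Ordinal jlt); rewrite colE !mxE -subr_le0 /eval_affine mxE.
Qed.

Lemma rational_polyhedronW (P : set 'rV[R]_n) :
  rational_polyhedron P -> polyhedron P.
Proof. by move=> [m [A [b ->]]]; exists m, (map_mx ratr A), b. Qed.

Lemma cell_rational hs x : rational_polyhedron (cell hs x).
Proof.
pose s := [seq h <- hs ++ map opp_affine hs | eval_affine h x <= 0].
suff -> : cell hs x = [set y | forall h, h \in s -> eval_affine h y <= 0].
  exact: rational_polyhedron_seq.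
apply/seteqP; split=> y /= Hy.
  move=> h; rewrite mem_filter mem_cat => /andP[hx /orP[hh|/mapP[h' hh' hE]]].
    by have [+ _] := Hy h hh; exact.
  subst h; move: hx; rewrite !eval_opp_affine !oppr_le0.
  by have [_] := Hy h' hh'; exact.
move=> h hh; split=> hx.
  by apply: Hy; rewrite mem_filter hx mem_cat hh.
rewrite -oppr_le0 -eval_opp_affine; apply: Hy.
by rewrite mem_filter eval_opp_affine oppr_le0 hx mem_cat map_f ?orbT.
Qed.

(** A cell depends only on the sign vector of its point, and there are finitely many of those. *)
Lemma finite_cells hs W : finite_set (cells_in hs W).
Proof.
pose sg x : (size hs).-tuple (bool * bool) :=
  [tuple of map (fun h => (eval_affine h x <= 0, 0 <= eval_affine h x)) (in_tuple hs)].
pose C (s : (size hs).-tuple (bool * bool)) : set 'rV[R]_n :=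
  [set y | forall i : 'I_(size hs),
     ((tnth s i).1 -> eval_affine (tnth (in_tuple hs) i) y <= 0) /\
     ((tnth s i).2 -> 0 <= eval_affine (tnth (in_tuple hs) i) y)].
have cellE x : cell hs x = C (sg x).
  apply/seteqP; split=> y /= Hy.
    by move=> i; rewrite tnth_map /=; apply: Hy; rewrite (mem_tnth i (in_tuple hs)).
  move=> h hh; have /tnthP[i ->] : h \in in_tuple hs by [].
  by have := Hy i; rewrite tnth_map.
apply: (@sub_finite_set _ _ (C @` [set: (size hs).-tuple (bool * bool)])).
  by move=> _ [x _ <-]; exists (sg x) => //; rewrite cellE.
exact/finite_image/finite_finset.
Qed.

(** Minimizing this number over a face picks a point of its relative interior. *)
Definition zeros hs x : nat := count (fun h => eval_affine h x == 0) hs.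

(** Take [y] in [F] on the fewest walls. Every wall through [y] then contains [F], so [F] lies in
    the cell of [y]; conversely, the functional maximal at the relatively interior point [y] is
    constant on that cell. *)
Lemma face_cell hs x F : face F (cell hs x) -> exists2 y, F y & F = cell hs y.
Proof.
move=> [[y0 Fy0] [a FE]].
have FP y : F y <-> cell hs x y /\
    forall u, cell hs x u -> (u *m a) 0 0 <= (y *m a) 0 0 by rewrite FE.
have [y Fy ymin] : exists2 y, F y & forall z, F z -> (zeros hs y <= zeros hs z)%N.
  pose p k := `[< exists2 y, F y & zeros hs y = k >].
  have ex_p : exists k, p k by exists (zeros hs y0); apply/asboolP; exists y0.
  case: (ex_minnP ex_p) => k /asboolP[y Fy <-] kmin; exists y => // z Fz.
  by apply: kmin; apply/asboolP; exists z.
exists y => //.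
have [xy ymax] := (FP y).1 Fy.
have zero_on_F h z : h \in hs -> eval_affine h y = 0 -> F z -> eval_affine h z = 0.
  move=> hh hy Fz; have [xz zmax] := (FP z).1 Fz.
  have [//|hz] := eqVneq (eval_affine h z) 0; exfalso.
  (* Since [y] and [z] lie weakly on the same side of each wall, the midpoint is on a wall only if
     both are. It would lie on fewer walls than [y]. *)
  pose m := y + 2^-1 *: (z - y).
  have Fm : F m.
    apply/FP; split; first by apply: cell_convex => //; lra.
    move=> u xu; rewrite /m mulmxDl -scalemxAl mulmxBl !mxE.
    have := ymax _ xu; have := zmax _ xu; rewrite !mxE; lra.
  have mE h' : eval_affine h' m = (eval_affine h' y + eval_affine h' z) / 2.
    by rewrite eval_affine_combination; lra.
  suff : (zeros hs m < zeros hs y)%N by rewrite ltnNge ymin.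
  apply: (@count_ltn _ _ _ _ h) => //=; last first.
  - by rewrite mE hy add0r mulf_neq0 ?invr_neq0.
  - by rewrite hy.
  move=> h' hh' /=; rewrite mE => /eqP hm.
  have [xy1 xy2] := xy h' hh'; have [xz1 xz2] := xz h' hh'.
  apply/eqP; have /orP[hx|hx] := le_total (eval_affine h' x) 0.
    by move: (xy1 hx) (xz1 hx); lra.
  by move: (xy2 hx) (xz2 hx); lra.
apply/seteqP; split=> z Hz.
  move=> h hh; have [xz1 xz2] := ((FP z).1 Hz).1 h hh; have [xy1 xy2] := xy h hh.
  have [hy|hy|hy] := ltgtP (eval_affine h y) 0.
  - split=> hy'; last by move: (lt_le_trans hy hy'); rewrite ltxx.
    apply: xz1; rewrite leNgt; apply/negP => hx.
    by have := xy2 (ltW hx); rewrite leNgt hy.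
  - split=> hy'; first by move: (lt_le_trans hy hy'); rewrite ltxx.
    apply: xz2; rewrite leNgt; apply/negP => hx.
    by have := xy1 (ltW hx); rewrite leNgt hy.
  - by rewrite /weaker_sign (zero_on_F h z hh hy Hz) lexx.
have xz : cell hs x z := weaker_signs_trans xy Hz.
apply/(FP z); split=> // u xu.
(* The segment from [z] to [y] can be prolonged beyond [y] inside the cell; as the functional does
   not increase there, [z] does no worse than [y]. *)
suff [d d0 xd] : exists2 d : R, 0 < d & cell hs x (y + d *: (y - z)).
  have := ymax _ xd; rewrite mulmxDl -scalemxAl mulmxBl !mxE.
  have := ymax _ xu; rewrite !mxE; move: (\sum_j _) (\sum_j _) (\sum_j _) => p q r.
  by nra.
have shift d h : eval_affine h (y + d *: (y - z)) =
    eval_affine h y + d * (eval_affine h y - eval_affine h z).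
  have := eval_affine_combination h (- d) y z.
  by rewrite scaleNr -scalerN opprB => ->; ring.
suff [d d0 xd] : exists2 d : R, 0 < d &
    forall h, h \in hs -> weaker_sign h y (y + d *: (y - z)).
  by exists d => //; apply: weaker_signs_trans xy _.
apply: common_small => h hh; have [hz1 hz2] := Hz h hh.
have [hy|hy|hy] := ltgtP (eval_affine h y) 0.
- exists (- eval_affine h y / (1 + `|eval_affine h z|)).
    by rewrite divr_gt0 ?oppr_gt0 // ltr_pwDl.
  move=> e e0; rewrite ler_pdivlMr ?ltr_pwDl // => eh.
  have := ler_norm (- eval_affine h z); rewrite normrN => hz.
  by rewrite /weaker_sign shift; split; nra.
- exists (eval_affine h y / (1 + `|eval_affine h z|)).
    by rewrite divr_gt0 // ltr_pwDl.
  move=> e e0; rewrite ler_pdivlMr ?ltr_pwDl // => eh.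
  have := ler_norm (eval_affine h z) => hz.
  by rewrite /weaker_sign shift; split; nra.
- exists 1 => // e e0 _; rewrite /weaker_sign shift hy.
  by rewrite hy in hz1 hz2; move: (hz1 (lexx 0)) (hz2 (lexx 0)); split; nra.
Qed.

(** [J] consists of the walls not through [x] on which [x] and [y] do not share a strict sign; a
    common point of both cells is forced onto each of them. *)
Lemma cell_capE hs x y : exists J : seq affine,
  {subset J <= hs} /\ cell hs x `&` cell hs y =
  [set z | cell hs x z /\ forall h, h \in J -> eval_affine h z = 0].
Proof.
pose strict h := [|| (0 < eval_affine h x) && (0 < eval_affine h y),
  (eval_affine h x < 0) && (eval_affine h y < 0) | eval_affine h x == 0].
exists [seq h <- hs | ~~ strict h]; split=> [h|]; first by rewrite mem_filter => /andP[].
apply/seteqP; split=> z /= [xz yz]; split=> // h.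
  rewrite mem_filter => /andP[+ hh].
  have [xz1 xz2] := xz h hh; have [yz1 yz2] := yz h hh.
  rewrite /strict !negb_or => /and3P[n1 n2 n3]; apply: le_anti.
  have [hx|hx|hx] := ltgtP (eval_affine h x) 0; last by rewrite hx eqxx in n3.
    by rewrite (xz1 (ltW hx)) yz2 // leNgt; move: n2; rewrite hx.
  by rewrite (xz2 (ltW hx)) yz1 // leNgt; move: n1; rewrite hx.
move=> hh; have [xz1 xz2] := xz h hh; rewrite /weaker_sign.
case st : (strict h); last by rewrite (yz h) ?lexx // mem_filter st.
case/or3P: st => [/andP[hx hy]|/andP[hx hy]|/eqP hx].
- by rewrite (xz2 (ltW hx)) [_ <= 0]leNgt hy.
- by rewrite (xz1 (ltW hx)) [0 <= eval_affine h y]leNgt hy.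
- by have z0 : eval_affine h z = 0; [apply/eqP; rewrite eq_le xz1 ?xz2 ?hx|rewrite z0 lexx].
Qed.

(** Orient the normals of [J] so that each is nonpositive on the cell. Their sum is then at most 0,
    with equality only where all of them vanish. *)
Lemma face_zeros hs x (J : seq affine) : {subset J <= hs} ->
  [set z | cell hs x z /\ forall h, h \in J -> eval_affine h z = 0] !=set0 ->
  face [set z | cell hs x z /\ forall h, h \in J -> eval_affine h z = 0] (cell hs x).
Proof.
move=> JH F0; split=> //.
pose s h : R := if 0 <= eval_affine h x then -1 else 1.
exists (\sum_(h <- J) s h *: map_mx ratr h.1).
have sE z : (z *m \sum_(h <- J) s h *: map_mx ratr h.1) 0 0 =
    \sum_(h <- J) s h * eval_affine h z + \sum_(h <- J) s h * h.2.
  rewrite mulmx_sumr summxE -big_split /=; apply: eq_bigr => h _.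
  by rewrite -scalemxAr mxE /eval_affine; ring.
have s_le0 z h : cell hs x z -> h \in J -> s h * eval_affine h z <= 0.
  move=> xz hJ; have [xz1 xz2] := xz h (JH h hJ); rewrite /s.
  case: ifPn => hx; first by rewrite mulN1r oppr_le0 xz2.
  by rewrite mul1r xz1 // ltW // ltNge.
have [z0 [xz0 z00]] := F0.
apply/seteqP; split=> z /= [xz Hz]; split=> //.
  move=> y xy; rewrite !sE lerD2r [leRHS]big1_seq; last first.
    by move=> h /andP[_ hJ]; rewrite Hz ?mulr0.
  by rewrite big_seq; apply: sumr_le0 => h; apply: s_le0.
have : \sum_(h <- J) s h * eval_affine h z = 0.
  apply/le_anti/andP; split.
    by rewrite big_seq; apply: sumr_le0 => h; apply: s_le0.
  have := Hz _ xz0; rewrite !sE lerD2r big1_seq // => h /andP[_ hJ].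
  by rewrite z00 ?mulr0.
move=> + h hJ.
move/eqP; rewrite -oppr_eq0 -sumrN big_seq psumr_eq0; last first.
  by move=> k kJ; rewrite oppr_ge0 s_le0.
move=> /allP/(_ h hJ); rewrite hJ oppr_eq0 mulf_eq0 => /orP[|/eqP //].
by rewrite /s; case: ifP => _; rewrite ?oppr_eq0 oner_eq0.
Qed.

Lemma arrangement_structure hs W : cell_closed hs W ->
  complex_structure W (cells_in hs W).
Proof.
move=> cW; split; last first.
  apply/seteqP; split=> [z [_ [x Wx <-] xz]|z Wz]; first exact: cW xz Wx.
  by exists (cell hs z); [exists z|exact: weaker_signs_refl].
have cap x y : cell hs x `&` cell hs y !=set0 -> face (cell hs x `&` cell hs y) (cell hs x).
  by have [J [JH ->]] := cell_capE hs x y; apply: face_zeros.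
split.
- exact: finite_cells.
- move=> _ [x Wx <-]; split; last by exists x; exact: weaker_signs_refl.
  exact/rational_polyhedronW/cell_rational.
- move=> _ F [x Wx <-] FE0; have [y Fy FE] := face_cell FE0; exists y => //.
  by apply: cW Wx; have [_ [a FE']] := FE0; rewrite FE' in Fy; case: Fy.
- move=> _ _ [x Wx <-] [y Wy <-] xy0; split; first exact: cap.
  by rewrite setIC; apply: cap; rewrite setIC.
Qed.

Lemma cell_closed_rational_complex hs W : cell_closed hs W ->
  rational_polyhedral_complex W.
Proof.
move=> cW; exists (cells_in hs W); split; first exact: arrangement_structure.
by move=> _ [x _ <-]; exact: cell_rational.
Qed.

End SignConditions.

(** * Connected components of unions of cells *)

Section Connectedness.
Variables (R : realType) (n : nat).
Implicit Types (x y : 'rV[R]_n) (A C : set 'rV[R]_n).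

Lemma connected_segment x y : connected [set x + t *: (y - x) | t in `[0, 1]%classic].
Proof.
apply: connected_continuous_connected; first exact: segment_connected.
apply: continuous_subspaceT => t; apply: cvgD; first exact: cvg_cst.
by apply: cvgZr_tmp; exact: cvg_id.
Qed.

Lemma connected_component_segment A C x y : components A C -> C x ->
  (forall t, 0 <= t -> t <= 1 -> A (x + t *: (y - x))) -> C y.
Proof.
move=> [z Az <-] Cx sA.
rewrite (same_connected_component Cx).
apply: (@connected_component_max _ _ [set x + t *: (y - x) | t in `[0, 1]%classic]).
- by exists 0; rewrite ?scale0r ?addr0 //= in_itv /= lexx ler01.
- move=> u [t /= tI <-]; move: tI; rewrite in_itv /= => /andP[t0 t1]; exact: sA.
- exact: connected_segment.
- by exists 1; rewrite ?scale1r ?subrKC //= in_itv /= lexx ler01.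
Qed.

(** Without zeros of [f], the conditions [0 < f] and [0 <= f] agree on [C], so the positive part is
    clopen. Used to place a component on one side of a cut. *)
Lemma connected_sign C (f : 'rV[R]_n -> R) x y : connected C -> continuous f ->
  (forall z, C z -> f z != 0) -> C x -> C y -> 0 < f x -> 0 < f y.
Proof.
move=> cC cf f0 Cx Cy fx.
suff : C `&` [set z | 0 < f z] = C by move=> CE; move: Cy; rewrite -CE => -[].
apply: cC.
- by exists x.
- exists [set z | 0 < f z] => //.
  by apply: (@open_comp _ _ f [set t | 0 < t]) => [z _|]; [exact: cf|exact: open_gt].
- exists [set z | 0 <= f z].
    by apply: (@preimage_closed _ _ f [set t | 0 <= t]) => [z _|]; [exact: cf|exact: closed_ge].
  apply/seteqP; split=> z [Cz /= fz]; split=> //; first exact: ltW.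
  by rewrite lt_neqAle eq_sym f0.
Qed.

(** The segment from [x] to a point of its closed cell stays in that cell, hence in [A], so both
    ends share a component. *)
Lemma component_cell_closed hs A C : cell_closed hs A -> components A C ->
  cell_closed hs C.
Proof.
move=> cA hC x y xy Cx; apply: (connected_component_segment hC Cx) => t t0 t1.
have Ax : A x by case: hC Cx => z _ <-; exact: connected_component_sub.
by apply: cA Ax; apply: cell_convex => //; exact: weaker_signs_refl.
Qed.

Lemma connected_components A C : components A C -> connected C.
Proof. by move=> [z _ <-]; exact: component_connected. Qed.

Lemma sub_components A C : components A C -> C `<=` A.
Proof. by move=> [z _ <-]; exact: connected_component_sub. Qed.

(** Relative to [A], the set [C] is open because of [U] and closed because of [V]. *)
Lemma component_of_clopen A C (U V : set 'rV[R]_n) x : connected C -> C x ->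
  C `<=` A -> open U -> closed V -> A `&` U = C -> C `<=` V -> V `<=` U ->
  components A C.
Proof.
move=> cC Cx CA oU cV AUC CV VU; exists x; first exact: CA.
apply/seteqP; split; last exact: connected_component_max.
set D := connected_component A x.
have DA : D `<=` A by exact: connected_component_sub.
have Dx : D x by apply: connected_component_refl; exact: CA.
suff : D `&` U = D by move=> DE y Dy; rewrite -AUC; split; [exact: DA|move: Dy; rewrite -DE => -[]].
have := @component_connected _ A x; rewrite -/D => cD; apply: cD.
- by exists x; split=> //; apply/VU/CV.
- by exists U.
- exists V => //; apply/seteqP; split=> y [Dy Uy]; split=> //; last exact: VU.
  by apply: CV; rewrite -AUC; split=> //; exact: DA.
Qed.

End Connectedness.

(** * Fourier-Motzkin elimination *)

Section Elimination.
Variables (R : realType) (n : nat).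
Implicit Types (h : affine R n).

Definition combine (k l : int) (g h : affine R n) : affine R n :=
  (k%:~R *: g.1 + l%:~R *: h.1, k%:~R * g.2 + l%:~R * h.2).

Lemma eval_combine k l g h (x : 'rV[R]_n) : eval_affine (combine k l g h) x =
  k%:~R * eval_affine g x + l%:~R * eval_affine h x.
Proof.
rewrite /eval_affine map_mxD !map_mxZ !rmorph_int mulmxDr -!scalemxAr !mxE /=.
by ring.
Qed.

Implicit Types (s : seq (affine R n * int)).

(* The Fourier-Motzkin elimination of [t] from the system
   [0 < eval_affine c.1 x + t * c.2]. *)
Definition eliminants s : seq (affine R n) :=
  map fst s ++ [seq combine c.2 (- c'.2) c'.1 c.1 | c <- s, c' <- s].

Lemma strictly_between (l u : seq R) : {in l & u, forall a b, a < b} ->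
  exists t, {in l, forall a, a < t} /\ {in u, forall b, t < b}.
Proof.
move=> lu.
have [M lM Mu] : exists2 M, {in l, forall a, a <= M} & {in u, forall b, M < b}.
  elim: l lu => [_|a l IH lu].
    elim: u => [|b u [M _ IH]]; first by exists 0.
    exists (Order.min M (b - 1)) => // b'; rewrite inE gt_min => /orP[/eqP ->|/IH ->//].
    by rewrite gtrBl ltr01 orbT.
  have [|M lM Mu] := IH.
    by move=> a' b' a'l; apply: lu; rewrite inE a'l orbT.
  exists (Order.max a M).
    by move=> a'; rewrite inE le_max => /orP[/eqP ->|/lM ->]; rewrite ?lexx ?orbT.
  by move=> b bu; rewrite gt_max Mu // lu // mem_head.
have [|d d0 du] := @common_small R R u (fun b d => M + d < b).
  move=> b bu; exists ((b - M) / 2); first by rewrite divr_gt0 // subr_gt0 Mu.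
  by move=> e e0; have := Mu b bu; lra.
exists (M + d); split=> // a al; rewrite (le_lt_trans (lM a al)) // ltrDl.
exact: d0.
Qed.

(** Solvability of a strict system is an open condition, so it passes from a point of the closed
    cell back to [x]. Eliminants positive at [y] are positive at [x], and this puts every lower
    bound for [t] below every upper bound. *)
Lemma eliminated s (x y : 'rV[R]_n) : weaker_signs (eliminants s) x y ->
  (exists t : R, forall c, c \in s -> 0 < eval_affine c.1 y + t * c.2%:~R) ->
  exists t : R, forall c, c \in s -> 0 < eval_affine c.1 x + t * c.2%:~R.
Proof.
move=> xy [t ty].
have pos h : h \in eliminants s -> 0 < eval_affine h y -> 0 < eval_affine h x.
  move=> hs hy; rewrite ltNge; apply/negP => hx.
  by have := (xy h hs).1 hx; rewrite leNgt hy.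
pose bound (c : affine R n * int) := - eval_affine c.1 x / c.2%:~R.
have [|t' [lt' ut']] := @strictly_between
    [seq bound c | c <- s & (0 < c.2)] [seq bound c | c <- s & (c.2 < 0)].
  move=> _ _ /mapP[c + ->] /mapP[c' + ->].
  rewrite !mem_filter => /andP[c0 cs] /andP[c'0 c's].
  have k0 : 0 < c.2%:~R :> R by rewrite ltr0z.
  have l0 : c'.2%:~R < 0 :> R by rewrite ltrz0.
  have : 0 < eval_affine (combine c.2 (- c'.2) c'.1 c.1) x.
    apply: pos.
      by rewrite mem_cat; apply/orP; right; apply/allpairsP; exists (c, c').
    rewrite eval_combine rmorphN /=.
    have := ty _ cs; have := ty _ c's; nra.
  rewrite eval_combine rmorphN /= /bound => Hx.
  rewrite ltr_pdivrMr // mulrAC ltr_ndivlMr //; lra.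
exists t' => c cs; have [c0|c0|c0] := ltgtP c.2 0.
- have := ut' (bound c); rewrite map_f ?mem_filter ?c0 // => /(_ isT).
  have k0 : c.2%:~R < 0 :> R by rewrite ltrz0.
  by rewrite /bound ltr_ndivlMr //; lra.
- have := lt' (bound c); rewrite map_f ?mem_filter ?c0 // => /(_ isT).
  have k0 : 0 < c.2%:~R :> R by rewrite ltr0z.
  by rewrite /bound ltr_pdivrMr //; lra.
- rewrite c0 mulr0 addr0; apply: pos; first by rewrite mem_cat map_f.
  by have := ty c cs; rewrite c0 mulr0 addr0.
Qed.

End Elimination.

(** * Slopes of convex piecewise linear functions *)

Section Slopes.
Variable A : finType.
Implicit Types (S : {set A}) (f : A -> int).

(** For the maximizers of a convex piecewise linear function at a point, [top] is the slope after
    the point and [bot] the slope before it. The default 0 concerns only empty [S]. *)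
Definition top S f : int :=
  if [pick a in S] is Some a0 then f [arg max_(a > a0 in S) f a]%O else 0.

Definition bot S f : int := - top S (fun a => - f a).

Lemma top_attained S f a : a \in S -> exists2 b, b \in S & top S f = f b.
Proof.
rewrite /top; case: pickP => [a0 a0S _|/(_ a) /= ->] //.
by case: arg_maxP => // b bS _; exists b.
Qed.

Lemma top_ge S f a : a \in S -> f a <= top S f.
Proof.
rewrite /top; case: pickP => [a0 a0S aS|/(_ a) /= ->] //.
by case: arg_maxP => // b bS; exact.
Qed.

Lemma top_eq S f a : a \in S -> (forall b, b \in S -> f b <= f a) -> top S f = f a.
Proof.
move=> aS fa; apply: le_anti; rewrite top_ge // andbT.
by have [b bS ->] := top_attained f aS; exact: fa.
Qed.

Lemma bot_attained S f a : a \in S -> exists2 b, b \in S & bot S f = f b.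
Proof.
move=> aS; have [b bS E] := top_attained (fun a => - f a) aS.
by exists b; rewrite // /bot E opprK.
Qed.

Lemma bot_le S f a : a \in S -> bot S f <= f a.
Proof. by move=> aS; rewrite /bot lerNl; exact: (top_ge (fun a => - f a)). Qed.

Lemma bot_eq S f a : a \in S -> (forall b, b \in S -> f a <= f b) -> bot S f = f a.
Proof.
move=> aS fa; rewrite /bot (@top_eq _ (fun a => - f a) a) ?opprK //.
by move=> b bS; rewrite lerN2; exact: fa.
Qed.

Lemma bot_le_top S f a : a \in S -> bot S f <= top S f.
Proof. by move=> aS; exact: le_trans (bot_le f aS) (top_ge f aS). Qed.

Lemma eq_top S f g : f =1 g -> top S f = top S g.
Proof.
move=> fg; case: (set_0Vmem S) => [->|[a aS]].
  by rewrite /top; case: pickP => // x; rewrite inE.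
have [b bS E] := top_attained g aS; rewrite E -fg; apply: top_eq => // c cS.
by rewrite !fg -E top_ge.
Qed.

Lemma top1 a f : top [set a] f = f a.
Proof. by apply: top_eq => [|b]; rewrite ?set11 // => /set1P ->. Qed.

End Slopes.

(** Base case and, below, inductive step of the parity count in [breaks_between]: either the
    predicate keeps its value, or it changes where [p - x] is even. *)
Lemma even_increment_flat (b b' : bool) (p x : int) :
  b = b' \/ (2 %| p - x)%Z ->
  (2 %| (if b then p - x else 0) + (if b' then x - p else 0) - 0)%Z.
Proof.
case=> [->|/dvdzP[k kE]]; apply/dvdzP; first by exists 0; case: b'; lia.
by case: b; case: b'; [exists 0|exists k|exists (- k)|exists 0]; lia.
Qed.

Lemma even_increment_step (b b' : bool) (p x y z s : int) :
  b = b' \/ (2 %| p - x)%Z -> (2 %| (if b' then p - y else 0) + z - s)%Z ->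
  (2 %| (if b then p - x else 0) + z - (if b' then y - x + s else s))%Z.
Proof.
move=> bb' /dvdzP[k kE]; apply/dvdzP; case: bb' => [->|/dvdzP[j jE]].
  by exists k; case: b' kE; lia.
by move: kE; case: b; case: b' => kE; [exists k|exists (k + j)|exists (k - j)|exists k]; lia.
Qed.

Section ConvexPiecewiseLinear.
Variables (R : realType) (A : finType) (S : {set A}) (alpha : A -> R) (beta : A -> int).

Definition line (t : R) (a : A) : R := alpha a + t * (beta a)%:~R.

Definition argmaxes (t : R) : {set A} :=
  [set a in S | [forall (b | b \in S), line t b <= line t a]]%SET.

Lemma argmaxesP t a : reflect
  (a \in S /\ forall b, b \in S -> line t b <= line t a) (a \in argmaxes t).
Proof.
rewrite inE; apply: (iffP andP) => -[aS].
  by move/forall_inP=> ta; split.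
by move=> ta; split => //; apply/forall_inP.
Qed.

Lemma argmaxes_neq0 t a : a \in S -> exists b, b \in argmaxes t.
Proof.
move=> aS; case: (@arg_maxP _ _ _ a (mem S) (line t) aS) => b bS bmax.
by exists b; apply/argmaxesP.
Qed.

Definition break (t : R) : bool := bot (argmaxes t) beta < top (argmaxes t) beta.

Lemma lineD s t a : line t a = line s a + (t - s) * (beta a)%:~R.
Proof. by rewrite /line; ring. Qed.

(** Flatter lines fall behind [a] at once, and steeper ones that have not passed it at [t1] are
    strictly below before; only ties of equal slope survive in between. *)
Lemma slope_between t0 t1 a : t0 < t1 ->
  a \in argmaxes t0 -> beta a = top (argmaxes t0) beta ->
  (forall b, b \in S -> beta a < beta b -> line t1 b <= line t1 a) ->
  [/\ a \in argmaxes t1, bot (argmaxes t1) beta = beta a &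
    forall t, t0 < t -> t < t1 ->
      argmaxes t = [set b in argmaxes t0 | beta b == beta a]%SET].
Proof.
move=> t01 /argmaxesP[aS a0] atop a1.
have lt1 b : b \in S -> beta b < beta a -> line t1 b < line t1 a.
  move=> bS; rewrite -(ltr_int R) => ba; have := a0 b bS.
  by rewrite !(lineD t0 t1); nra.
have eq01 b t : beta b = beta a -> line t b - line t a = line t0 b - line t0 a.
  by move=> ba; rewrite !(lineD t0 t) ba; ring.
have aM1 : a \in argmaxes t1.
  apply/argmaxesP; split=> // b bS.
  have [ba|ba|ba] := ltgtP (beta b) (beta a); first exact/ltW/lt1.
    exact: a1.
  by have := a0 b bS; rewrite -subr_le0 -(eq01 _ t1 ba) subr_le0.
split=> //.
  apply: bot_eq => // b /argmaxesP[bS bmax]; rewrite leNgt; apply/negP => ba.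
  by have := bmax a aS; rewrite leNgt lt1.
move=> t t0t tt1; apply/setP => b; rewrite [RHS]inE.
apply/idP/idP.
  move=> /argmaxesP[bS bt].
  have := bt a aS => ab.
  have ba : beta b = beta a.
    have [ba|ba|//] := ltgtP (beta b) (beta a); exfalso; move: (ba); rewrite -(ltr_int R) => ba'.
      by have := a0 b bS; move: ab; rewrite !(lineD t0 t); nra.
    by have := a1 b bS ba; move: ab; rewrite !(lineD t t1); nra.
  rewrite ba eqxx andbT; apply/argmaxesP; split=> // d dS.
  apply: le_trans (a0 d dS) _; rewrite -subr_ge0 -(eq01 _ t ba) subr_ge0.
  exact: ab.
move=> /andP[/argmaxesP[bS b0] /eqP ba]; apply/argmaxesP; split=> // d dS.
have {}ab : line t b = line t a.
  apply/eqP; rewrite -subr_eq0 (eq01 _ t ba) subr_eq0; apply/eqP.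
  by apply: le_anti; rewrite a0 ?b0.
rewrite ab; have [da|da|da] := ltgtP (beta d) (beta a).
- by move: da; rewrite -(ltr_int R) => da; have := a0 d dS; rewrite !(lineD t0 t); nra.
- have := a1 d dS da; move: da; rewrite -(ltr_int R) => da.
  by rewrite !(lineD t t1); nra.
- by have := a0 d dS; rewrite -subr_le0 -(eq01 _ t da) subr_le0.
Qed.

Lemma top_le_bot t0 t1 a0 : a0 \in S -> t0 < t1 ->
  top (argmaxes t0) beta <= bot (argmaxes t1) beta.
Proof.
move=> a0S t01.
have [a1 /(top_attained beta)[a aM ->]] := argmaxes_neq0 t0 a0S.
have [b1 /(bot_attained beta)[b bM ->]] := argmaxes_neq0 t1 a0S.
have [aS amax] := argmaxesP _ _ aM; have [bS bmax] := argmaxesP _ _ bM.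
rewrite -(ler_int R); have := amax b bS; have := bmax a aS.
by rewrite !(lineD t0 t1); nra.
Qed.

(** Follow a steepest maximizer [a] at [t0]: the next break occurs when the first steeper line
    catches up, unless that is not before [t1]. *)
Lemma next_break t0 t1 a0 : a0 \in S -> t0 < t1 ->
  exists t, [/\ t0 < t, t <= t1, bot (argmaxes t) beta = top (argmaxes t0) beta,
    t < t1 -> break t &
    [/\ forall s, t0 < s -> s < t -> argmaxes s =
      [set b in argmaxes t0 | beta b == top (argmaxes t0) beta]%SET &
    [set b in argmaxes t0 | beta b == top (argmaxes t0) beta]%SET \subset argmaxes t]].
Proof.
move=> a0S t01; have [a1 a1M] := argmaxes_neq0 t0 a0S.
have [a aM atop] := top_attained beta a1M.
have [aS amax] := argmaxesP _ _ aM.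
(* The time at which the steeper line [b] meets [a]. *)
pose tau b := t0 + (line t0 a - line t0 b) / (beta b - beta a)%:~R.
have tauP b t : b \in S -> beta a < beta b -> (line t b <= line t a) = (t <= tau b).
  move=> bS; rewrite -subr_gt0 -(ltr_int R) => k0.
  rewrite /tau -[RHS]lerBlDl ler_pdivlMr // !(lineD t0 t) rmorphB /=.
  by apply/idP/idP; lra.
have tau_gt b : b \in S -> beta a < beta b -> t0 < tau b.
  move=> bS ab; rewrite ltrDl divr_gt0 ?ltr0z ?subr_gt0 //.
  rewrite lt_neqAle amax // andbT; apply/negP => /eqP E.
  have : b \in argmaxes t0 by apply/argmaxesP; split=> // d; rewrite E; exact: amax.
  by move=> /(top_ge beta); rewrite atop leNgt ab.
have conclude t : t0 < t ->
    (forall b, b \in S -> beta a < beta b -> line t b <= line t a) ->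
    [/\ bot (argmaxes t) beta = top (argmaxes t0) beta,
      forall s, t0 < s -> s < t -> argmaxes s =
      [set b in argmaxes t0 | beta b == top (argmaxes t0) beta]%SET &
      [set b in argmaxes t0 | beta b == top (argmaxes t0) beta]%SET \subset argmaxes t].
  move=> t0t /(slope_between t0t aM (esym atop))[aMt bE sE]; rewrite atop; split=> //.
  apply/fintype.subsetP => b; rewrite inE => /andP[/argmaxesP[bS b0] /eqP ba].
  have [_ at_] := argmaxesP _ _ aMt.
  apply/argmaxesP; split=> // d /at_ /le_trans; apply.
  rewrite !(lineD t0 t) ba lerD2r; exact: b0.
pose B := [set b in S | (beta a < beta b) && (tau b < t1)]%SET.
case: (set_0Vmem B) => [B0|[b0 b0B]].
  have [|bE sE sub] := conclude t1 t01.
    move=> b bS ab; rewrite tauP // leNgt; apply/negP => tb.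
    by have : b \in B; [rewrite inE bS ab|rewrite B0 inE].
  by exists t1; split=> //; rewrite ltxx.
have [b bB bmin] : exists2 b, b \in B & forall d, d \in B -> tau b <= tau d.
  by case: (@arg_minP _ _ _ b0 (mem B) tau b0B) => b bB bmin; exists b.
have := bB; rewrite inE => /and3P[bS ab tb].
have [|bE sE sub] := conclude (tau b) (tau_gt b bS ab).
  move=> d dS ad; rewrite tauP //; case: (ltP (tau d) t1) => dt.
    by apply: bmin; rewrite inE dS ad.
  exact: le_trans (ltW tb) dt.
exists (tau b); split=> //; [exact: tau_gt|exact: ltW|move=> _].
have aMt : a \in argmaxes (tau b).
  by apply: (fintype.subsetP sub); rewrite inE aM atop eqxx.
rewrite /break bE atop; apply: (lt_le_trans ab); apply: top_ge.
have [_ at_] := argmaxesP _ _ aMt.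
have tab : line (tau b) a <= line (tau b) b.
  have k0 : (beta b - beta a)%:~R != 0 :> R.
    by rewrite intr_eq0 subr_eq0 (gt_eqF ab).
  move: k0; rewrite rmorphB /= => k0.
  suff : (tau b - t0) * ((beta b)%:~R - (beta a)%:~R) = line t0 a - line t0 b.
    by rewrite !(lineD t0 (tau b)); lra.
  by rewrite /tau addrAC subrr add0r rmorphB /= mulfVK.
by apply/argmaxesP; split=> // d /at_ /le_trans; apply.
Qed.

(* If [p - beta a] is even whenever [a] is the only maximizer at some point, the increments telescope
   modulo 2 even when only the breaks in [P] are counted, since [P] changes only at such points. *)
Lemma breaks_between (t0 t1 : R) a0 : a0 \in S -> t0 < t1 ->
  exists ts : seq R, [/\ uniq ts,
    forall t, (t \in ts) = [&& t0 < t, t < t1 & break t],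
    \sum_(t <- ts) (top (argmaxes t) beta - bot (argmaxes t) beta) =
      bot (argmaxes t1) beta - top (argmaxes t0) beta &
    forall (P : pred R) (p : int),
      (forall s t, t0 <= s -> s < t -> t <= t1 ->
        (forall r, s <= r -> r <= t -> (1 < #|argmaxes r|)%N) -> P s = P t) ->
      (forall t a, t0 < t -> t < t1 -> argmaxes t = [set a]%SET ->
        (2 %| p - beta a)%Z) ->
      (2 %| (if P t0 then p - top (argmaxes t0) beta else 0)
          + (if P t1 then bot (argmaxes t1) beta - p else 0)
          - \sum_(t <- ts | P t) (top (argmaxes t) beta - bot (argmaxes t) beta))%Z].
Proof.
move=> a0S.
(* Each break raises the integral slope by at least one, so the slope gained between [t0] and [t1]
   bounds the number of breaks. *)
have [n] := ubnP `|bot (argmaxes t1) beta - top (argmaxes t0) beta|%N.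
elim: n t0 => // n IH t0 nlt t01.
have [t [t0t tt1 bE brk [const sub]]] := next_break a0S t01.
have [a1 a1M] := argmaxes_neq0 t0 a0S.
have [a aM atop] := top_attained beta a1M.
set M' := [set b in argmaxes t0 | beta b == top (argmaxes t0) beta]%SET in const sub.
have aM' : a \in M' by rewrite inE aM atop /=.
have M'0 : M' \subset argmaxes t0 by apply/fintype.subsetP => b; rewrite inE => /andP[].
(* Up to the next break the maximizers are constantly [M']. If there are several, [P] cannot change;
   if [a] is the only one, its slope has the parity of [p]. *)
have parity (P : pred R) (p : int) :
    (forall s u, t0 <= s -> s < u -> u <= t1 ->
       (forall r, s <= r -> r <= u -> (1 < #|argmaxes r|)%N) -> P s = P u) ->
    (forall s b, t0 < s -> s < t1 -> argmaxes s = [set b]%SET -> (2 %| p - beta b)%Z) ->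
    P t0 = P t \/ (2 %| p - top (argmaxes t0) beta)%Z.
  move=> sat par; have [M'1|M'1] := ltnP 1 #|M'|.
    left; apply: sat => // r; rewrite le_eqVlt => /orP[/eqP <- _|t0r].
      exact: leq_trans M'1 (subset_leq_card M'0).
    rewrite le_eqVlt => /orP[/eqP ->|rt].
      exact: leq_trans M'1 (subset_leq_card sub).
    by rewrite const.
  right; rewrite atop.
  have M'E : M' = [set a]%SET.
    by apply/esym/eqP; rewrite eqEcard finset.sub1set aM' cards1.
  apply: (par ((t0 + t) / 2)); [lra| |rewrite const //; lra].
  apply: lt_le_trans tt1; lra.
have small s : t0 < s -> s < t -> break s = false.
  move=> t0s st; rewrite /break (const s t0s st).
  have bM' b : b \in M' -> beta b = beta a by rewrite inE -atop => /andP[_ /eqP].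
  rewrite (@bot_eq _ _ _ a) // ?(@top_eq _ _ _ a) ?ltxx // => b /bM' -> //.
have [tE|tlt] : t = t1 \/ t < t1.
  by move: tt1; rewrite le_eqVlt => /orP[/eqP|]; [left|right].
  subst t; exists [::]; split=> //.
  - by move=> s; apply/esym/negP => /and3P[? ?]; rewrite small.
  - by rewrite big_nil bE subrr.
  - move=> P p sat par; rewrite big_nil bE.
    exact: even_increment_flat (parity P p sat par).
have brkt := brk tlt.
have [|ts [uts tsE tsum tpar]] := IH t _ tlt.
  have := top_le_bot a0S tlt; have := top_le_bot a0S t01.
  by move: brkt nlt; rewrite /break bE; lia.
have tnotin : t \notin ts by rewrite tsE ltxx.
exists (t :: ts); split.
- by rewrite /= tnotin.
- move=> s; rewrite inE tsE; have [st|st|->] := ltgtP s t.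
  + by case: (ltP t0 s) => // t0s; rewrite small ?andbF.
  + by rewrite (lt_trans t0t st).
  + by rewrite t0t tlt brkt.
- by rewrite big_cons tsum bE; ring.
- move=> P p sat par; rewrite big_cons.
  rewrite bE; apply: even_increment_step (parity P p sat par) _.
  apply: tpar => [s u ts' |s b ts'].
  - by apply: sat; apply: le_trans ts'; exact: ltW.
  - by apply: par; apply: lt_trans ts'.
Qed.

Lemma eventually_steepest t0 a0 : a0 \in S -> exists T, t0 < T /\
  forall t, T <= t -> bot (argmaxes t) beta = top S beta.
Proof.
move=> a0S; pose N := \sum_a `|alpha a|.
have N_ge a : `|alpha a| <= N by rewrite /N (bigD1 a) //= lerDl sumr_ge0.
(* The slopes are integers, so a steeper line gains at least [t] on a flatter one, and the values at
   0 differ by at most [N + N]. The rest makes [T] exceed [t0]. *)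
exists (`|t0| + 1 + (N + N)); split=> [|t Tt].
  by have := ler_norm t0; have := N_ge a0; have := normr_ge0 (alpha a0); lra.
have [a aS atop] := top_attained beta a0S.
have [b1 /(bot_attained beta)[b bM ->]] := argmaxes_neq0 t a0S.
have [bS bmax] := argmaxesP _ _ bM; rewrite atop; apply: le_anti.
rewrite -{1}atop top_ge //= leNgt; apply/negP => ba.
have := bmax a aS; have : 1 <= (beta a)%:~R - (beta b)%:~R :> R.
  by rewrite -rmorphB /= ler1z; lia.
have := ler_norm (- alpha b); have := ler_norm (alpha b); have := ler_norm (- alpha a).
rewrite /line !normrN; have := N_ge a; have := N_ge b; have := normr_ge0 t0; nra.
Qed.

(** Beyond some [T] the slope is constantly [top S beta]. With [p] equal to this slope, the boundary
    term at [T] vanishes whatever [P T] is. *)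
Lemma breaks_after (t0 : R) a0 : a0 \in S ->
  exists ts : seq R, [/\ uniq ts,
    forall t, (t \in ts) = (t0 < t) && break t,
    \sum_(t <- ts) (top (argmaxes t) beta - bot (argmaxes t) beta) =
      top S beta - top (argmaxes t0) beta &
    forall (P : pred R),
      (forall s t, t0 <= s -> s < t ->
        (forall r, s <= r -> r <= t -> (1 < #|argmaxes r|)%N) -> P s = P t) ->
      (forall t a, t0 < t -> argmaxes t = [set a]%SET -> (2 %| top S beta - beta a)%Z) ->
      (2 %| (if P t0 then top S beta - top (argmaxes t0) beta else 0)
          - \sum_(t <- ts | P t) (top (argmaxes t) beta - bot (argmaxes t) beta))%Z].
Proof.
move=> a0S; have [T [t0T steep]] := eventually_steepest t0 a0S.
have [ts [uts tsE tsum tpar]] := breaks_between a0S t0T.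
exists ts; split=> //.
- move=> t; rewrite tsE; case: (ltP t T) => //= Tt.
  rewrite andbF; apply/esym/negP => /andP[_]; rewrite /break steep // ltNge.
  have [b1 /(top_attained beta)[b bM ->]] := argmaxes_neq0 t a0S.
  by rewrite top_ge //; case/argmaxesP: bM.
- by rewrite tsum steep.
- move=> P sat par; have := tpar P (top S beta); rewrite steep // subrr.
  rewrite [if P T then _ else _]if_same addr0; apply.
    by move=> s t t0s st _; exact: sat.
  by move=> t a t0t _; exact: par.
Qed.

Lemma breaks_after_tail (t0 t1 : R) a0 (ts : seq R) : a0 \in S -> t0 <= t1 ->
  uniq ts -> (forall t, (t \in ts) = (t0 < t) && break t) ->
  \sum_(t <- ts | t1 < t) (top (argmaxes t) beta - bot (argmaxes t) beta) =
    top S beta - top (argmaxes t1) beta.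
Proof.
move=> a0S t01 uts tsE; have [ts' [uts' ts'E <- _]] := breaks_after t1 a0S.
rewrite -big_filter; apply: perm_big; apply: uniq_perm; rewrite ?filter_uniq //.
move=> t; rewrite mem_filter tsE ts'E; case: (ltP t1 t) => //= t1t.
by rewrite (le_lt_trans t01 t1t).
Qed.

Lemma breaks_between_tail (t0 t1 t2 : R) a0 (ts : seq R) : a0 \in S ->
  t0 <= t1 -> t1 < t2 ->
  uniq ts -> (forall t, (t \in ts) = [&& t0 < t, t < t2 & break t]) ->
  \sum_(t <- ts | t1 < t) (top (argmaxes t) beta - bot (argmaxes t) beta) =
    bot (argmaxes t2) beta - top (argmaxes t1) beta.
Proof.
move=> a0S t01 t12 uts tsE; have [ts' [uts' ts'E <- _]] := breaks_between a0S t12.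
rewrite -big_filter; apply: perm_big; apply: uniq_perm; rewrite ?filter_uniq //.
move=> t; rewrite mem_filter tsE ts'E; case: (ltP t1 t) => //= t1t.
by rewrite (le_lt_trans t01 t1t).
Qed.

End ConvexPiecewiseLinear.

Section Plane.
Variable R : realType.
Implicit Types (p q : 'rV[R]_2) (y : int * int) (t : R).

Lemma ptE0 (a b : R) : pt a b 0 0 = a. Proof. by rewrite mxE. Qed.
Lemma ptE1 (a b : R) : pt a b 0 1 = b. Proof. by rewrite mxE. Qed.

Lemma rv2P p q : p 0 0 = q 0 0 -> p 0 1 = q 0 1 -> p = q.
Proof.
move=> e0 e1; apply/rowP => -[[|[|//]] ilt].
  by rewrite (_ : Ordinal ilt = 0) //; apply: val_inj.
by rewrite (_ : Ordinal ilt = 1) //; apply: val_inj.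
Qed.

Definition vec y : 'rV[R]_2 := pt y.1%:~R y.2%:~R.

Lemma addvE0 p t y : (p + t *: vec y) 0 0 = p 0 0 + t * y.1%:~R.
Proof. by rewrite !mxE. Qed.

Lemma addvE1 p t y : (p + t *: vec y) 0 1 = p 0 1 + t * y.2%:~R.
Proof. by rewrite !mxE. Qed.

End Plane.
Arguments vec {R} y.

Definition pairing y (a : 'I_4 * 'I_4) : int := a.1%:Z * y.1 + a.2%:Z * y.2.

(** * Stable multiplicities as sums of slopes *)

Section TropicalPolynomial.
Variables (R : realType) (c : 'I_4 -> 'I_4 -> R).
Implicit Types (p q x : 'rV[R]_2) (y : int * int) (t : R) (a b d : 'I_4 * 'I_4).

Lemma monomial_value_line p t y a :
  monomial_value c (p + t *: vec y) a = line (monomial_value c p) (pairing y) t a.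
Proof.
rewrite /line /monomial_value addvE0 addvE1 /pairing rmorphD !rmorphM /=.
by ring.
Qed.

Lemma maximizersP p a : reflect
  (forall b, monomial_value c p b <= monomial_value c p a) (a \in maximizers c p).
Proof. by rewrite inE; exact: forallP. Qed.

Lemma maximizers_line p t y : maximizers c (p + t *: vec y) =
  argmaxes [set: 'I_4 * 'I_4] (monomial_value c p) (pairing y) t.
Proof.
apply/setP => a; apply/maximizersP/argmaxesP => [Ha|[_ Ha] b].
  by split=> [|b _]; rewrite ?finset.in_setT // -!monomial_value_line.
by rewrite !monomial_value_line Ha ?finset.in_setT.
Qed.

Lemma maximizers_neq0 p : exists a, a \in maximizers c p.
Proof.
have [a aM] := argmaxes_neq0 (monomial_value c p) (pairing (0, 0)) 0
  (finset.in_setT (ord0, ord0)).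
by exists a; rewrite -maximizers_line scale0r addr0 in aM.
Qed.

Lemma area2_pairing a b d :
  area2 a b d = pairing (a.2%:Z - b.2%:Z, b.1%:Z - a.1%:Z) d
              - pairing (a.2%:Z - b.2%:Z, b.1%:Z - a.1%:Z) a.
Proof. by rewrite /area2 /pairing /=; ring. Qed.

Lemma exists_area2_neq0 a b : a != b -> exists d, area2 a b d != 0.
Proof.
pose other (i : 'I_4) : 'I_4 := if i == ord0 then lift ord0 ord0 else ord0.
have otherP i : other i != i by rewrite /other; case: (eqVneq i ord0) => [->|i0]; rewrite // eq_sym.
have neq (i j : 'I_4) : i != j -> j%:Z - i%:Z != 0.
  by move=> ij; rewrite subr_eq0 eq_sym.
case: a b => a1 a2 [b1 b2]; rewrite xpair_eqE negb_and => ab.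
have [ab1|ab1] := eqVneq a1 b1.
  rewrite ab1 eqxx /= in ab; exists (other a1, a2); rewrite /area2 /= ab1.
  by rewrite !subrr mulr0 sub0r oppr_eq0 mulf_neq0 // neq // eq_sym otherP.
exists (a1, other a2); rewrite /area2 /= !subrr mulr0 subr0.
by rewrite mulf_neq0 // neq // eq_sym otherP.
Qed.

(** Smoothness speaks of vertices only; this lemma brings it to edges. If all maximizers are
    collinear, move along the dual edge until a further monomial joins them. *)
Lemma extend_to_vertex p a b : a \in maximizers c p -> b \in maximizers c p ->
  a != b -> exists q, maximizers c p \subset maximizers c q /\
    two_dimensional (maximizers c q).
Proof.
move=> aM bM ab.
have [tw|ntw] := pselect (two_dimensional (maximizers c p)); first by exists p.
have area0 d : d \in maximizers c p -> area2 a b d = 0.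
  by move=> dM; apply: contrapT => /eqP abd; apply: ntw; exists a, b, d.
have [x abx] := exists_area2_neq0 ab.
pose u0 : int * int := (a.2%:Z - b.2%:Z, b.1%:Z - a.1%:Z).
(* Orthogonal to [b - a], so no maximizer at [p] gains on another, and oriented towards an exponent
   [x] off their line, so that a break must come. *)
pose u : int * int := if 0 < area2 a b x then u0 else (- u0.1, - u0.2).
have uE d : pairing u d - pairing u a = if 0 < area2 a b x then area2 a b d else - area2 a b d.
  rewrite /u; case: ifP => _; rewrite area2_pairing //.
  by rewrite /pairing /=; ring.
have ux : pairing u a < pairing u x.
  by rewrite -subr_gt0 uE; case: ifP => // /negbT; rewrite -leNgt oppr_gt0 lt_neqAle abx.
have M0 : argmaxes [set: 'I_4 * 'I_4] (monomial_value c p) (pairing u) 0 = maximizers c p.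
  by rewrite -maximizers_line scale0r addr0.
have Mpair d : d \in maximizers c p -> pairing u d = pairing u a.
  by move=> /area0 d0; apply/eqP; rewrite -subr_eq0 uE d0 oppr0 if_same.
have topE : top (maximizers c p) (pairing u) = pairing u a.
  by apply: top_eq => // d /Mpair ->.
have xT := finset.in_setT x.
have [T [T0 steep]] := eventually_steepest (monomial_value c p) (pairing u) 0 xT.
have [t [t0 tT botE brk [_ sub]]] := next_break (monomial_value c p) (pairing u) xT T0.
rewrite M0 topE -maximizers_line in botE brk sub *.
have {}sub : maximizers c p \subset maximizers c (p + t *: vec u).
  apply/fintype.subsetP => d dM; apply: (fintype.subsetP sub).
  by rewrite inE dM Mpair ?eqxx.
exists (p + t *: vec u); split=> //.
have tltT : t < T.
  rewrite lt_neqAle tT andbT; apply/negP => /eqP tE.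
  have := steep t; rewrite -maximizers_line botE tE lexx => /(_ isT) E.
  by have := top_ge (pairing u) xT; rewrite -E leNgt ux.
have := brk tltT; rewrite /break -maximizers_line botE => ltop.
have [e eM eE] := top_attained (pairing u) (fintype.subsetP sub _ aM).
exists a, b, e; split=> //; [exact: (fintype.subsetP sub)|exact: (fintype.subsetP sub)|].
move: ltop; rewrite eE -subr_gt0 uE.
by case: ifP => _; [apply: lt0r_neq0|rewrite oppr_gt0 => /ltr0_neq0].
Qed.

Hypothesis smooth : unimodular_newton_subdivision c.

Lemma triangle_area (a b d a' b' d' : 'I_4 * 'I_4) :
  a \in [set a'; b'; d']%SET -> b \in [set a'; b'; d']%SET -> d \in [set a'; b'; d']%SET ->
  a != b -> a != d -> b != d -> absz (area2 a b d) = absz (area2 a' b' d').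
Proof.
rewrite !inE -!orbA.
by move=> /or3P[] /eqP -> /or3P[] /eqP -> /or3P[] /eqP ->; rewrite ?eqxx //= => _ _ _;
  rewrite /area2; lia.
Qed.

(** Unit area is a Bezout identity, with the second side of the triangle as coefficients. *)
Lemma area2_coprime a b d : absz (area2 a b d) = 1%N ->
  coprimez (b.1%:Z - a.1%:Z) (b.2%:Z - a.2%:Z).
Proof.
rewrite /area2 => area1; apply/coprimezP.
move: (b.1%:Z - a.1%:Z) (b.2%:Z - a.2%:Z) (d.2%:Z - a.2%:Z) (d.1%:Z - a.1%:Z) area1.
move=> m n k l area1.
have [s1|s1] : m * k - n * l = 1 \/ m * k - n * l = -1 by lia.
  by exists (k, - l) => /=; rewrite -s1; ring.
by exists (- k, l) => /=; apply: oppr_inj; rewrite -s1; ring.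
Qed.

Lemma smooth_area p a b d : a \in maximizers c p -> b \in maximizers c p ->
  d \in maximizers c p -> a != b -> a != d -> b != d -> area2 a b d != 0.
Proof.
move=> aM bM dM ab ad bd; have [q [/fintype.subsetP sub tw]] := extend_to_vertex aM bM ab.
have [a' [b' [d' [ME area1]]]] := smooth tw.
have [aq bq dq] := And3 (sub a aM) (sub b bM) (sub d dM); rewrite ME in aq bq dq.
by rewrite -absz_eq0 (triangle_area aq bq dq) // area1.
Qed.

(** Every edge of the curve thus has weight one. *)
Lemma smooth_primitive p a b : a \in maximizers c p -> b \in maximizers c p ->
  a != b -> coprimez (b.1%:Z - a.1%:Z) (b.2%:Z - a.2%:Z).
Proof.
move=> aM bM ab; have [q [/fintype.subsetP sub tw]] := extend_to_vertex aM bM ab.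
have [a' [b' [d' [ME area1]]]] := smooth tw.
have [aq bq] := (sub a aM, sub b bM); rewrite ME in aq bq.
move: aq bq ab; rewrite !inE -!orbA.
move=> /or3P[] /eqP -> /or3P[] /eqP ->; rewrite ?eqxx // => _.
- by apply: (@area2_coprime _ _ d').
- by apply: (@area2_coprime _ _ b'); rewrite -area1 /area2; lia.
- by apply: (@area2_coprime _ _ d'); rewrite -area1 /area2; lia.
- by apply: (@area2_coprime _ _ a'); rewrite -area1 /area2; lia.
- by apply: (@area2_coprime _ _ b'); rewrite -area1 /area2; lia.
- by apply: (@area2_coprime _ _ a'); rewrite -area1 /area2; lia.
Qed.

End TropicalPolynomial.

(** * Uniqueness of edge directions and of stable multiplicities *)

Section StableMultiplicity.
Variable R : realType.
Implicit Types (p q x v : 'rV[R]_2) (X Y : set 'rV[R]_2) (y : int * int).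

Lemma ball2P p (r : R) x : ball p r x <->
  [/\ 0 < r, `|p 0 0 - x 0 0| < r & `|p 0 1 - x 0 1| < r].
Proof.
split=> [[r0 px]|[r0 p0 p1]]; first by split=> //; exact: px.
split=> // i [[|[|//]] jlt]; rewrite !ord1.
  by rewrite (_ : Ordinal jlt = 0) //; exact: val_inj.
by rewrite (_ : Ordinal jlt = 1) //; exact: val_inj.
Qed.

Lemma orthogonal_multiple (k l x z : R) : k != 0 \/ l != 0 -> k * x + l * z = 0 ->
  exists t, x = t * - l /\ z = t * k.
Proof.
case=> nz E.
  exists (z / k); split; last by rewrite mulfVK.
  apply: (mulfI nz); have -> : k * (z / k * - l) = - (l * z) by field.
  by lra.
exists (- x / l); split; first by field.
apply: (mulfI nz); have -> : l * (- x / l * k) = - (k * x) by field.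
by lra.
Qed.

Lemma near_line q (P : set 'rV[R]_2) (w : 'rV[R]_2) : (\forall x \near q, P x) ->
  exists2 d : R, 0 < d & forall t, `|t| < d -> P (q + t *: w).
Proof.
move=> /nbhs_ballP[r /= r0 rP].
have K0 : 0 < 1 + `|w 0 0| + `|w 0 1| by rewrite -addrA ltr_pwDl ?addr_ge0.
exists (r / (1 + `|w 0 0| + `|w 0 1|)); first by rewrite divr_gt0.
move=> t; rewrite ltr_pdivlMr // => tr; apply: rP; apply/ball2P.
have n0 := normr_ge0 (w 0 0); have n1 := normr_ge0 (w 0 1); have nt := normr_ge0 t.
by split=> //; rewrite !mxE opprD addNKr normrN normrM; nra.
Qed.

(** Take [(1, K)] with [K] above all slopes occurring in [s]; a vector with first entry 0 has no
    multiple with first entry 1. *)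
Lemma exists_generic (s : seq 'rV[R]_2) :
  exists v, forall r, r \in s -> forall t : R, v <> t *: r.
Proof.
have [|K [Ks _]] := @strictly_between R (map (fun r : 'rV[R]_2 => r 0 1 / r 0 0) s) [::].
  by [].
exists (pt 1 K) => r rs t E.
have /= E0 := congr1 (fun v : 'rV[R]_2 => v 0 0) E.
have /= E1 := congr1 (fun v : 'rV[R]_2 => v 0 1) E.
rewrite ptE0 mxE in E0; rewrite ptE1 mxE in E1.
have r0 : r 0 0 != 0 by apply/eqP => r0; move: E0; rewrite r0 mulr0 => /eqP; rewrite oner_eq0.
have tE : (r 0 0)^-1 = t by apply: (mulIf r0); rewrite mulVf.
by have := Ks _ (map_f _ rs) => /=; rewrite tE mulrC -E1 ltxx.
Qed.

Definition ivec y : 'rV[int]_2 := \row_j (if j == 0 then y.1 else y.2).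

Lemma map_ivec y : map_mx intr (ivec y) = vec y :> 'rV[R]_2.
Proof. by apply/rowP => j; rewrite !mxE; case: ifP. Qed.

Lemma primitive_multiple (u w : 'rV[int]_2) : primitive u ->
  u 0 0 * w 0 1 = u 0 1 * w 0 0 -> exists k, w 0 0 = k * u 0 0 /\ w 0 1 = k * u 0 1.
Proof.
move=> /coprimezP[[a b] /= ab1] uw; exists (a * w 0 0 + b * w 0 1); split.
  transitivity ((a * u 0 0 + b * u 0 1) * w 0 0); first by rewrite ab1 mul1r.
  by rewrite !mulrDl -!mulrA -uw; ring.
transitivity ((a * u 0 0 + b * u 0 1) * w 0 1); first by rewrite ab1 mul1r.
by rewrite !mulrDl -!mulrA uw; ring.
Qed.

(** Both line germs agree near [q], so the directions are parallel, and primitive parallel vectors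
    differ by a unit. Hence the determinant in [transversal_mult] does not depend on the choice. *)
Lemma edge_direction_unique X q u w : edge_direction X q u -> edge_direction X q w ->
  exists2 k : int, `|k|%N = 1%N & w 0 0 = k * u 0 0 /\ w 0 1 = k * u 0 1.
Proof.
move=> [pu Xu] [pw Xw].
have [t t0 [t' tE]] : exists2 t : R, 0 < t &
    exists t', t *: map_mx intr w = t' *: map_mx intr u :> 'rV[R]_2.
  have H : \forall x \near q, (exists t : R, x = q + t *: map_mx intr u) <->
                              (exists t : R, x = q + t *: map_mx intr w).
    by apply: filterS2 Xu Xw => x [h1 h2] [h3 h4]; split=> [/h2/h3|/h4/h1].
  have [d d0 dH] := near_line (map_mx intr w) H.
  exists (d / 2); first by rewrite divr_gt0.
  have [|_ [|t' /addrI ->]] := dH (d / 2).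
  - by rewrite gtr0_norm ?divr_gt0 //; lra.
  - by exists (d / 2).
  - by exists t'.
have uw : u 0 0 * w 0 1 = u 0 1 * w 0 0.
  have /= E0 := congr1 (fun v : 'rV[R]_2 => v 0 0) tE.
  have /= E1 := congr1 (fun v : 'rV[R]_2 => v 0 1) tE.
  rewrite !mxE in E0 E1; apply: (@intr_inj R); rewrite !rmorphM /=.
  by apply: (mulfI (lt0r_neq0 t0)); rewrite mulrCA E1 [RHS]mulrCA E0; ring.
have [k [k0 k1]] := primitive_multiple pu uw.
have [l [l0 l1]] := primitive_multiple pw (esym (etrans (mulrC _ _) (etrans uw (mulrC _ _)))).
have lk : l * k = 1.
  have [u00|u00] := eqVneq (u 0 0) 0; last by apply: (mulIf u00); rewrite -mulrA -k0 -l0 mul1r.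
  have u10 : u 0 1 != 0.
    apply/eqP => u10; have /coprimezP[[a b] /=] := pu.
    by rewrite u00 u10 !mulr0.
  by apply: (mulIf u10); rewrite -mulrA -k1 -l1 mul1r.
exists k => //; have /eqP := congr1 absz lk.
by rewrite abszM muln_eq1 => /andP[_ /eqP].
Qed.

Lemma transversal_multE X Y q u w : edge_direction X q u -> edge_direction Y q w ->
  transversal_mult X Y q = absz (u 0 0 * w 0 1 - u 0 1 * w 0 0)%R.
Proof.
move=> Xu Yw; apply: xget_unique; first by exists u, w.
move=> _ [u' [w' [Xu' Yw' ->]]].
have [k k1 [uE0 uE1]] := edge_direction_unique Xu Xu'.
have [l l1 [wE0 wE1]] := edge_direction_unique Yw Yw'.
rewrite uE0 uE1 wE0 wE1.
have -> : k * u 0 0 * (l * w 0 1) - k * u 0 1 * (l * w 0 0) =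
  (k * l) * (u 0 0 * w 0 1 - u 0 1 * w 0 0) by ring.
by rewrite !abszM k1 l1 !mul1n.
Qed.

(** One vector generic for both exceptional lists, with one small [d] and then one small [e],
    computes both numbers. *)
Lemma is_stable_mult_unique X Y p m m' :
  is_stable_mult X Y p m -> is_stable_mult X Y p m' -> m = m'.
Proof.
move=> [s Hs] [s' Hs'].
have [v vs] := exists_generic (s ++ s').
have H : forall r, r \in s -> forall t : R, v <> t *: r.
  by move=> r rs; apply: vs; rewrite mem_cat rs.
have H' : forall r, r \in s' -> forall t : R, v <> t *: r.
  by move=> r rs; apply: vs; rewrite mem_cat rs orbT.
have [d [Hd Hd']] := filter_ex (filterI (Hs v H) (Hs' v H')).
by have [e [[_ <-] [_ <-]]] := filter_ex (filterI Hd Hd').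
Qed.

Lemma stable_multE X Y p m : is_stable_mult X Y p m -> stable_mult X Y p = m.
Proof.
move=> H; apply: xget_unique => // m' H'; exact: is_stable_mult_unique H' H.
Qed.

End StableMultiplicity.

(** * Initial forms: the curve near a point *)

Section LocalStructure.
Variables (R : realType) (c : 'I_4 -> 'I_4 -> R).
Implicit Types (p q x v w : 'rV[R]_2) (y : int * int) (a b : 'I_4 * 'I_4) (M : {set 'I_4 * 'I_4}).

Definition functional a w : R := a.1%:R * w 0 0 + a.2%:R * w 0 1.

(** The support of the initial form: among monomials tied at a point, those that win after a
    displacement by [w]. *)
Definition initial M w : {set 'I_4 * 'I_4} :=
  [set a in M | [forall (b | b \in M), functional b w <= functional a w]]%SET.

Lemma initialP M w a : reflect
  (a \in M /\ forall b, b \in M -> functional b w <= functional a w) (a \in initial M w).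
Proof.
rewrite inE; apply: (iffP andP) => -[aM].
  by move/forall_inP=> aw; split.
by move=> aw; split=> //; apply/forall_inP.
Qed.

Lemma monomial_valueE p x a :
  monomial_value c x a = monomial_value c p a + functional a (x - p).
Proof. by rewrite /monomial_value /functional !mxE; ring. Qed.

Lemma functionalZ (e : R) w a : functional a (e *: w) = e * functional a w.
Proof. by rewrite /functional !mxE; ring. Qed.

Lemma functionalD v w a : functional a (v + w) = functional a v + functional a w.
Proof. by rewrite /functional !mxE; ring. Qed.

Lemma functional_vec y a : functional a (vec y) = (pairing y a)%:~R.
Proof. by rewrite /functional !mxE /= /pairing rmorphD !rmorphM. Qed.

Lemma initialZ M w (e : R) : 0 < e -> initial M (e *: w) = initial M w.
Proof.
move=> e0; apply/setP => a; apply/initialP/initialP => -[aM aw]; split=> // b bM.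
  by have := aw b bM; rewrite !functionalZ ler_pM2l.
by rewrite !functionalZ ler_pM2l // aw.
Qed.

Lemma initial_line M v y (s : R) :
  initial M (v + s *: vec y) = argmaxes M (functional ^~ v) (pairing y) s.
Proof.
have E a : functional a (v + s *: vec y) = line (functional ^~ v) (pairing y) s a.
  by rewrite functionalD functionalZ functional_vec.
by apply/setP => a; apply/initialP/argmaxesP => -[aM aw]; split=> // b bM;
  have := aw b bM; rewrite !E.
Qed.

Lemma functional_small a w (r : R) : `|w 0 0| < r -> `|w 0 1| < r ->
  `|functional a w| <= 6 * r.
Proof.
move=> w0 w1; rewrite /functional; apply: le_trans (ler_normD _ _) _.
rewrite !normrM !normr_nat.
have n (i : 'I_4) : i%:R <= 3 :> R by rewrite ler_nat -ltnS.
have m (i : 'I_4) : 0 <= i%:R :> R by [].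
have := n a.1; have := n a.2; have := m a.1; have := m a.2.
have := normr_ge0 (w 0 0); have := normr_ge0 (w 0 1); nra.
Qed.

Lemma local_maximizers p : exists2 r, 0 < r &
  forall x, ball p r x -> maximizers c x = initial (maximizers c p) (x - p).
Proof.
have [a0 a0M] := maximizers_neq0 c p; have a0max := maximizersP _ _ _ a0M.
(* Exponents are at most 3, so each monomial changes by at most [6 * r] on the ball; a gap above
   [12 * r] keeps the other monomials from becoming maximal. *)
have [r r0 Hr] : exists2 r, 0 < r & forall b, b \in enum {: 'I_4 * 'I_4} ->
    b \notin maximizers c p -> monomial_value c p b + 12 * r < monomial_value c p a0.
  apply: common_small => b _.
  case: (boolP (b \in maximizers c p)) => bM; first by exists 1.
  have gap : monomial_value c p b < monomial_value c p a0.
    rewrite lt_neqAle a0max andbT; apply: contra bM => /eqP E.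
    by apply/maximizersP => d; rewrite E.
  exists ((monomial_value c p a0 - monomial_value c p b) / 24).
    by rewrite divr_gt0 // subr_gt0.
  by move=> e e0 eb _; lra.
exists r => // x /ball2P[_ x0 x1].
have val_eq a : a \in maximizers c p -> monomial_value c p a = monomial_value c p a0.
  by move=> aM; apply: le_anti; rewrite a0max (maximizersP _ _ _ aM).
have out b a : b \notin maximizers c p -> a \in maximizers c p ->
    monomial_value c x b < monomial_value c x a.
  move=> bM aM; have := Hr b (mem_enum _ _) bM; rewrite -(val_eq a aM).
  rewrite !(monomial_valueE p x) => gap.
  have small d : `|functional d (x - p)| <= 6 * r.
    by apply: functional_small; rewrite !mxE distrC.
  have := small b; have := small a; rewrite !ler_norml => /andP[? ?] /andP[? ?]; lra.
apply/setP => a; apply/maximizersP/initialP => [Ha|[aM aw] b].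
  have aM : a \in maximizers c p.
    by apply: contraT => aM; have := out a a0 aM a0M; rewrite ltNge Ha.
  split=> // b bM; have := Ha b.
  by rewrite !(monomial_valueE p x) (val_eq a aM) (val_eq b bM) lerD2l.
case: (boolP (b \in maximizers c p)) => bM; last exact/ltW/out.
by rewrite !(monomial_valueE p x) (val_eq a aM) (val_eq b bM) lerD2l aw.
Qed.

Lemma set2_cards_gt1 a b M : a \in M -> b \in M -> a != b -> (1 < #|M|)%N.
Proof.
move=> aM bM ab; apply: (@leq_trans #|[set a; b]%SET|); first by rewrite cards2 ab.
by apply: subset_leq_card; apply/fintype.subsetP => d; rewrite !inE => /orP[] /eqP ->.
Qed.

Lemma corner_locus_edge q a b : maximizers c q = [set a; b]%SET -> a != b ->
  coprimez (b.1%:Z - a.1%:Z) (b.2%:Z - a.2%:Z) ->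
  edge_direction (corner_locus c) q (ivec (a.2%:Z - b.2%:Z, b.1%:Z - a.1%:Z)).
Proof.
move=> qE ab cop; split.
  rewrite /primitive !mxE /=; apply/coprimezP.
  by have /coprimezP[[k l] /= kl] := cop; exists (- l, k); rewrite /= -kl; ring.
have [r r0 rE] := local_maximizers q.
apply/nbhs_ballP; exists r => // x /rE xE.
rewrite /corner_locus /= xE qE map_ivec.
have Eab : functional b (x - q) - functional a (x - q) =
    (b.1%:R - a.1%:R) * (x - q) 0 0 + (b.2%:R - a.2%:R) * (x - q) 0 1.
  by rewrite /functional; ring.
split=> [|[t xt]].
  move=> /card_gt1P[d [e [dM eM de]]].
  have Fab : functional b (x - q) = functional a (x - q).
    have [dE deq] := initialP _ _ _ dM; have [eE eeq] := initialP _ _ _ eM.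
    have := deq a (set21 _ _); have := deq b (set22 _ _).
    have := eeq a (set21 _ _); have := eeq b (set22 _ _).
    move: dE eE de; rewrite !inE => /orP[] /eqP -> /orP[] /eqP ->; rewrite ?eqxx // => _;
    by move=> *; apply: le_anti; apply/andP.
  have [||t [t0 t1]] := @orthogonal_multiple R (b.1%:R - a.1%:R) (b.2%:R - a.2%:R)
    ((x - q) 0 0) ((x - q) 0 1).
  - have /orP[?|?] : (a.1 != b.1) || (a.2 != b.2).
      by rewrite -negb_and -xpair_eqE -!surjective_pairing.
    + by left; rewrite subr_eq0 eqr_nat eq_sym.
    + by right; rewrite subr_eq0 eqr_nat eq_sym.
  - by rewrite -Eab Fab subrr.
  exists t; apply: rv2P; rewrite ?addvE0 ?addvE1 /=.
    by move: t0; rewrite !mxE rmorphB /= => t0; lra.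
  by move: t1; rewrite !mxE rmorphB /= => t1; lra.
have Fab : functional b (x - q) = functional a (x - q).
  apply/eqP; rewrite -subr_eq0 Eab xt [q + _]addrC addrK !mxE /= !rmorphB /=.
  by apply/eqP; ring.
by apply: (@set2_cards_gt1 a b) => //; apply/initialP; split=> [|d];
  rewrite ?set21 ?set22 // !inE => /orP[] /eqP ->; rewrite ?Fab.
Qed.

End LocalStructure.
Arguments functional {R} a w.

Lemma near_all_seq (T : Type) (F : set_system T) {FF : Filter F} (I : eqType)
  (s : seq I) (P : I -> T -> Prop) :
  (forall i, i \in s -> \forall x \near F, P i x) ->
  \forall x \near F, forall i, i \in s -> P i x.
Proof.
elim: s => [|i s IH] sP; first by apply: filterE.
apply: filterS2 (sP i (mem_head _ _)) (IH _).
  by move=> x Pi Ps j; rewrite inE => /orP[/eqP ->|/Ps].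
by move=> j js; apply: sP; rewrite inE js orbT.
Qed.

Definition dot (k y : int * int) : int := k.1 * y.1 + k.2 * y.2.

(** * Sets that are locally unions of rays *)

Section Stars.
Variable R : realType.
Implicit Types (p q x u : 'rV[R]_2) (L : set 'rV[R]_2) (y : int * int).

Lemma near_half_plane (k l : R) (z q : 'rV[R]_2) :
  0 < k * (q - z) 0 0 + l * (q - z) 0 1 ->
  \forall x \near q, 0 < k * (x - z) 0 0 + l * (x - z) 0 1.
Proof.
set m := (X in 0 < X) => m0; apply/nbhs_ballP.
have K0 : 0 < 1 + `|k| + `|l| by rewrite -addrA ltr_pwDl ?addr_ge0.
exists (m / (1 + `|k| + `|l|)); first by rewrite /= divr_gt0.
move=> x /ball2P[_]; rewrite !ltr_pdivlMr // => x0 x1.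
have -> : k * (x - z) 0 0 + l * (x - z) 0 1 =
  m - (k * (q 0 0 - x 0 0) + l * (q 0 1 - x 0 1)) by rewrite /m !mxE; ring.
rewrite subr_gt0; apply: le_lt_trans (ler_norm _) _; apply: le_lt_trans (ler_normD _ _) _.
rewrite !normrM -(ltr_pM2r K0).
have := ler_wpM2l (normr_ge0 k) (ltW x0); have := ler_wpM2l (normr_ge0 l) (ltW x1).
nra.
Qed.

Definition star L p (ys : seq (int * int)) : Prop :=
  exists2 r, 0 < r & forall x, ball p r x ->
    (L x <-> exists y t, [/\ y \in ys, 0 <= t & x = p + t *: vec y]).

(** A linear form positive on [y] and nonpositive on [y'] keeps points near the open ray of
    direction [y] off the ray of direction [y']. *)
Definition separated_directions (ys : seq (int * int)) : Prop :=
  {in ys &, forall y y', y != y' -> exists k, 0 < dot k y /\ dot k y' <= 0}.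

(** Near a point of an open ray, separation excludes all other rays and positivity of the scalar
    product with [y] excludes the apex, so a full line germ remains. *)
Lemma star_edge L p ys r (u q : 'rV[R]_2) y t : separated_directions ys ->
  (forall x, ball p r x ->
    (L x <-> exists y t, [/\ y \in ys, 0 <= t & x = p + t *: vec y])) ->
  y \in ys -> coprimez y.1 y.2 -> 0 < t -> q - u = p + t *: vec y -> ball p r (q - u) ->
  edge_direction (translate L u) q (ivec y).
Proof.
move=> sep Lr yys cop t0 qu /ball2P[r0 qu0 qu1]; split; first by rewrite /primitive !mxE.
have quE : q = p + u + t *: vec y by rewrite addrAC -qu subrK.
have near_y' : \forall x \near q, forall y', y' \in ys -> y' != y ->
    forall t', 0 <= t' -> x - u <> p + t' *: vec y'.
  apply: (@near_all_seq _ (nbhs q) _ _ ys (fun y' x => y' != y ->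
    forall t', 0 <= t' -> x - u <> p + t' *: vec y')) => y' y'ys.
  have [->|y'y] := eqVneq y' y; first by apply: filterE => x /eqP.
  have [|k [ky ky']] := sep y y' yys y'ys; first by rewrite eq_sym.
  have dotE (t' : R) w : (k.1%:~R * (t' *: vec w : 'rV[R]_2) 0 0 +
      k.2%:~R * (t' *: vec w : 'rV[R]_2) 0 1) = t' * (dot k w)%:~R.
    by rewrite !mxE /= /dot rmorphD !rmorphM /=; ring.
  have : \forall x \near q, 0 < k.1%:~R * (x - (p + u)) 0 0 + k.2%:~R * (x - (p + u)) 0 1.
    apply: near_half_plane; rewrite quE [p + u + _]addrC addrK dotE.
    by rewrite mulr_gt0 // ltr0z.
  apply: filterS => x xk _ t' t'0 xE; move: xk.
  have -> : x - (p + u) = t' *: vec y' by rewrite opprD addrA addrAC xE addrC addKr.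
  by rewrite dotE ltNge mulr_ge0_le0 // lerz0.
have y0 : 0 < (y.1%:~R * y.1%:~R + y.2%:~R * y.2%:~R : R).
  rewrite -!expr2 lt_neqAle addr_ge0 ?sqr_ge0 // andbT eq_sym paddr_eq0 ?sqr_ge0 //.
  rewrite !sqrf_eq0 !intr_eq0; apply/negP => /andP[/eqP y1 /eqP y2].
  by move: cop; rewrite y1 y2.
have near_y : \forall x \near q, 0 < y.1%:~R * (x - (p + u)) 0 0 + y.2%:~R * (x - (p + u)) 0 1.
  apply: near_half_plane; rewrite quE [p + u + _]addrC addrK !mxE /=.
  by move: (mulr_gt0 t0 y0); nra.
have near_r : \forall x \near q, ball p r (x - u).
  apply/nbhs_ballP; exists (Order.min (r - `|p 0 0 - (q - u) 0 0|) (r - `|p 0 1 - (q - u) 0 1|)).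
    by rewrite /= lt_min !subr_gt0 qu0.
  move=> x /ball2P[_]; rewrite !lt_min => /andP[x0 _] /andP[_ x1].
  apply/ball2P; split=> //.
    have -> : p 0 0 - (x - u) 0 0 = (p 0 0 - (q - u) 0 0) + (q 0 0 - x 0 0).
      by rewrite !mxE; ring.
    by apply: le_lt_trans (ler_normD _ _) _; lra.
  have -> : p 0 1 - (x - u) 0 1 = (p 0 1 - (q - u) 0 1) + (q 0 1 - x 0 1).
    by rewrite !mxE; ring.
  by apply: le_lt_trans (ler_normD _ _) _; lra.
apply: filterS3 near_y' near_y near_r => x xy' xy xr; rewrite map_ivec /translate /=.
rewrite (Lr _ xr); split.
  move=> [y' [t' [y'ys t'0 xE]]].
  have [y'y|y'y] := eqVneq y' y; last by have := xy' y' y'ys y'y t' t'0.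
  exists (t' - t); have -> : x = p + t' *: vec y + u by rewrite -y'y -xE subrK.
  by rewrite quE; apply: rv2P; rewrite !mxE; ring.
move=> [t' xE]; exists y, (t + t').
have xE' : x - (p + u) = (t + t') *: vec y.
  by rewrite xE quE; apply: rv2P; rewrite !mxE; ring.
split=> //; last by rewrite -xE'; apply: rv2P; rewrite !mxE; ring.
move: xy; rewrite xE' !mxE /= mulrCA [X in _ + X]mulrCA -mulrDr pmulr_lgt0 //.
exact: ltW.
Qed.

End Stars.

Section StarMultiplicity.
Variables (R : realType) (c : 'I_4 -> 'I_4 -> R).
Hypothesis smooth : unimodular_newton_subdivision c.
Implicit Types (p q x v w : 'rV[R]_2) (y : int * int) (a b d : 'I_4 * 'I_4).

(** Cramer's rule: the area is the determinant of the two difference equations. *)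
Lemma functional_indep a b d w : area2 a b d != 0 ->
  functional a w = functional b w -> functional a w = functional d w -> w = 0.
Proof.
rewrite -(intr_eq0 R) => area ab ad.
have E0 : (area2 a b d)%:~R * w 0 0 = 0 :> R.
  move: ab ad; rewrite /functional /area2 rmorphB !rmorphM !rmorphB /= -!pmulrn.
  move: (w 0 0) (w 0 1) (a.1%:R : R) (a.2%:R : R) (b.1%:R : R) (b.2%:R : R) (d.1%:R : R) (d.2%:R : R).
  move=> w0 w1 a1 a2 b1 b2 d1 d2 ab ad.
  transitivity ((d2 - a2) * ((b1 * w0 + b2 * w1) - (a1 * w0 + a2 * w1))
     - (b2 - a2) * ((d1 * w0 + d2 * w1) - (a1 * w0 + a2 * w1))); first by ring.
  by rewrite -ab -ad subrr !mulr0 subr0.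
have E1 : (area2 a b d)%:~R * w 0 1 = 0 :> R.
  move: ab ad; rewrite /functional /area2 rmorphB !rmorphM !rmorphB /= -!pmulrn.
  move: (w 0 0) (w 0 1) (a.1%:R : R) (a.2%:R : R) (b.1%:R : R) (b.2%:R : R) (d.1%:R : R) (d.2%:R : R).
  move=> w0 w1 a1 a2 b1 b2 d1 d2 ab ad {E0}.
  transitivity ((b1 - a1) * ((d1 * w0 + d2 * w1) - (a1 * w0 + a2 * w1))
     - (d1 - a1) * ((b1 * w0 + b2 * w1) - (a1 * w0 + a2 * w1))); first by ring.
  by rewrite -ab -ad subrr !mulr0 subr0.
apply: rv2P; rewrite !mxE.
  by move/eqP: E0; rewrite mulf_eq0 (negbTE area) => /eqP.
by move/eqP: E1; rewrite mulf_eq0 (negbTE area) => /eqP.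
Qed.

Lemma functional_inj_off v : (forall a b, a != b -> forall t : R,
    v <> t *: vec (a.2%:Z - b.2%:Z, b.1%:Z - a.1%:Z)) ->
  injective (functional ^~ v).
Proof.
move=> gen a b ab; apply/eqP; apply: contraT => neq; exfalso.
have [||t [t0 t1]] := @orthogonal_multiple R (b.1%:R - a.1%:R) (b.2%:R - a.2%:R) (v 0 0) (v 0 1).
- have /orP[?|?] : (a.1 != b.1) || (a.2 != b.2).
    by rewrite -negb_and -xpair_eqE -!surjective_pairing.
  + by left; rewrite subr_eq0 eqr_nat eq_sym.
  + by right; rewrite subr_eq0 eqr_nat eq_sym.
- by move: ab; rewrite /functional => ab; lra.
apply: (gen a b neq t); apply: rv2P; rewrite !mxE /= rmorphB /=.
  by rewrite t0; ring.
by rewrite t1; ring.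
Qed.

(* Translate [L] by a small generic [v]: the ray of direction [y] then starts in the region of the
   monomial of [maximizers c p] that is greatest in direction [v] and ends in the region of a monomial
   steepest in direction [y].  The starting slopes sum to zero by balancing. *)
Lemma star_stable_mult (L : set 'rV[R]_2) p (ys : seq (int * int)) :
  star L p ys -> uniq ys -> separated_directions ys ->
  (forall y, y \in ys -> coprimez y.1 y.2) ->
  (forall a, \sum_(y <- ys) pairing y a = 0) ->
  is_stable_mult (corner_locus c) L p
    (absz (\sum_(y <- ys) top (maximizers c p) (pairing y))%R).
Proof.
move=> [r2 r20 Lr] ysU sep prim bal; set M := maximizers c p.
have [a0 a0M] := maximizers_neq0 c p.
have [r1 r10 Gr] := local_maximizers c p.
pose normal (ab : ('I_4 * 'I_4) * ('I_4 * 'I_4)) : int * int :=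
  (ab.1.2%:Z - ab.2.2%:Z, ab.2.1%:Z - ab.1.1%:Z).
(* Avoiding the ray directions keeps the translated rays off [p]; avoiding the directions dual to
   pairs of exponents makes a single monomial win in direction [v]. *)
exists ([seq vec y | y <- ys] ++
  [seq vec (normal ab) | ab <- enum {: ('I_4 * 'I_4) * ('I_4 * 'I_4)}]).
move=> v gen.
have vy y t : y \in ys -> v <> t *: vec y.
  by move=> yys; apply: gen; rewrite mem_cat map_f.
have vinj : injective (functional ^~ v).
  apply: functional_inj_off => a b _ t; apply: gen; rewrite mem_cat; apply/orP; right.
  by apply/mapP; exists (a, b); rewrite ?mem_enum.
pose am y s := argmaxes M (functional ^~ v) (pairing y) s.
have [ts tsP] := choice (fun y => breaks_after (functional ^~ v) (pairing y) 0 a0M).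
have am0 y : am y 0 = initial M v by rewrite /am -initial_line scale0r addr0.
have [av avE] : exists av, initial M v = [set av]%SET.
  have [av avM] := argmaxes_neq0 (functional ^~ v) (pairing (0, 0)) 0 a0M.
  rewrite -/(am _ _) am0 in avM; exists av.
  apply/setP => a; rewrite inE; apply/idP/eqP => [aM|-> //].
  have [avm avmax] := initialP _ _ _ avM; have [am' amax] := initialP _ _ _ aM.
  by apply: vinj; apply: le_anti; rewrite avmax ?amax.
(* Rescaled about [p] by [e], the crossings do not depend on [e]: they are the breaks of the initial
   form along [v + s *: vec y]. Finitely many bounds on [e] bring them all into the ball. *)
pose ws := v :: [seq v + s *: vec y | y <- ys, s <- ts y].
have near_d : \forall d \near (0 : R)^'+, [/\ 0 < d, d < r1 & d < r2 / 2].
  near=> d; split; near: d; [exact: nbhs_right_gt|exact: nbhs_right_lt|].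
  by apply: nbhs_right_lt; rewrite divr_gt0.
apply: filterS near_d => d [d0 dr1 dr2].
have near_e : \forall e \near (0 : R)^'+, 0 < e /\
    forall w, w \in ws -> e * `|w 0 0| < d /\ e * `|w 0 1| < d.
  apply: filterI; first exact: nbhs_right_gt.
  apply: (@near_all_seq _ ((0 : R)^'+) _ _ ws (fun w e => e * `|w 0 0| < d /\ e * `|w 0 1| < d)) => w _.
  have K0 : 0 < 1 + `|w 0 0| + `|w 0 1| by rewrite -addrA ltr_pwDl ?addr_ge0.
  near=> e; have e0 : 0 < e by near: e; exact: nbhs_right_gt.
  have : e < d / (1 + `|w 0 0| + `|w 0 1|).
    by near: e; apply: nbhs_right_lt; rewrite divr_gt0.
  rewrite ltr_pdivlMr //; have := normr_ge0 (w 0 0); have := normr_ge0 (w 0 1).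
  by move=> *; split; nra.
apply: filterS near_e => e [e0 ews] /=.
pose pe y s : 'rV[R]_2 := p + e *: (v + s *: vec y).
have ball_pe w : w \in ws -> ball p d (p + e *: w).
  move=> /ews[w0 w1]; apply/ball2P; split=> //.
    by rewrite !mxE opprD addNKr normrN normrM (gtr0_norm e0).
  by rewrite !mxE opprD addNKr normrN normrM (gtr0_norm e0).
have ball_le r x : d <= r -> ball p d x -> ball p r x.
  by move=> dr /ball2P[_ ? ?]; apply/ball2P; split; lra.
have vws : v \in ws by exact: mem_head.
have pews y s : y \in ys -> s \in ts y -> v + s *: vec y \in ws.
  move=> yys sts; rewrite inE; apply/orP; right; apply/allpairsPdep.
  by exists y, s.
have max_pe y s : ball p d (pe y s) -> maximizers c (pe y s) = am y s.
  move=> /(ball_le r1 _ (ltW dr1))/Gr ->.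
  by rewrite /pe [p + _]addrC addrK initialZ // initial_line.
have s_gt0 y s : s \in ts y -> 0 < s by have [_ -> _ _] := tsP y => /andP[].
have s_break y s : s \in ts y -> bot (am y s) (pairing y) < top (am y s) (pairing y).
  by have [_ -> _ _] := tsP y => /andP[].
have am_neq0 y s : exists a, a \in am y s by exact: argmaxes_neq0 a0M.
have back y s : pe y s - e *: v = p + (e * s) *: vec y.
  by rewrite /pe; apply: rv2P; rewrite !mxE; ring.
have ball_back x : ball p d x -> ball p r2 (x - e *: v).
  move=> /ball2P[_ x0 x1]; have [v0 v1] := ews v vws; apply/ball2P.
  rewrite -(gtr0_norm e0) -!normrM in v0 v1.
  split=> //; rewrite !mxE.
    have -> : p 0 0 - (x 0 0 - e * v 0 0) = (p 0 0 - x 0 0) + e * v 0 0 by ring.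
    by apply: le_lt_trans (ler_normD _ _) _; lra.
  have -> : p 0 1 - (x 0 1 - e * v 0 1) = (p 0 1 - x 0 1) + e * v 0 1 by ring.
  by apply: le_lt_trans (ler_normD _ _) _; lra.
have multE y s : y \in ys -> s \in ts y ->
    transversal_mult (corner_locus c) (translate L (e *: v)) (pe y s) =
    absz (top (am y s) (pairing y) - bot (am y s) (pairing y))%R.
  move=> yys sts.
  have [a1 a1am] := am_neq0 y s.
  have [a aam aE] := top_attained (pairing y) a1am.
  have [b bam bE] := bot_attained (pairing y) a1am.
  have ab : a != b.
    by apply/eqP => ab; have := s_break y s sts; rewrite aE bE ab ltxx.
  have bpe := ball_pe _ (pews y s yys sts).
  have maxE := max_pe y s bpe.
  (* Three monomials tied at [v + s *: vec y] would force this vector to be 0, since they span a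
     triangle of nonzero area. *)
  have amE : am y s = [set a; b]%SET.
    apply/setP => x; rewrite finset.in_set2; apply/idP/orP => [xam|[]/eqP -> //].
    case: (eqVneq x a) => [|xa]; [by left|right; apply: contraT => xb].
    have area : area2 a b x != 0.
      by apply: (@smooth_area _ _ smooth (pe y s)); rewrite ?maxE // 1?eq_sym.
    exfalso; have [aM amax] := argmaxesP _ _ _ _ _ aam.
    have [bM bmax] := argmaxesP _ _ _ _ _ bam; have [xM xmax] := argmaxesP _ _ _ _ _ xam.
    have lineE z : functional z (v + s *: vec y) = line (functional ^~ v) (pairing y) s z.
      by rewrite functionalD functionalZ functional_vec.
    have w0 : v + s *: vec y = 0.
      by apply: (functional_indep area); rewrite !lineE; apply: le_anti; rewrite amax ?bmax ?xmax.
    by apply: (vy y (- s) yys); rewrite scaleNr; apply/eqP; rewrite -addr_eq0 w0.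
  have cop : coprimez (b.1%:Z - a.1%:Z) (b.2%:Z - a.2%:Z).
    by apply: (@smooth_primitive _ _ smooth (pe y s)); rewrite ?maxE.
  have Gedge := @corner_locus_edge _ c (pe y s) a b (etrans maxE amE) ab cop.
  have Ledge : edge_direction (translate L (e *: v)) (pe y s) (ivec y).
    apply: (star_edge sep Lr yys (prim y yys) _ (back y s) (ball_back _ bpe)).
    by rewrite mulr_gt0 // (s_gt0 y s sts).
  rewrite (transversal_multE Gedge Ledge) !mxE /= aE bE /pairing.
  by congr absz; ring.
have tsU y : uniq (ts y) by have [] := tsP y.
pose l := [seq pe y s | y <- ys, s <- ts y].
have lU : uniq l.
  apply: allpairs_uniq_dep => // -[y s] [y' s'] /= /allpairsPdep[y1 [s1 [yys sts E]]].
  case: E yys sts => <- <- {y1 s1} yys sts /allpairsPdep[y1 [s1 [y'ys s'ts E]]].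
  case: E y'ys s'ts => <- <- {y1 s1} y'ys s'ts /addrI/(scalerI (lt0r_neq0 e0))/addrI ss'.
  have dotE (k z : int * int) (t : R) : k.1%:~R * (t *: vec z : 'rV[R]_2) 0 0 +
      k.2%:~R * (t *: vec z : 'rV[R]_2) 0 1 = t * (dot k z)%:~R.
    by rewrite !mxE /= /dot rmorphD !rmorphM /=; ring.
  have ss'dot k : s * (dot k y)%:~R = s' * (dot k y')%:~R by rewrite -!dotE ss'.
  have s0 := s_gt0 y s sts; have s'0 := s_gt0 y' s' s'ts.
  have [yy'|yy'] := eqVneq y y'; last first.
    have [k [ky ky']] := sep y y' yys y'ys yy'.
    have : 0 < s * (dot k y)%:~R by rewrite mulr_gt0 ?ltr0z.
    by rewrite ss'dot ltNge mulr_ge0_le0 ?(ltW s'0) // lerz0.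
  subst y'; congr Tagged; apply: (@mulIf _ (dot y y)%:~R _ _ _ (ss'dot y)).
  rewrite intr_eq0 /dot -!expr2 paddr_eq0 ?sqr_ge0 // !sqrf_eq0.
  by apply/negP => /andP[/eqP y1 /eqP y2]; have := prim y yys; rewrite y1 y2.
have ZE : corner_locus c `&` translate L (e *: v) `&` ball p d = [set` l].
  apply/seteqP; split=> q /=.
    move=> [[Gq Lq] bq].
    have [y [t [yys t0 tE]]] := (Lr _ (ball_back _ bq)).1 Lq.
    have qE : q = pe y (t / e).
      rewrite -[q](subrK (e *: v)) tE /pe; apply: rv2P; rewrite !mxE;
        by field; rewrite gt_eqF.
    apply/allpairsPdep; exists y, (t / e); split=> //.
    have [_ -> _ _] := tsP y.
    move: Gq; rewrite /corner_locus /= qE max_pe -?qE // => am_gt1.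
    have s0 : 0 < t / e.
      rewrite lt_neqAle divr_ge0 ?(ltW e0) // andbT eq_sym; apply/eqP => s0.
      by move: am_gt1; rewrite s0 am0 avE cards1.
    rewrite s0 /=; have /card_gt1P[a [b [aam bam ab]]] := am_gt1.
    have le_bt : bot (am y (t / e)) (pairing y) <= top (am y (t / e)) (pairing y).
      exact: bot_le_top aam.
    (* Tied monomials of equal slope along [y] would also agree on [v], against genericity; so every
       crossing is a break. *)
    rewrite /break lt_neqAle le_bt andbT; apply/eqP => btE.
    move/negP: ab; apply; apply/eqP; apply: vinj.
    have pab : pairing y a = pairing y b.
      apply: le_anti; apply/andP; split.
        by apply: le_trans (top_ge _ aam) _; rewrite -btE; exact: bot_le.
      by apply: le_trans (top_ge _ bam) _; rewrite -btE; exact: bot_le.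
    have [aM amax] := argmaxesP _ _ _ _ _ aam; have [bM bmax] := argmaxesP _ _ _ _ _ bam.
    have := amax b bM; have := bmax a aM; rewrite /line pab !lerD2r => h1 h2.
    by apply: le_anti; rewrite h1 h2.
  move=> /allpairsPdep[y [s [yys sts qE]]]; rewrite qE.
  have bpe := ball_pe _ (pews y s yys sts).
  split=> //; split.
    rewrite /corner_locus /= (max_pe y s bpe).
    have [a1 a1am] := am_neq0 y s.
    have [a aam aE] := top_attained (pairing y) a1am.
    have [b bam bE] := bot_attained (pairing y) a1am.
    apply: (set2_cards_gt1 aam bam); apply/eqP => ab.
    by have := s_break y s sts; rewrite aE bE ab ltxx.
  apply/(Lr _ (ball_back _ bpe)); exists y, (e * s).
  by split; [|rewrite mulr_ge0 // ltW // (s_gt0 y s sts)|exact: back].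
split.
  move=> q Zq; have : [set` l] q by rewrite -ZE.
  move=> /allpairsPdep[y [s [yys sts ->]]].
  by rewrite multE // absz_gt0 subr_eq0 gt_eqF // s_break.
rewrite ZE -fsbig_seq // big_allpairs_dep.
have yE y : y \in ys -> (\sum_(s <- ts y)
    transversal_mult (corner_locus c) (translate L (e *: v)) (pe y s))%N%:Z =
    top M (pairing y) - pairing y av.
  move=> yys; have [_ _ tsum _] := tsP y.
  rewrite -/(am y 0) am0 avE top1 in tsum; rewrite -tsum big_seq [RHS]big_seq.
  rewrite (big_morph Posz PoszD erefl); apply: eq_bigr => s sts.
  rewrite multE // gez0_abs // subr_ge0.
  by have [a1 a1am] := am_neq0 y s; exact: bot_le_top a1am.
apply/eqP; rewrite -eqz_nat; apply/eqP.
rewrite (big_morph Posz PoszD erefl) big_seq (eq_bigr _ yE) -big_seq.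
rewrite sumrB bal subr0 gez0_abs // -[leLHS](bal a0) big_seq [leRHS]big_seq.
by apply: ler_sum => y _; exact: top_ge.
Unshelve. all: by end_near.
Qed.

End StarMultiplicity.

(** * Multiplicities at balanced stars *)

Section BalancedGraphs.
Variable R : realType.
Implicit Types (p x : 'rV[R]_2) (y : int * int).

Definition on_ray p y x : Prop := exists2 t : R, 0 <= t & x = p + t *: vec y.

Lemma on_rayP p y x : on_ray p y x <-> exists t : R,
  [/\ 0 <= t, x 0 0 = p 0 0 + t * y.1%:~R & x 0 1 = p 0 1 + t * y.2%:~R].
Proof.
split=> [[t t0 ->]|[t [t0 x0 x1]]]; first by exists t; rewrite addvE0 addvE1.
by exists t => //; apply: rv2P; rewrite ?addvE0 ?addvE1.
Qed.

Definition some_ray p (ys : seq (int * int)) x : Prop :=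
  foldr (fun y P => on_ray p y x \/ P) False ys.

Lemma starP (L : set 'rV[R]_2) p ys (r : R) : 0 < r ->
  (forall x, ball p r x -> (L x <-> some_ray p ys x)) -> star L p ys.
Proof.
move=> r0 Lr; exists r => // x /Lr ->; elim: ys {Lr} => /= [|y ys IH].
  by split=> // -[y [t []]].
rewrite /some_ray /= -/(some_ray p ys x) IH; split.
  move=> [[t t0 ->]|[z [t [zys t0 ->]]]]; first by exists y, t; rewrite mem_head.
  by exists z, t; rewrite inE zys orbT.
move=> [z [t [+ t0 ->]]]; rewrite inE => /orP[/eqP ->|zys]; first by left; exists t.
by right; exists z, t.
Qed.

(** Candidates for the separating forms; they suffice for the directions of a (1,1)-curve, so that
    [directions_ok] can be checked by computation. *)
Definition small_vectors : seq (int * int) :=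
  [seq (k, l) | k <- [:: 1; 0; -1], l <- [:: 1; 0; -1]].

Definition directions_ok (ys : seq (int * int)) : bool :=
  [&& uniq ys, all (fun y => coprimez y.1 y.2) ys,
   all (fun y => all (fun y' => (y == y') || has (fun k => (0 < dot k y) && (dot k y' <= 0))
     small_vectors) ys) ys,
   \sum_(y <- ys) y.1 == 0 & \sum_(y <- ys) y.2 == 0].

Lemma pairing_sum ys a : \sum_(y <- ys) pairing y a =
  a.1%:Z * (\sum_(y <- ys) y.1) + a.2%:Z * (\sum_(y <- ys) y.2).
Proof. by rewrite !mulr_sumr -big_split. Qed.

Lemma pairingN y a : pairing (- y.1, - y.2) a = - pairing y a.
Proof. by rewrite /pairing /=; ring. Qed.

Lemma top_opp (S : {set 'I_4 * 'I_4}) y :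
  top S (pairing (- y.1, - y.2)) = - bot S (pairing y).
Proof. by rewrite /bot opprK; apply: eq_top => a; rewrite pairingN. Qed.

(** By balancing, the slopes of any one monomial along the rays add up to 0, and the steepest slopes
    dominate them. *)
Lemma sum_top_ge0 (S : {set 'I_4 * 'I_4}) a ys : directions_ok ys -> a \in S ->
  0 <= \sum_(y <- ys) top S (pairing y).
Proof.
move=> /and5P[_ _ _ /eqP s1 /eqP s2] aS.
apply: (@le_trans _ _ (\sum_(y <- ys) pairing y a)).
  by rewrite pairing_sum s1 s2 !mulr0.
by apply: ler_sum => y _; exact: top_ge.
Qed.

Lemma stable_mult_star (c : 'I_4 -> 'I_4 -> R) (L : set 'rV[R]_2) p ys :
  unimodular_newton_subdivision c -> directions_ok ys -> star L p ys ->
  (stable_mult (corner_locus c) L p)%:Z = \sum_(y <- ys) top (maximizers c p) (pairing y).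
Proof.
move=> smooth ok st; have /and5P[U /allP prim /allP sep /eqP s1 /eqP s2] := ok.
rewrite (stable_multE (star_stable_mult smooth st U _ prim _)).
- have [a aM] := maximizers_neq0 c p.
  by rewrite gez0_abs // (sum_top_ge0 ok aM).
- move=> y y' yys y'ys yy'.
  have /allP/(_ y' y'ys)/orP[|/hasP[k _ /andP[? ?]]] := sep y yys.
    by rewrite (negbTE yy').
  by exists k.
- by move=> a; rewrite pairing_sum s1 s2 !mulr0.
Qed.

End BalancedGraphs.

(** * Tropical (1,1)-curves *)

Section Curves.
Variable R : realType.
Implicit Types (w x : 'rV[R]_2) (l t : R) (b : bool).

(* [b] is the sign of the slope of the bounded edge, [l >= 0] the length parameter. *)
Definition sg b : int := if b then 1 else -1.
Definition edge_dir b : int * int := (sg b, 1).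
Definition curve b w l : set 'rV[R]_2 :=
  segment w (w + l *: vec (edge_dir b)) `|` ray w (vec (- sg b, 0)) `|` ray w (vec (0, -1))
    `|` ray (w + l *: vec (edge_dir b)) (vec (sg b, 0))
    `|` ray (w + l *: vec (edge_dir b)) (vec (0, 1)).

Lemma tropical_11_curveE (z : 'rV[R]_(2 + 1)) : tropical_11_curve z =
  if 0 < rsubmx z 0 0 then curve true (lsubmx z) (rsubmx z 0 0)
  else curve false (lsubmx z) (- rsubmx z 0 0).
Proof.
by rewrite /tropical_11_curve /curve /vec /= !opprK !rmorphN /= scaleNr.
Qed.

Lemma rayE w (k m : int) x : ray w (vec (k, m)) x <-> on_ray w (k, m) x.
Proof. by split=> [[t /= t0 <-]|[t t0 ->]]; exists t. Qed.

Lemma segmentP w l b x : 0 <= l -> segment w (w + l *: vec (edge_dir b)) x <->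
  [/\ (sg b)%:~R * (x 0 0 - w 0 0) = x 0 1 - w 0 1, 0 <= x 0 1 - w 0 1 & x 0 1 - w 0 1 <= l].
Proof.
have s2 : (sg b)%:~R * (sg b)%:~R = 1 :> R by case: b; rewrite /sg /= ?mulr1 // mulrNN mulr1.
move=> l0; split.
  move=> [t /=]; rewrite in_itv /= => /andP[t0 t1] <-.
  have -> : w + t *: (w + l *: vec (edge_dir b) - w) = w + (t * l) *: vec (edge_dir b).
    by apply: rv2P; rewrite !mxE; ring.
  rewrite addvE0 addvE1 /= mulr1 ![w _ _ + _ - _]addrAC !subrr !add0r mulrCA s2 mulr1.
  by split=> //; [exact: mulr_ge0|rewrite ler_piMl].
move=> [E x0 x1]; have [l00|l00] := eqVneq l 0.
  exists 0; first by rewrite /= in_itv /= lexx ler01.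
  rewrite scale0r addr0; have x10 : x 0 1 - w 0 1 = 0 by lra.
  apply: rv2P; last by lra.
  by rewrite x10 in E; move/(congr1 (fun u => (sg b)%:~R * u)): E; rewrite mulrA s2 mul1r mulr0; lra.
have {}l00 : 0 < l by rewrite lt_neqAle eq_sym l00.
exists ((x 0 1 - w 0 1) / l).
  by rewrite /= in_itv /= divr_ge0 // ler_pdivrMr // mul1r.
have -> : w + ((x 0 1 - w 0 1) / l) *: (w + l *: vec (edge_dir b) - w) =
    w + (x 0 1 - w 0 1) *: vec (edge_dir b).
  by apply: rv2P; rewrite !mxE; field; rewrite gt_eqF.
apply: rv2P; rewrite ?addvE0 ?addvE1 /= ?mulr1; last by lra.
by rewrite -E mulrAC s2 mul1r; lra.
Qed.

Lemma on_rayh w x b : on_ray w (sg b, 0) x <->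
  x 0 1 = w 0 1 /\ 0 <= (sg b)%:~R * (x 0 0 - w 0 0).
Proof.
rewrite on_rayP /=; case: b => /=; rewrite ?mul1r ?mulN1r; split.
- by move=> [t [t0 -> ->]]; split; lra.
- by move=> [-> x0]; exists (x 0 0 - w 0 0); split=> //; lra.
- by move=> [t [t0 -> ->]]; split; rewrite ?mulrN1; lra.
- by move=> [-> x0]; exists (w 0 0 - x 0 0); split=> //; rewrite ?mulrN1; lra.
Qed.

Lemma on_rayv w x b : on_ray w (0, sg b) x <->
  x 0 0 = w 0 0 /\ 0 <= (sg b)%:~R * (x 0 1 - w 0 1).
Proof.
rewrite on_rayP /=; case: b => /=; rewrite ?mul1r ?mulN1r; split.
- by move=> [t [t0 -> ->]]; split; lra.
- by move=> [-> x0]; exists (x 0 1 - w 0 1); split=> //; lra.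
- by move=> [t [t0 -> ->]]; split; rewrite ?mulrN1; lra.
- by move=> [-> x0]; exists (w 0 1 - x 0 1); split=> //; rewrite ?mulrN1; lra.
Qed.

Lemma curveP b w l x : 0 <= l -> curve b w l x <->
  [/\ (sg b)%:~R * (x 0 0 - w 0 0) = x 0 1 - w 0 1, 0 <= x 0 1 - w 0 1 & x 0 1 - w 0 1 <= l] \/
  (x 0 1 - w 0 1 = 0 /\ (sg b)%:~R * (x 0 0 - w 0 0) <= 0) \/
  ((sg b)%:~R * (x 0 0 - w 0 0) = 0 /\ x 0 1 - w 0 1 <= 0) \/
  (x 0 1 - w 0 1 = l /\ l <= (sg b)%:~R * (x 0 0 - w 0 0)) \/
  ((sg b)%:~R * (x 0 0 - w 0 0) = l /\ l <= x 0 1 - w 0 1).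
Proof.
move=> l0.
have -> : curve b w l x <-> segment w (w + l *: vec (edge_dir b)) x \/
    on_ray w (sg (~~ b), 0) x \/ on_ray w (0, sg false) x \/
    on_ray (w + l *: vec (edge_dir b)) (sg b, 0) x \/
    on_ray (w + l *: vec (edge_dir b)) (0, sg true) x.
  have sN : (- sg b, 0) = (sg (~~ b), 0) by case: b.
  by rewrite -!rayE /curve sN /setU /=; tauto.
rewrite segmentP // !on_rayh !on_rayv !addvE0 !addvE1 /=.
case: b => /=; split=> [[[? ? ?]|[[? ?]|[[? ?]|[[? ?]|[? ?]]]]]|[[? ? ?]|[[? ?]|[[? ?]|[[? ?]|[? ?]]]]]].
all: try by (left; split; lra).
all: try by (right; left; split; lra).
all: try by (right; right; left; split; lra).
all: try by (right; right; right; left; split; lra).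
all: try by (right; right; right; right; split; lra).
Qed.

(** Without the parameter, membership is proportionality together with a nonnegative scalar product:
    for a fixed direction these are linear conditions. *)
Lemma on_ray_detP w x (y : int * int) : y != (0, 0) -> on_ray w y x <->
  y.1%:~R * (x 0 1 - w 0 1) = y.2%:~R * (x 0 0 - w 0 0) /\
  0 <= y.1%:~R * (x 0 0 - w 0 0) + y.2%:~R * (x 0 1 - w 0 1).
Proof.
move=> y0; have n0 : 0 < (y.1%:~R * y.1%:~R + y.2%:~R * y.2%:~R : R).
  rewrite -!expr2 lt_neqAle addr_ge0 ?sqr_ge0 // andbT eq_sym paddr_eq0 ?sqr_ge0 //.
  by rewrite !sqrf_eq0 !intr_eq0; move: y0; rewrite [y]surjective_pairing xpair_eqE.
rewrite on_rayP; split=> [[t [t0 -> ->]]|[E x0]].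
  by split; [ring|rewrite -!addrA ![w _ _ + (_ + - _)]addrCA !subrr !addr0; nra].
exists ((y.1%:~R * (x 0 0 - w 0 0) + y.2%:~R * (x 0 1 - w 0 1)) /
  (y.1%:~R * y.1%:~R + y.2%:~R * y.2%:~R)).
move: (x 0 0 - w 0 0) (x 0 1 - w 0 1) (subrKC (w 0 0) (x 0 0)) (subrKC (w 0 1) (x 0 1)) E x0.
move=> X Y <- <- E XY0; split; first by rewrite divr_ge0 // ltW.
  congr (_ + _); have XE : (y.1%:~R * X + y.2%:~R * Y) * y.1%:~R =
      X * (y.1%:~R * y.1%:~R + y.2%:~R * y.2%:~R).
    by transitivity (y.1%:~R * X * y.1%:~R + y.2%:~R * (y.1%:~R * Y)); [ring|rewrite E; ring].
  by rewrite mulrAC XE mulfK // lt0r_neq0.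
congr (_ + _); have YE : (y.1%:~R * X + y.2%:~R * Y) * y.2%:~R =
    Y * (y.1%:~R * y.1%:~R + y.2%:~R * y.2%:~R).
  by transitivity (y.1%:~R * (y.2%:~R * X) + y.2%:~R * Y * y.2%:~R); [ring|rewrite -E; ring].
by rewrite mulrAC YE mulfK // lt0r_neq0.
Qed.

Definition opp (y : int * int) : int * int := (- y.1, - y.2).

Definition legs b w l : seq ('rV[R]_2 * (int * int)) :=
  [:: (w, (- sg b, 0)); (w, (0, -1));
      (w + l *: vec (edge_dir b), (sg b, 0)); (w + l *: vec (edge_dir b), (0, 1))].

Lemma curve_on_raysP b w l (p : 'rV[R]_2) x (ys : seq (int * int)) :
  0 <= l -> all (fun y => y != (0, 0)) ys ->
  (curve b w l x <-> foldr (fun (y : int * int) P =>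
    (y.1%:~R * (x 0 1 - p 0 1) = y.2%:~R * (x 0 0 - p 0 0) /\
    0 <= y.1%:~R * (x 0 0 - p 0 0) + y.2%:~R * (x 0 1 - p 0 1)) \/ P) False ys) ->
  (curve b w l x <-> some_ray p ys x).
Proof.
move=> l0 ys0 ->; elim: ys ys0 => //= y ys IH /andP[y0 /IH {}IH].
by rewrite /some_ray /= -/(some_ray p ys x) on_ray_detP // IH.
Qed.

Ltac split_hyps := repeat match goal with
  | H : _ \/ _ |- _ => destruct H
  | H : _ /\ _ |- _ => destruct H
  | H : [/\ _, _ & _] |- _ => destruct H
  | H : False |- _ => destruct H end.

Ltac choose_lra := first
  [solve [split; lra] | solve [left; split; lra] | right; choose_lra | solve [exfalso; lra]].

(** Balls are squares here: within distance [l] of one vertex, the other vertex and its legs are out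
    of sight. *)
Lemma star_lower b w l : 0 < l ->
  star (curve b w l) w [:: (- sg b, 0); (0, -1); edge_dir b].
Proof.
move=> l0; have l1 := ltW l0; apply: (starP l0) => x /ball2P[_].
rewrite !ltr_norml => /andP[h1 h2] /andP[h3 h4].
apply: curve_on_raysP => //; [by case: (b)|rewrite curveP //].
by case: b h1 h2 h3 h4 => /= *; split=> ?; split_hyps; choose_lra.
Qed.

Lemma star_upper b w l : 0 < l ->
  star (curve b w l) (w + l *: vec (edge_dir b)) [:: (sg b, 0); (0, 1); opp (edge_dir b)].
Proof.
move=> l0; have l1 := ltW l0; apply: (starP l0) => x /ball2P[_].
rewrite !addvE0 !addvE1 !ltr_norml => /andP[h1 h2] /andP[h3 h4].
apply: curve_on_raysP => //; [by case: (b)|rewrite curveP // !addvE0 !addvE1].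
by case: b h1 h2 h3 h4 => /= *; split=> ?; split_hyps; choose_lra.
Qed.

Lemma star_vertex b w :
  star (curve b w 0) w [:: (- sg b, 0); (0, -1); (sg b, 0); (0, 1)].
Proof.
apply: (starP ltr01) => x /ball2P[_].
rewrite !ltr_norml => /andP[h1 h2] /andP[h3 h4].
apply: curve_on_raysP => //; [by case: (b)|rewrite curveP //].
by case: b h1 h2 h3 h4 => /= *; split=> ?; split_hyps; choose_lra.
Qed.

Lemma star_line (L : set 'rV[R]_2) (p : 'rV[R]_2) (y : int * int) (r : R) :
  y != (0, 0) -> 0 < r ->
  (forall x, ball p r x ->
    (L x <-> y.1%:~R * (x 0 1 - p 0 1) = y.2%:~R * (x 0 0 - p 0 0))) ->
  star L p [:: y; opp y].
Proof.
move=> y0 r0 Lr; apply: (starP r0) => x /Lr ->.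
have oy0 : opp y != (0, 0).
  by move: y0; rewrite /opp [y]surjective_pairing !xpair_eqE /= !oppr_eq0.
rewrite /some_ray /= !on_ray_detP // /opp /= !rmorphN /= !mulNr.
split=> [E|[[]|[[+ _]|//]] //]; last by move/oppr_inj.
have [s0|s0] := lerP 0 (y.1%:~R * (x 0 0 - p 0 0) + y.2%:~R * (x 0 1 - p 0 1)).
  by left.
by right; left; rewrite E; split=> //; rewrite -opprD oppr_ge0 ltW.
Qed.

Lemma star_leg b w l t lg : 0 <= l -> 0 < t -> lg \in legs b w l ->
  star (curve b w l) (lg.1 + t *: vec lg.2) [:: lg.2; opp lg.2].
Proof.
move=> l0 t0; rewrite !inE => /or4P[] /eqP -> /=; (apply: (star_line _ t0); first by case: b);
move=> x /ball2P[_]; rewrite !addvE0 !addvE1 !ltr_norml => /andP[h1 h2] /andP[h3 h4];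
rewrite curveP //;
by case: b h1 h2 h3 h4 => /= *; split=> ?; split_hyps; first [lra | choose_lra].
Qed.

Lemma star_bounded_edge b w l t : 0 < t -> t < l ->
  star (curve b w l) (w + t *: vec (edge_dir b)) [:: edge_dir b; opp (edge_dir b)].
Proof.
move=> t0 tl; have l0 : 0 <= l by lra.
have r0 : 0 < Order.min t (l - t) by rewrite lt_min t0 subr_gt0.
apply: (star_line _ r0) => [|x /ball2P[_]]; first by case: b.
rewrite !lt_min => /andP[+ +] /andP[+ +].
rewrite !addvE0 !addvE1 !ltr_norml => /andP[h1 h2] /andP[h3 h4] /andP[h5 h6] /andP[h7 h8].
rewrite curveP //.
by case: b h1 h2 h3 h4 h5 h6 h7 h8 => /= *; split=> ?; split_hyps; first [lra | choose_lra].
Qed.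

End Curves.

(** * Tritangency as a parity condition *)

Section Intersection.
Variables (R : realType) (c : 'I_4 -> 'I_4 -> R).
Hypothesis smooth : unimodular_newton_subdivision c.
Variables (b : bool) (w : 'rV[R]_2) (l : R).
Hypothesis l_ge0 : 0 <= l.
Implicit Types (p x : 'rV[R]_2) (y : int * int) (t : R) (lg : 'rV[R]_2 * (int * int)).

Notation L := (curve b w l).
Notation G := (corner_locus c).
Notation M := (maximizers c).
Notation w1 := (w + l *: vec (edge_dir b)).
Notation LG := (legs b w l).
Let d := edge_dir b.
Notation mult := (stable_mult G L).

Lemma legs_ok lg : lg \in LG -> directions_ok [:: lg.2; opp lg.2].
Proof.
by rewrite !inE => /or4P[] /eqP ->; rewrite /directions_ok !big_cons !big_nil; case: (b).
Qed.

Lemma mult_leg lg t : lg \in LG -> 0 < t ->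
  (mult (lg.1 + t *: vec lg.2))%:Z =
  top (M (lg.1 + t *: vec lg.2)) (pairing lg.2) - bot (M (lg.1 + t *: vec lg.2)) (pairing lg.2).
Proof.
move=> lgs t0; rewrite (stable_mult_star smooth (legs_ok lgs) (star_leg l_ge0 t0 lgs)).
by rewrite !big_cons big_nil addr0 top_opp.
Qed.

Lemma mult_edge t : 0 < t -> t < l -> (mult (w + t *: vec d))%:Z =
  top (M (w + t *: vec d)) (pairing d) - bot (M (w + t *: vec d)) (pairing d).
Proof.
move=> t0 tl.
have ok : directions_ok [:: d; opp d] by rewrite /d /directions_ok !big_cons !big_nil; case: (b).
rewrite (stable_mult_star smooth ok (star_bounded_edge b w t0 tl)).
by rewrite !big_cons big_nil addr0 top_opp.
Qed.

Lemma mult_lower : 0 < l -> (mult w)%:Z =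
  top (M w) (pairing (- sg b, 0)) + top (M w) (pairing (0, -1)) + top (M w) (pairing d).
Proof.
move=> l0; have ok : directions_ok [:: (- sg b, 0); (0, -1); edge_dir b].
  by rewrite /directions_ok !big_cons !big_nil; case: (b).
rewrite (stable_mult_star smooth ok (star_lower b w l0)).
by rewrite !big_cons big_nil addr0 addrA.
Qed.

Lemma mult_upper : 0 < l -> (mult w1)%:Z =
  top (M w1) (pairing (sg b, 0)) + top (M w1) (pairing (0, 1)) - bot (M w1) (pairing d).
Proof.
move=> l0; have ok : directions_ok [:: (sg b, 0); (0, 1); opp (edge_dir b)].
  by rewrite /directions_ok !big_cons !big_nil; case: (b).
rewrite (stable_mult_star smooth ok (star_upper b w l0)).
by rewrite !big_cons big_nil addr0 addrA top_opp.
Qed.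

Lemma mult_vertex : l = 0 -> (mult w)%:Z =
  top (M w) (pairing (- sg b, 0)) + top (M w) (pairing (0, -1)) +
  (top (M w) (pairing (sg b, 0)) + top (M w) (pairing (0, 1))).
Proof.
move=> l0; have ok : directions_ok [:: (- sg b, 0); (0, -1); (sg b, 0); (0, 1)].
  by rewrite /directions_ok !big_cons !big_nil; case: (b).
rewrite l0 (stable_mult_star smooth ok (star_vertex b w)).
by rewrite !big_cons big_nil addr0 !addrA.
Qed.

Lemma curve_leg lg t : lg \in LG -> 0 <= t -> L (lg.1 + t *: vec lg.2).
Proof.
move=> + t0; rewrite !inE => /or4P[] /eqP -> /=.
- by left; left; left; right; exists t.
- by left; left; right; exists t.
- by left; right; exists t.
- by right; exists t.
Qed.

Lemma curve_edge t : 0 <= t -> t <= l -> L (w + t *: vec d).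
Proof.
move=> t0 tl; rewrite curveP //; left.
by rewrite !addvE0 !addvE1 /=; case: (b) => /=; split; lra.
Qed.

Lemma curve_points x : L x -> [\/ x = w, x = w1,
  exists lg t, [/\ lg \in LG, 0 < t & x = lg.1 + t *: vec lg.2] |
  exists t, [/\ 0 < t, t < l & x = w + t *: vec d]].
Proof.
have leg lg : lg \in LG -> ray lg.1 (vec lg.2) x -> x = lg.1 \/
    exists lg t, [/\ lg \in LG, 0 < t & x = lg.1 + t *: vec lg.2].
  move=> lgs [t /= t0 <-]; have [->|tn0] := eqVneq t 0.
    by left; rewrite scale0r addr0.
  by right; exists lg, t; split=> //; rewrite lt_neqAle eq_sym tn0.
have mem i : (i < 4)%N -> nth (w, (0, 0)) LG i \in LG by move=> ?; exact: mem_nth.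
case=> [[[[|]|]|]|].
- move=> [t /=]; rewrite in_itv /= => /andP[t0 t1] <-.
  have -> : w + t *: (w1 - w) = w + (t * l) *: vec d by apply: rv2P; rewrite !mxE; ring.
  have [->|tn0] := eqVneq t 0; first by constructor 1; rewrite mul0r scale0r addr0.
  have [->|t1n] := eqVneq t 1; first by constructor 2; rewrite mul1r.
  have [->|ln0] := eqVneq l 0; first by constructor 1; rewrite mulr0 scale0r addr0.
  have l0 : 0 < l by rewrite lt_neqAle eq_sym ln0.
  constructor 4; exists (t * l); split=> //.
    by rewrite mulr_gt0 // lt_neqAle eq_sym tn0.
  by rewrite gtr_pMl // lt_neqAle t1n.
- by move/(leg _ (mem 0%N isT)) => [->|]; [constructor 1|constructor 3].
- by move/(leg _ (mem 1%N isT)) => [->|]; [constructor 1|constructor 3].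
- by move/(leg _ (mem 2%N isT)) => [->|]; [constructor 2|constructor 3].
- by move/(leg _ (mem 3%N isT)) => [->|]; [constructor 2|constructor 3].
Qed.

(* That is: a point of the curve off [G] cuts it into parts of even total multiplicity.  The part
   containing the end of a leg [lg] has total multiplicity the steepest slope of a monomial along
   [lg] minus the slope of the monomial dominant at the point. *)
Definition even_cuts : Prop :=
  (forall lg t a, lg \in LG -> 0 < t -> M (lg.1 + t *: vec lg.2) = [set a]%SET ->
     (2 %| top [set: 'I_4 * 'I_4] (pairing lg.2) - pairing lg.2 a)%Z) /\
  (forall t a, 0 < t -> t < l -> M (w + t *: vec d) = [set a]%SET ->
     (2 %| top [set: 'I_4 * 'I_4] (pairing (sg b, 0))
         + top [set: 'I_4 * 'I_4] (pairing (0, 1)) - pairing d a)%Z).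

(** Models membership in a component of the intersection: constancy along its segments is all that
    the parity count needs. *)
Definition saturated (P : pred 'rV[R]_2) : Prop := forall x y : 'rV[R]_2,
  (forall t, 0 <= t -> t <= 1 -> (L `&` G) (x + t *: (y - x))) -> P x = P y.

Lemma saturated_line P p y (s t : R) : saturated P -> s < t ->
  (forall r, s <= r -> r <= t -> L (p + r *: vec y)) ->
  (forall r, s <= r -> r <= t -> (1 < #|M (p + r *: vec y)|)%N) ->
  P (p + s *: vec y) = P (p + t *: vec y).
Proof.
move=> sat st Lr Mr; apply: sat => u u0 u1.
have -> : p + s *: vec y + u *: (p + t *: vec y - (p + s *: vec y)) =
    p + (s + u * (t - s)) *: vec y by apply: rv2P; rewrite !mxE; ring.
by split; [apply: Lr|rewrite /corner_locus /=; apply: Mr]; nra.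
Qed.

Let a0T := finset.in_setT (ord0 : 'I_4, ord0 : 'I_4).

(** The breaks of the polynomial restricted to the leg are its points of positive multiplicity. The
    vertex at [t = 0] is excluded, since other edges contribute there too. *)
Lemma leg_breaks lg : lg \in LG -> exists ts : seq R, [/\ uniq ts,
  (forall t, t \in ts -> 0 < t) /\
  (forall t, 0 < t -> mult (lg.1 + t *: vec lg.2) != 0%N -> t \in ts),
  \sum_(t <- ts) (mult (lg.1 + t *: vec lg.2))%:Z =
    top [set: 'I_4 * 'I_4] (pairing lg.2) - top (M lg.1) (pairing lg.2),
  (forall P, saturated P -> even_cuts ->
    (2 %| (if P lg.1 then top [set: 'I_4 * 'I_4] (pairing lg.2) - top (M lg.1) (pairing lg.2)
           else 0) - \sum_(t <- ts | P (lg.1 + t *: vec lg.2))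
             (mult (lg.1 + t *: vec lg.2))%:Z)%Z) &
  forall t0, 0 <= t0 -> \sum_(t <- ts | t0 < t) (mult (lg.1 + t *: vec lg.2))%:Z =
    top [set: 'I_4 * 'I_4] (pairing lg.2) - top (M (lg.1 + t0 *: vec lg.2)) (pairing lg.2)].
Proof.
move=> lgs; pose am := argmaxes [set: 'I_4 * 'I_4] (monomial_value c lg.1) (pairing lg.2).
have amE t : am t = M (lg.1 + t *: vec lg.2) by rewrite /am -maximizers_line.
have am0 : am 0 = M lg.1 by rewrite amE scale0r addr0.
have [ts [uts tsE tsum tpar]] :=
  breaks_after (monomial_value c lg.1) (pairing lg.2) 0 a0T.
have sumE (Q : pred R) : \sum_(t <- ts | Q t) (mult (lg.1 + t *: vec lg.2))%:Z =
    \sum_(t <- ts | Q t) (top (am t) (pairing lg.2) - bot (am t) (pairing lg.2)).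
  rewrite big_seq_cond [RHS]big_seq_cond; apply: eq_bigr => t /andP[tts _].
  by rewrite mult_leg ?amE //; move: tts; rewrite tsE => /andP[].
exists ts; split=> //.
- split=> t; first by rewrite tsE => /andP[].
  move=> t0; rewrite -eqz_nat mult_leg // subr_eq0 => tb; rewrite tsE t0 /=.
  rewrite /break lt_neqAle eq_sym -/(am t) amE tb /=.
  by have [e eM] := maximizers_neq0 c (lg.1 + t *: vec lg.2); exact: bot_le_top eM.
- by rewrite sumE tsum -/(am 0) am0.
- move=> P sat [ev _]; rewrite sumE.
  have := tpar (fun t => P (lg.1 + t *: vec lg.2)); rewrite -/(am 0) am0 scale0r addr0; apply.
    move=> s t s0 st Mst; apply: saturated_line => // r sr rt.
      by apply: curve_leg => //; exact: le_trans s0 sr.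
    by rewrite -amE; exact: Mst.
  by move=> t a t0; rewrite -/(am t) amE; exact: ev.
- move=> t0 t00; rewrite sumE -amE.
  exact: (breaks_after_tail a0T t00 uts tsE).
Qed.

Lemma edge_breaks : exists ts : seq R, [/\ uniq ts,
  (forall t, t \in ts -> 0 < t < l) /\
  (forall t, 0 < t -> t < l -> mult (w + t *: vec d) != 0%N -> t \in ts),
  (0 < l -> \sum_(t <- ts) (mult (w + t *: vec d))%:Z =
    bot (M w1) (pairing d) - top (M w) (pairing d)),
  (forall P (p : int), 0 < l -> saturated P -> even_cuts ->
    p = top [set: 'I_4 * 'I_4] (pairing (sg b, 0))
      + top [set: 'I_4 * 'I_4] (pairing (0, 1)) ->
    (2 %| (if P w then p - top (M w) (pairing d) else 0) +
          (if P w1 then bot (M w1) (pairing d) - p else 0) -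
          \sum_(t <- ts | P (w + t *: vec d)) (mult (w + t *: vec d))%:Z)%Z) &
  forall t0, 0 <= t0 -> t0 < l -> \sum_(t <- ts | t0 < t) (mult (w + t *: vec d))%:Z =
    bot (M w1) (pairing d) - top (M (w + t0 *: vec d)) (pairing d)].
Proof.
have [l0|l0] := eqVneq l 0.
  exists [::]; split=> //.
  - split=> // t t0; rewrite l0 => tl; by have := lt_trans t0 tl; rewrite ltxx.
  - by rewrite l0 ltxx.
  - by move=> P p lpos; exfalso; move: lpos; rewrite l0 ltxx.
  - by move=> t0 t00; rewrite l0 ltNge t00.
have {}l0 : 0 < l by rewrite lt_neqAle eq_sym l0.
pose am := argmaxes [set: 'I_4 * 'I_4] (monomial_value c w) (pairing d).
have amE t : am t = M (w + t *: vec d) by rewrite /am -maximizers_line.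
have am0 : am 0 = M w by rewrite amE scale0r addr0.
have [ts [uts tsE tsum tpar]] :=
  breaks_between (monomial_value c w) (pairing d) a0T l0.
have sumE (Q : pred R) : \sum_(t <- ts | Q t) (mult (w + t *: vec d))%:Z =
    \sum_(t <- ts | Q t) (top (am t) (pairing d) - bot (am t) (pairing d)).
  rewrite big_seq_cond [RHS]big_seq_cond; apply: eq_bigr => t /andP[tts _].
  by move: tts; rewrite tsE => /and3P[t0 tl _]; rewrite mult_edge ?amE.
exists ts; split=> //.
- split=> t; first by rewrite tsE => /and3P[-> ->].
  move=> t0 tl; rewrite -eqz_nat mult_edge // subr_eq0 => tb; rewrite tsE t0 tl /=.
  rewrite /break lt_neqAle eq_sym -/(am t) amE tb /=.
  by have [e eM] := maximizers_neq0 c (w + t *: vec d); exact: bot_le_top eM.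
- by rewrite sumE tsum -/(am 0) -/(am l) am0 amE.
- move=> P p _ sat [_ ev] pE; rewrite sumE.
  have := tpar (fun t => P (w + t *: vec d)) p.
  rewrite -/(am 0) -/(am l) am0 amE scale0r addr0; apply.
    move=> s t s0 st tl Mst; apply: saturated_line => // r sr rt.
      by apply: curve_edge; [exact: le_trans s0 sr|exact: le_trans rt tl].
    by rewrite -amE; exact: Mst.
  by move=> t a t0 tl; rewrite -/(am t) amE pE; exact: ev.
- move=> t0 t00 tl; rewrite sumE -!amE.
  exact: (breaks_between_tail a0T t00 tl uts tsE).
Qed.

End Intersection.

(** * Cutting a (1,1)-curve by a line *)

Section Support.
Variables (R : realType) (c : 'I_4 -> 'I_4 -> R).
Hypothesis smooth : unimodular_newton_subdivision c.
Variables (b : bool) (w : 'rV[R]_2) (l : R).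
Hypothesis l_ge0 : 0 <= l.
Implicit Types (p q x : 'rV[R]_2) (y : int * int) (t : R) (lg : 'rV[R]_2 * (int * int)).

Notation L := (curve b w l).
Notation G := (corner_locus c).
Notation LG := (legs b w l).
Notation steepest y := (top [set: 'I_4 * 'I_4] (pairing y)).
Let d := edge_dir b.

Definition ip y x : R := y.1%:~R * x 0 0 + y.2%:~R * x 0 1.

Lemma ip_diff y (p q : 'rV[R]_2) : ip y (p - q) =
  y.1%:~R * (p 0 0 - q 0 0) + y.2%:~R * (p 0 1 - q 0 1).
Proof. by rewrite /ip !mxE. Qed.

Lemma steepest_up : steepest (0, 1) = 3.
Proof.
rewrite (@top_eq _ _ _ (ord0, ord_max)) ?finset.in_setT // => a _.
by rewrite /pairing /= !mulr0 !mulr1 !add0r lez_nat -ltnS.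
Qed.

Lemma steepest_down : steepest (0, -1) = 0.
Proof.
rewrite (@top_eq _ _ _ (ord0, ord0)) ?finset.in_setT // => a _.
by rewrite /pairing /= !mulr0 !mulrN1 !add0r lerN2.
Qed.

Lemma steepest_left : steepest (-1, 0) = 0.
Proof.
rewrite (@top_eq _ _ _ (ord0, ord0)) ?finset.in_setT // => a _.
by rewrite /pairing /= !mulr0 !mulrN1 !addr0 lerN2.
Qed.

Lemma steepest_right : steepest (1, 0) = 3.
Proof.
rewrite (@top_eq _ _ _ (ord_max, ord0)) ?finset.in_setT // => a _.
by rewrite /pairing /= !mulr0 !mulr1 !addr0 lez_nat -ltnS.
Qed.

Lemma steepest_sides : steepest (- sg b, 0) + steepest (sg b, 0) = 3.
Proof.
by case: (b); rewrite /= ?opprK steepest_left steepest_right.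
Qed.

Ltac coords E := have := congr1 (fun x : 'rV[R]_2 => x 0 0) E;
  have := congr1 (fun x : 'rV[R]_2 => x 0 1) E; rewrite !addvE0 !addvE1 /=.

Lemma legs_inj lg lg' s t : lg \in LG -> lg' \in LG -> 0 < s -> 0 < t ->
  lg.1 + s *: vec lg.2 = lg'.1 + t *: vec lg'.2 -> lg = lg' /\ s = t.
Proof.
move=> + + s0 t0; rewrite !inE => /or4P[] /eqP -> /or4P[] /eqP -> /= E; coords E;
have l0 := l_ge0; case: (b) => /= E1 E0; first [by exfalso; lra | by split=> //; lra].
Qed.

Lemma legs_off_edge lg s u : lg \in LG -> 0 < s -> 0 <= u -> u <= l ->
  lg.1 + s *: vec lg.2 <> w + u *: vec d.
Proof.
move=> + s0 u0 ul; rewrite !inE => /or4P[] /eqP -> /= E; coords E;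
have l0 := l_ge0; case: (b) => /= E1 E0; lra.
Qed.

Lemma edge_inj (s t : R) : w + s *: vec d = w + t *: vec d -> s = t.
Proof. by move=> E; coords E => /= E1 _; lra. Qed.

Lemma uniq_legs : uniq LG.
Proof. by rewrite /= !inE !xpair_eqE !negb_or; case: (b); rewrite ?andbF. Qed.

(** The perpendicular through a point of a leg separates the far end of that leg from the rest of
    the curve, so a cut of the curve becomes a half-plane. *)
Lemma leg_cut lg t : lg \in LG -> 0 < t ->
  (forall u, 0 <= u -> u <= l ->
     ip lg.2 (w + u *: vec d - (lg.1 + t *: vec lg.2)) < 0) /\
  forall lg' s, lg' \in LG -> 0 < s ->
    (lg' != lg -> ip lg.2 (lg'.1 + s *: vec lg'.2 - (lg.1 + t *: vec lg.2)) < 0) /\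
    ip lg.2 (lg.1 + s *: vec lg.2 - (lg.1 + t *: vec lg.2)) = s - t.
Proof.
move=> lgs t0; split=> [u u0 ul|lg' s + s0]; move: lgs; rewrite !inE ip_diff.
  move=> /or4P[] /eqP -> /=; rewrite !addvE0 !addvE1 /=; have l0 := l_ge0; case: (b) => /=; lra.
rewrite ip_diff !addvE0 !addvE1; move=> /or4P[] /eqP -> /or4P[] /eqP ->;
rewrite ?eqxx /= ?addvE0 ?addvE1 /=; split=> // *; have l0 := l_ge0; case: (b) => /=; lra.
Qed.

(** Likewise on the bounded edge: the perpendicular separates the two vertices with their legs; legs
    0 and 1 start at the lower vertex, legs 2 and 3 at the upper one. *)
Lemma edge_cut t : 0 < t -> t < l ->
  (forall u, ip d (w + u *: vec d - (w + t *: vec d)) = 2 * (u - t)) /\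
  forall i s, (i < 4)%N -> 0 < s -> let lg := nth (w, (0, 0)) LG i in
    if (i < 2)%N then ip d (lg.1 + s *: vec lg.2 - (w + t *: vec d)) < 0
    else 0 < ip d (lg.1 + s *: vec lg.2 - (w + t *: vec d)).
Proof.
move=> t0 tl; split=> [u|]; rewrite /d.
  by rewrite ip_diff !addvE0 !addvE1 /=; have l0 := l_ge0; case: (b) => /=; lra.
by case=> [|[|[|[|//]]]] s _ s0 /=; rewrite ip_diff !addvE0 !addvE1 /=; have l0 := l_ge0; case: (b) => /=; lra.
Qed.

End Support.

(** * Multiplicities added up over the whole curve *)

Section SupportSequence.
Variables (R : realType) (c : 'I_4 -> 'I_4 -> R).
Hypothesis smooth : unimodular_newton_subdivision c.
Variables (b : bool) (w : 'rV[R]_2) (l : R).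
Hypothesis l_ge0 : 0 <= l.
Implicit Types (p x : 'rV[R]_2) (y : int * int) (t : R) (lg : 'rV[R]_2 * (int * int)).

Notation L := (curve b w l).
Notation G := (corner_locus c).
Notation M := (maximizers c).
Notation w1 := (w + l *: vec (edge_dir b)).
Notation LG := (legs b w l).
Notation steepest y := (top [set: 'I_4 * 'I_4] (pairing y)).
Notation d := (edge_dir b).
Notation mult := (stable_mult G L).

Lemma big_allpairs_cond (I J T : Type) (f : I -> J -> T) (s : seq I) (ts : I -> seq J)
    (P : pred T) (F : T -> int) :
  \sum_(x <- [seq f i j | i <- s, j <- ts i] | P x) F x =
  \sum_(i <- s) \sum_(j <- ts i | P (f i j)) F (f i j).
Proof.
rewrite big_mkcond big_allpairs_dep; apply: eq_bigr => i _.
by rewrite -big_mkcond.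
Qed.

Lemma big_seq2_cond (T : Type) (x y : T) (P : pred T) (F : T -> int) :
  \sum_(z <- [:: x; y] | P z) F z = (if P x then F x else 0) + (if P y then F y else 0).
Proof. by rewrite !big_cons big_nil; case: (P x); case: (P y); rewrite ?addr0 ?add0r. Qed.

(** The slopes at the vertices cancel against the starting slopes of the legs and the edge. What
    remains are the steepest slopes along the four legs, 3 + 0 + 3. *)
Lemma total_six (l0 : bool) (p1 p2 p3 p4 t1 t2 t3 t4 td bd s5 : int) :
  p1 + p3 = 3 -> p2 = 0 -> p4 = 3 -> (l0 -> s5 = 0) -> (~~ l0 -> s5 = bd - td) ->
  (if l0 then t1 + t2 + (t3 + t4) else (t1 + t2 + td) + (t3 + t4 - bd))
    + (s5 + ((p1 - t1) + ((p2 - t2) + ((p3 - t3) + ((p4 - t4) + 0))))) = 6.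
Proof. by case: l0 => E1 E2 E3 h0 h1; [rewrite (h0 isT)|rewrite (h1 isT)]; lia. Qed.

(** [P0] and [P1] tell whether the predicate holds at the vertices. Up to even terms, the lower
    vertex accounts for 6, which gives the 3 in the witnesses, and the upper one for 0 unless the
    two coincide. *)
Lemma even_total (P0 P1 l0 : bool) (p1 p2 p3 p4 t1 t2 t3 t4 td bd s1 s2 s3 s4 s5 : int) :
  p1 + p3 = 3 -> p2 = 0 -> p4 = 3 ->
  (l0 -> P0 = P1) -> (l0 -> s5 = 0) ->
  (2 %| (if P0 then p1 - t1 else 0) - s1)%Z ->
  (2 %| (if P0 then p2 - t2 else 0) - s2)%Z ->
  (2 %| (if P1 then p3 - t3 else 0) - s3)%Z ->
  (2 %| (if P1 then p4 - t4 else 0) - s4)%Z ->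
  (~~ l0 -> 2 %| (if P0 then p3 + p4 - td else 0) + (if P1 then bd - (p3 + p4) else 0) - s5)%Z ->
  (2 %| (if l0 then if P0 then t1 + t2 + (t3 + t4) else 0
         else (if P0 then t1 + t2 + td else 0) + (if P1 then t3 + t4 - bd else 0))
        + (s5 + (s1 + (s2 + (s3 + (s4 + 0))))))%Z.
Proof.
move=> E1 E2 E3 h0 h1 /dvdzP[k1 k1E] /dvdzP[k2 k2E] /dvdzP[k3 k3E] /dvdzP[k4 k4E] h5.
apply/dvdzP; case: l0 h0 h1 h5 => h0 h1 h5.
  exists ((if P0 then 3 else 0) - k1 - k2 - k3 - k4).
  have {}h0 := h0 isT; have {}h1 := h1 isT; subst P1 s5.
  by case: P0 k1E k2E k3E k4E {h5} => k1E k2E k3E k4E; lia.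
have /dvdzP[k5 k5E] := h5 isT.
exists ((if P0 then 3 else 0) - k1 - k2 - k3 - k4 - k5).
by case: P0 k1E k2E k5E {h0 h5} => k1E k2E; case: P1 k3E k4E => k3E k4E k5E; lia.
Qed.

(** Made total in [lg], so that a choice function can be extracted. *)
Lemma leg_breaks_or lg : exists ts : seq R, lg \in LG -> [/\ uniq ts,
  (forall t, t \in ts -> 0 < t) /\
  (forall t, 0 < t -> mult (lg.1 + t *: vec lg.2) != 0%N -> t \in ts),
  \sum_(t <- ts) (mult (lg.1 + t *: vec lg.2))%:Z = steepest lg.2 - top (M lg.1) (pairing lg.2),
  (forall P, saturated c b w l P -> even_cuts c b w l ->
    (2 %| (if P lg.1 then steepest lg.2 - top (M lg.1) (pairing lg.2) else 0)
        - \sum_(t <- ts | P (lg.1 + t *: vec lg.2)) (mult (lg.1 + t *: vec lg.2))%:Z)%Z) &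
  forall t0, 0 <= t0 -> \sum_(t <- ts | t0 < t) (mult (lg.1 + t *: vec lg.2))%:Z =
    steepest lg.2 - top (M (lg.1 + t0 *: vec lg.2)) (pairing lg.2)].
Proof.
case: (boolP (lg \in LG)) => [lgs|_]; last by exists [::].
by have [ts tsP] := leg_breaks smooth l_ge0 lgs; exists ts.
Qed.

(** [N] contains all points of nonzero multiplicity but possibly others, such as a vertex off the
    tropical curve; these do not affect the sums. *)
Lemma support_seq : exists N : seq 'rV[R]_2, [/\ uniq N,
  (forall p, p \in N -> L p) /\ (forall p, L p -> mult p != 0%N -> p \in N),
  \sum_(p <- N) (mult p)%:Z = 6,
  (forall P, saturated c b w l P -> even_cuts c b w l ->
     (2 %| \sum_(p <- N | P p) (mult p)%:Z)%Z) &
  (forall lg t a, lg \in LG -> 0 < t -> M (lg.1 + t *: vec lg.2) = [set a]%SET ->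
     \sum_(p <- N | 0 < ip lg.2 (p - (lg.1 + t *: vec lg.2))) (mult p)%:Z =
       steepest lg.2 - pairing lg.2 a) /\
  (forall t a, 0 < t -> t < l -> M (w + t *: vec d) = [set a]%SET ->
     \sum_(p <- N | 0 < ip d (p - (w + t *: vec d))) (mult p)%:Z =
       steepest (sg b, 0) + steepest (0, 1) - pairing d a)].
Proof.
have [ts tsP] := choice leg_breaks_or.
have [es [esU [esl esN] esum epar ecut]] := edge_breaks smooth b w l_ge0.
have tsU lg : lg \in LG -> uniq (ts lg) by move=> /tsP[].
(* For [l = 0] the vertices coincide and must be counted once. *)
pose vs := if l == 0 then [:: w] else [:: w; w1].
pose ep := [seq w + t *: vec d | t <- es].
pose lp := [seq lg.1 + t *: vec lg.2 | lg <- LG, t <- ts lg].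
have vsE p : p \in vs -> exists u, [/\ 0 <= u, u <= l & p = w + u *: vec d].
  rewrite /vs; case: ifP => _; rewrite !inE; [move=> /eqP ->|move=> /orP[] /eqP ->].
  - by exists 0; rewrite scale0r addr0.
  - by exists 0; rewrite scale0r addr0.
  - by exists l.
have epE p : p \in ep -> exists2 u, 0 < u < l & p = w + u *: vec d.
  by move=> /mapP[u /esl u0 ->]; exists u.
have lpE p : p \in lp -> exists lg t, [/\ lg \in LG, 0 < t & p = lg.1 + t *: vec lg.2].
  by move=> /allpairsPdep[lg [t [lgs tts ->]]]; exists lg, t; split=> //;
    have [_ [+ _] _ _ _] := tsP lg lgs; exact.
pose N := vs ++ ep ++ lp.
have sumE (P : pred 'rV[R]_2) : \sum_(p <- N | P p) (mult p)%:Z = \sum_(p <- vs | P p) (mult p)%:Z +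
    (\sum_(t <- es | P (w + t *: vec d)) (mult (w + t *: vec d))%:Z +
     \sum_(lg <- LG) \sum_(t <- ts lg | P (lg.1 + t *: vec lg.2))
        (mult (lg.1 + t *: vec lg.2))%:Z).
  rewrite /N big_cat /=; congr (_ + _); rewrite big_cat /=; congr (_ + _).
    by rewrite big_map.
  exact: (big_allpairs_cond (fun lg t => lg.1 + t *: vec lg.2) LG ts P (fun p => (mult p)%:Z)).
have LG0 i : (i < 4)%N -> nth (w, (0, 0)) LG i \in LG by move=> ?; exact: mem_nth.
have w0E : w = w + 0 *: vec d by rewrite scale0r addr0.
have sum_legs (F : 'rV[R]_2 * (int * int) -> int) : \sum_(lg <- LG) F lg =
    F (w, (- sg b, 0)) + (F (w, (0, -1)) + (F (w1, (sg b, 0)) + (F (w1, (0, 1)) + 0))).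
  by rewrite !big_cons big_nil.
have mem0 : (w, (- sg b, 0)) \in LG by exact: (LG0 0%N isT).
have mem1 : (w, (0, -1)) \in LG by exact: (LG0 1%N isT).
have mem2 : (w1, (sg b, 0)) \in LG by exact: (LG0 2%N isT).
have mem3 : (w1, (0, 1)) \in LG by exact: (LG0 3%N isT).
have w1E : l == 0 -> w1 = w by move=> /eqP ->; rewrite scale0r addr0.
have es0 : l == 0 -> es = [::].
  move=> /eqP l0; case E : es => [//|t es']; have : t \in es by rewrite E mem_head.
  by move=> /esl; rewrite l0 => /andP[t0 /(lt_trans t0)]; rewrite ltxx.
have vsS (P : pred 'rV[R]_2) : \sum_(p <- vs | P p) (mult p)%:Z =
    if l == 0 then if P w then top (M w) (pairing (- sg b, 0)) + top (M w) (pairing (0, -1))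
      + (top (M w1) (pairing (sg b, 0)) + top (M w1) (pairing (0, 1))) else 0
    else (if P w then top (M w) (pairing (- sg b, 0)) + top (M w) (pairing (0, -1))
            + top (M w) (pairing d) else 0)
       + (if P w1 then top (M w1) (pairing (sg b, 0)) + top (M w1) (pairing (0, 1))
            - bot (M w1) (pairing d) else 0).
  rewrite /vs; case: ifPn => l0.
    by rewrite big_cons big_nil addr0 (w1E l0); case: (P w) => //; apply: mult_vertex => //; apply/eqP.
  have lpos : 0 < l by rewrite lt_neqAle eq_sym l0.
  rewrite big_seq2_cond; congr (_ + _).
    by case: (P w) => //; exact: mult_lower.
  by case: (P w1) => //; exact: mult_upper.
exists N; split.
- rewrite /N cat_uniq [uniq (ep ++ lp)]cat_uniq; apply/and5P; split.
  + rewrite /vs; case: ifPn => //= l0; rewrite inE andbT; apply: contra l0 => /eqP E.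
    by rewrite eq_sym; apply/eqP; apply: (@edge_inj R b w); rewrite -w0E -E.
  + apply/hasPn => p; rewrite mem_cat => /orP[/epE[u /andP[u0 ul] ->]|/lpE[lg [t [lgs t0 ->]]]];
      apply/negP.
      rewrite /vs; case: ifP => _; rewrite /= !inE; [move=> /eqP|move=> /orP[]/eqP].
      * by rewrite {2}w0E => /edge_inj u00; rewrite u00 ltxx in u0.
      * by rewrite {2}w0E => /edge_inj u00; rewrite u00 ltxx in u0.
      * by move=> /edge_inj u00; rewrite u00 ltxx in ul.
    by move=> /vsE[u [u0 ul E]]; exact: (legs_off_edge l_ge0 lgs t0 u0 ul E).
  + by rewrite map_inj_uniq // => s t /edge_inj.
  + apply/hasPn => p /lpE[lg [t [lgs t0 ->]]]; apply/negP => /epE[u /andP[u0 ul] E].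
    exact: (legs_off_edge l_ge0 lgs t0 (ltW u0) (ltW ul) E).
  + apply: (@allpairs_uniq_dep _ (fun _ => R) _ (fun lg t => lg.1 + t *: vec lg.2) LG ts).
      exact: uniq_legs.
      by move=> lg; exact: tsU.
    move=> [lg s] [lg' s'] /allpairsPdep[lg1 [s1 [lgs sts E]]].
    case: E lgs sts => <- <- {lg1 s1} lgs sts /allpairsPdep[lg1 [s1 [lgs' sts' E]]].
    case: E lgs' sts' => <- <- {lg1 s1} lgs' sts' /= E.
    have [_ [s0 _] _ _ _] := tsP lg lgs; have [_ [s0' _] _ _ _] := tsP lg' lgs'.
    have [lgE sE] := legs_inj l_ge0 lgs lgs' (s0 s sts) (s0' s' sts') E.
    by subst lg' s'.
- split=> p.
    rewrite mem_cat [_ \in ep ++ lp]mem_cat;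
      move=> /or3P[/vsE[u [u0 ul ->]]|/epE[u /andP[u0 ul] ->]|/lpE[lg [t [lgs t0 ->]]]].
    + exact: curve_edge.
    + by apply: curve_edge => //; exact: ltW.
    + by apply: curve_leg => //; exact: ltW.
  move=> /(curve_points l_ge0) Lp mp; rewrite mem_cat [_ \in ep ++ lp]mem_cat.
  case: Lp => [pE|pE|[lg [t [lgs t0 pE]]]|[t [t0 tl pE]]].
  + by rewrite pE /vs; case: ifP; rewrite mem_head.
  + rewrite pE /vs; case: eqP => [->|_]; first by rewrite scale0r addr0 mem_head.
    by rewrite !inE eqxx orbT.
  + apply/or3P; constructor 3; apply/allpairsPdep; exists lg, t; split=> //.
    have [_ [_ tin] _ _ _] := tsP lg lgs; apply: tin; first exact: t0.
    by move: mp; rewrite pE.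
  + apply/or3P; constructor 2; apply/mapP; exists t; last exact: pE.
    by move: mp; rewrite pE; exact: esN.
- rewrite (sumE predT) vsS sum_legs.
  have tot lg : lg \in LG -> \sum_(t <- ts lg) (mult (lg.1 + t *: vec lg.2))%:Z =
      steepest lg.2 - top (M lg.1) (pairing lg.2) by move=> /tsP[].
  rewrite /predT (tot _ mem0) (tot _ mem1) (tot _ mem2) (tot _ mem3) {tot}.
  apply: (total_six _ _ _ _ (steepest_sides b) steepest_down steepest_up).
    by move=> /es0 ->; rewrite big_nil.
  by move=> l0; apply: esum; rewrite lt_neqAle eq_sym l0.
- move=> P sat ev; rewrite sumE vsS sum_legs.
  have par lg : lg \in LG ->
    (2 %| (if P lg.1 then steepest lg.2 - top (M lg.1) (pairing lg.2) else 0)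
        - \sum_(t <- ts lg | P (lg.1 + t *: vec lg.2)) (mult (lg.1 + t *: vec lg.2))%:Z)%Z.
    by move=> /tsP[_ _ _ h _]; exact: h.
  apply: (even_total (steepest_sides b) steepest_down steepest_up _ _ (par _ mem0) (par _ mem1)
    (par _ mem2) (par _ mem3)).
  + by move=> /w1E ->.
  + by move=> /es0 ->; rewrite big_nil.
  + by move=> l0; apply: epar => //; rewrite lt_neqAle eq_sym l0.
- split.
    move=> lg t a lgs t0 Ma; have [cut_edge cut_legs] := leg_cut l_ge0 lgs t0.
    rewrite sumE big1_seq; last first.
      move=> p /andP[Pp /vsE[u [u0 ul pE]]].
      by have := cut_edge u u0 ul; rewrite -pE ltNge ltW.
    rewrite big1_seq; last first.
      move=> u /andP[Pu /esl /andP[u0 ul]].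
      by have := cut_edge u (ltW u0) (ltW ul); rewrite ltNge ltW.
    have rest0 : \sum_(lg' <- LG | lg' != lg)
        \sum_(s <- ts lg' | 0 < ip lg.2 (lg'.1 + s *: vec lg'.2 - (lg.1 + t *: vec lg.2)))
          (mult (lg'.1 + s *: vec lg'.2))%:Z = 0.
      apply: big1_seq.
      move=> lg' /andP[lgn lgs']; apply: big1_seq => s /andP[Ps sts].
      have [_ [s0 _] _ _ _] := tsP lg' lgs'.
      by have [/(_ lgn)] := cut_legs lg' s lgs' (s0 s sts); rewrite ltNge ltW.
    rewrite (bigD1_seq lg) ?uniq_legs //= rest0 !add0r addr0.
    have [_ [s0 _] _ _ cutE] := tsP lg lgs.
    have := cutE t (ltW t0); rewrite Ma top1 => <-.
    rewrite big_seq_cond [RHS]big_seq_cond; apply: eq_bigl => s.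
    case: (boolP (s \in ts lg)) => //= sts.
    by have [_ ->] := cut_legs lg s lgs (s0 s sts); rewrite subr_gt0.
  move=> t a t0 tl Ma; have [cut_edge cut_legs] := edge_cut b w l_ge0 t0 tl.
  have lpos := lt_trans t0 tl.
  have l0 : (l == 0) = false by rewrite gt_eqF.
  rewrite sumE vsS l0 sum_legs.
  have -> : (0 < ip d (w - (w + t *: vec d))) = false.
    have := cut_edge 0; rewrite scale0r addr0 => ->.
    by rewrite pmulr_rgt0 // sub0r oppr_gt0 ltNge ltW.
  have -> : 0 < ip d (w1 - (w + t *: vec d)).
    by rewrite cut_edge pmulr_rgt0 // subr_gt0.
  have -> : \sum_(s <- es | 0 < ip d (w + s *: vec d - (w + t *: vec d)))
      (mult (w + s *: vec d))%:Z = bot (M w1) (pairing d) - pairing d a.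
    have := ecut t (ltW t0) tl; rewrite Ma top1 => <-.
    by apply: eq_bigl => s; rewrite cut_edge pmulr_rgt0 // subr_gt0.
  have below i : (i < 2)%N -> let lg := nth (w, (0, 0)) LG i in
      \sum_(s <- ts lg | 0 < ip d (lg.1 + s *: vec lg.2 - (w + t *: vec d)))
        (mult (lg.1 + s *: vec lg.2))%:Z = 0.
    move=> i2 lg; apply: big1_seq => s /andP[Ps sts].
    have i4 : (i < 4)%N by exact: leq_trans i2 _.
    have [_ [s0 _] _ _ _] := tsP lg (LG0 i i4).
    by have := cut_legs i s i4 (s0 s sts); rewrite /= i2 ltNge ltW.
  have above i : (2 <= i < 4)%N -> let lg := nth (w, (0, 0)) LG i in
      \sum_(s <- ts lg | 0 < ip d (lg.1 + s *: vec lg.2 - (w + t *: vec d)))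
        (mult (lg.1 + s *: vec lg.2))%:Z = steepest lg.2 - top (M lg.1) (pairing lg.2).
    move=> /andP[i2 i4] lg; have [_ [s0 _] tot _ _] := tsP lg (LG0 i i4).
    rewrite -tot big_seq_cond [RHS]big_seq_cond; apply: eq_bigl => s.
    case: (boolP (s \in ts lg)) => //= sts.
    by have := cut_legs i s i4 (s0 s sts); rewrite /= ltnNge i2.
  have /= -> := below 0%N isT; have /= -> := below 1%N isT.
  have /= -> := above 2%N isT; have /= -> := above 3%N isT.
  by ring.
Qed.

End SupportSequence.

(** * Positive multiplicity on every component *)

Section Tritangency.
Variables (R : realType) (c : 'I_4 -> 'I_4 -> R).
Hypothesis smooth : unimodular_newton_subdivision c.
Variables (b : bool) (w : 'rV[R]_2) (l : R).
Hypothesis l_ge0 : 0 <= l.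
Implicit Types (p q x : 'rV[R]_2) (y : int * int) (t : R) (lg : 'rV[R]_2 * (int * int)).

Notation L := (curve b w l).
Notation G := (corner_locus c).
Notation Z := (L `&` G).
Notation M := (maximizers c).
Notation w1 := (w + l *: vec (edge_dir b)).
Notation d := (edge_dir b).
Notation mult := (stable_mult G L).

Lemma star_exists p : L p -> exists ys, directions_ok ys /\ star L p ys.
Proof.
move=> /(curve_points l_ge0) Lp.
have low : exists ys, directions_ok ys /\ star L w ys.
  have [l0|l0] := eqVneq l 0.
    exists [:: (- sg b, 0); (0, -1); (sg b, 0); (0, 1)]; rewrite l0; split; last exact: star_vertex.
    by rewrite /directions_ok !big_cons !big_nil; case: (b).
  exists [:: (- sg b, 0); (0, -1); edge_dir b]; split.
    by rewrite /directions_ok !big_cons !big_nil; case: (b).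
  by apply: star_lower; rewrite lt_neqAle eq_sym l0.
case: Lp => [->//|->|[lg [t [lgs t0 ->]]]|[t [t0 tl ->]]].
- have [l0|l0] := eqVneq l 0; first by move: low; rewrite {3}l0 scale0r addr0.
  exists [:: (sg b, 0); (0, 1); opp (edge_dir b)]; split.
    by rewrite /directions_ok !big_cons !big_nil; case: (b).
  by apply: star_upper; rewrite lt_neqAle eq_sym l0.
- by exists [:: lg.2; opp lg.2]; split; [exact: legs_ok lgs|exact: star_leg].
- exists [:: d; opp d]; split; last exact: star_bounded_edge.
  by rewrite /directions_ok !big_cons !big_nil; case: (b).
Qed.

Lemma maximizers_off p : ~ G p -> exists a, M p = [set a]%SET.
Proof.
move=> nG; have [a aM] := maximizers_neq0 c p; exists a.
apply/eqP; rewrite eq_sym eqEcard finset.sub1set aM cards1 leqNgt.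
by apply/negP.
Qed.

(** Off the tropical curve a single monomial supplies all slopes, which cancel by balancing. *)
Lemma mult_support p : L p -> mult p != 0%N -> G p.
Proof.
move=> Lp mp; apply: contrapT => /maximizers_off[a Ma]; move: mp.
have [ys [ok st]] := star_exists Lp.
rewrite -eqz_nat (stable_mult_star smooth ok st) Ma.
have /and5P[_ _ _ /eqP s1 /eqP s2] := ok.
by rewrite (eq_bigr (fun y => pairing y a)) ?pairing_sum ?s1 ?s2 ?mulr0 ?eqxx // => y _; rewrite top1.
Qed.

(** If the sum were 0, balancing would make every monomial of [S] attain each steepest slope; a
    horizontal and a vertical ray then determine its exponent. *)
Lemma sum_top_gt0 (S : {set 'I_4 * 'I_4}) (a a' : 'I_4 * 'I_4) ys (k m : int) :
  directions_ok ys -> a \in S -> a' \in S -> a != a' ->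
  (k, 0) \in ys -> k != 0 -> (0, m) \in ys -> m != 0 ->
  0 < \sum_(y <- ys) top S (pairing y).
Proof.
move=> ok aS a'S aa' kys k0 mys m0.
rewrite lt_neqAle (sum_top_ge0 ok aS) andbT; apply/negP => /eqP E.
have /and5P[_ _ _ /eqP s1 /eqP s2] := ok.
have tight e y : e \in S -> y \in ys -> top S (pairing y) = pairing y e.
  move=> eS yys; apply/eqP; rewrite -subr_eq0.
  have : \sum_(y <- ys) (top S (pairing y) - pairing y e) == 0.
    by rewrite sumrB -E pairing_sum s1 s2 !mulr0 subrr.
  rewrite psumr_eq0 => [/allP/(_ y yys)//|i _].
  by rewrite subr_ge0; exact: top_ge.
have := tight _ _ aS kys; rewrite (tight _ _ a'S kys) /pairing /= !mulr0 !addr0 => /(mulIf k0) [E1].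
have := tight _ _ aS mys; rewrite (tight _ _ a'S mys) /pairing /= !mulr0 !add0r => /(mulIf m0) [E2].
by move/eqP: aa'; apply; rewrite [a]surjective_pairing [a']surjective_pairing; congr (_, _); exact: val_inj.
Qed.

Lemma mult_lower_gt0 : G w -> mult w != 0%N.
Proof.
move=> /card_gt1P[a [a' [aM a'M aa']]].
have [l0|l0] := eqVneq l 0.
  have ok : directions_ok [:: (- sg b, 0); (0, -1); (sg b, 0); (0, 1)].
    by rewrite /directions_ok !big_cons !big_nil; case: (b).
  rewrite -eqz_nat l0 (stable_mult_star smooth ok (star_vertex b w)) gt_eqF //.
  by apply: (@sum_top_gt0 _ a a' _ (sg b) 1) => //; rewrite ?inE ?eqxx ?orbT //; case: (b).
have lpos : 0 < l by rewrite lt_neqAle eq_sym l0.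
have ok : directions_ok [:: (- sg b, 0); (0, -1); edge_dir b].
  by rewrite /directions_ok !big_cons !big_nil; case: (b).
rewrite -eqz_nat (stable_mult_star smooth ok (star_lower b w lpos)) gt_eqF //.
by apply: (@sum_top_gt0 _ a a' _ (- sg b) (-1)) => //; rewrite ?inE ?eqxx ?orbT //; case: (b).
Qed.

Lemma mult_upper_gt0 : G w1 -> mult w1 != 0%N.
Proof.
have [l0|l0] := eqVneq l 0.
  by rewrite {1 2}(_ : w1 = w); [exact: mult_lower_gt0|rewrite l0 scale0r addr0].
move=> /card_gt1P[a [a' [aM a'M aa']]].
have lpos : 0 < l by rewrite lt_neqAle eq_sym l0.
have ok : directions_ok [:: (sg b, 0); (0, 1); opp (edge_dir b)].
  by rewrite /directions_ok !big_cons !big_nil; case: (b).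
rewrite -eqz_nat (stable_mult_star smooth ok (star_upper b w lpos)) gt_eqF //.
by apply: (@sum_top_gt0 _ a a' _ (sg b) 1) => //; rewrite ?inE ?eqxx ?orbT //; case: (b).
Qed.

(** At multiplicity 0 all maximizers have the same slope along [y], so they stay tied nearby. Going
    backwards, the tie persists up to a break or to the start [q]. *)
Lemma walk_back q y t : 0 < t -> (1 < #|M (q + t *: vec y)|)%N ->
  top (M (q + t *: vec y)) (pairing y) = bot (M (q + t *: vec y)) (pairing y) ->
  exists s, [/\ 0 <= s, s < t,
    0 < s -> bot (M (q + s *: vec y)) (pairing y) < top (M (q + s *: vec y)) (pairing y) &
    forall r, s <= r -> r <= t -> (1 < #|M (q + r *: vec y)|)%N].
Proof.
move=> t0 Mt flat; set p := q + t *: vec y in Mt flat.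
have pE r : p + r *: vec (opp y) = q + (t - r) *: vec y.
  by apply: rv2P; rewrite !mxE /= rmorphN /=; ring.
have [u [u0 ut botE brk [const sub]]] := next_break (monomial_value c p) (pairing (opp y))
  (finset.in_setT (ord0 : 'I_4, ord0 : 'I_4)) t0.
have amE r : argmaxes [set: 'I_4 * 'I_4] (monomial_value c p) (pairing (opp y)) r =
    M (q + (t - r) *: vec y) by rewrite -maximizers_line pE.
have am0 : argmaxes [set: 'I_4 * 'I_4] (monomial_value c p) (pairing (opp y)) 0 = M p.
  by rewrite amE subr0.
have [a0 a0M] := maximizers_neq0 c p.
have slope a : a \in M p -> pairing y a = bot (M p) (pairing y).
  move=> aM; apply: le_anti; rewrite bot_le // andbT -flat.
  exact: top_ge.
have full : [set a in M p | pairing (opp y) a == top (M p) (pairing (opp y))]%SET = M p.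
  apply/setP => a; rewrite inE; case: (boolP (a \in M p)) => //= aM.
  by rewrite /opp top_opp pairingN (slope a aM) eqxx.
rewrite am0 full in const sub; exists (t - u); split.
- by rewrite subr_ge0.
- by rewrite ltrBlDr ltrDl.
- rewrite subr_gt0 => /brk; rewrite /break amE /opp top_opp.
  have -> : bot (M (q + (t - u) *: vec y)) (pairing (- y.1, - y.2)) =
      - top (M (q + (t - u) *: vec y)) (pairing y).
    by rewrite /bot; congr (- _); apply: eq_top => a; rewrite pairingN opprK.
  by rewrite ltrN2.
- move=> r rt; rewrite le_eqVlt => /orP[/eqP ->//|rlt].
  have rE : q + r *: vec y = q + (t - (t - r)) *: vec y by rewrite subKr.
  rewrite rE -amE; move: rt; rewrite le_eqVlt => /orP[/eqP <-|rt].
    by rewrite subKr; apply: leq_trans Mt (subset_leq_card sub).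
  by rewrite const // ?subr_gt0 // ltrBlDr -ltrBlDl.
Qed.

(** Walking back from any point inside the component ends at a break or at a vertex on the tropical
    curve, and both have positive multiplicity. *)
Lemma component_mult C : components Z C -> exists2 p, C p & mult p != 0%N.
Proof.
move=> ZC; have [x Zx CE] := ZC.
have Cx : C x by rewrite -CE; exact: connected_component_refl.
have [Lx Gx] := Zx.
have along q y s t : 0 <= s -> s < t -> (forall r, s <= r -> r <= t -> L (q + r *: vec y)) ->
    C (q + t *: vec y) -> (forall r, s <= r -> r <= t -> (1 < #|M (q + r *: vec y)|)%N) ->
    C (q + s *: vec y).
  move=> s0 st Lr Ct Mr; apply: (connected_component_segment ZC Ct) => u u0 u1.
  have -> : q + t *: vec y + u *: (q + s *: vec y - (q + t *: vec y)) =
      q + (t - u * (t - s)) *: vec y by apply: rv2P; rewrite !mxE; ring.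
  by split; [apply: Lr|rewrite /corner_locus /=; apply: Mr]; nra.
have [xE|xE|[lg [t [lgs t0 xE]]]|[t [t0 tl xE]]] := curve_points l_ge0 Lx.
- by exists x => //; rewrite xE; apply: mult_lower_gt0; rewrite -xE.
- by exists x => //; rewrite xE; apply: mult_upper_gt0; rewrite -xE.
- have [m0|m0] := pselect (mult x = 0%N); last by exists x => //; exact/eqP.
  have flat : top (M x) (pairing lg.2) = bot (M x) (pairing lg.2).
    by apply/eqP; rewrite -subr_eq0 xE -(mult_leg smooth l_ge0 lgs t0) -xE m0.
  rewrite xE in Gx Cx flat; have [s [s0 st brk Mr]] := walk_back t0 Gx flat.
  have Cs : C (lg.1 + s *: vec lg.2).
    apply: (along _ _ _ t) => // r sr _; apply: curve_leg => //; exact: le_trans s0 sr.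
  exists (lg.1 + s *: vec lg.2) => //.
  move: s0 Cs Mr brk; rewrite le_eqVlt => /orP[/eqP <-|s0] Cs Mr brk; last first.
    by rewrite -eqz_nat (mult_leg smooth l_ge0 lgs s0) subr_eq0 gt_eqF // brk.
  have := Mr 0 (lexx 0) (ltW t0); rewrite scale0r addr0.
  move: lgs; rewrite !inE => /or4P[] /eqP -> /=.
  + exact: mult_lower_gt0.
  + exact: mult_lower_gt0.
  + exact: mult_upper_gt0.
  + exact: mult_upper_gt0.
- have [m0|m0] := pselect (mult x = 0%N); last by exists x => //; exact/eqP.
  have flat : top (M x) (pairing d) = bot (M x) (pairing d).
    by apply/eqP; rewrite -subr_eq0 xE -(mult_edge smooth b w t0 tl) -xE m0.
  rewrite xE in Gx Cx flat; have [s [s0 st brk Mr]] := walk_back t0 Gx flat.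
  have Cs : C (w + s *: vec d).
    apply: (along _ _ _ t) => // r sr rt; apply: curve_edge => //; first exact: le_trans s0 sr.
    exact: le_trans rt (ltW tl).
  exists (w + s *: vec d) => //.
  move: s0 Cs Mr brk; rewrite le_eqVlt => /orP[/eqP <-|s0] Cs Mr brk; last first.
    by rewrite -eqz_nat (mult_edge smooth b w s0 (lt_trans st tl)) subr_eq0 gt_eqF // brk.
  by have := Mr 0 (lexx 0) (ltW t0); rewrite scale0r addr0; exact: mult_lower_gt0.
Qed.

End Tritangency.

(** * Parity of components and of cuts *)

Section Equivalence.
Variables (R : realType) (c : 'I_4 -> 'I_4 -> R).
Hypothesis smooth : unimodular_newton_subdivision c.
Variables (b : bool) (w : 'rV[R]_2) (l : R).
Hypothesis l_ge0 : 0 <= l.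
Implicit Types (p q x : 'rV[R]_2) (y : int * int) (t : R) (lg : 'rV[R]_2 * (int * int))
  (C : set 'rV[R]_2).

Notation L := (curve b w l).
Notation G := (corner_locus c).
Notation Z := (L `&` G).
Notation mult := (stable_mult G L).

Lemma ip_continuous y q : continuous (fun p => ip y (p - q)).
Proof.
rewrite (_ : (fun p => _) = fun p => y.1%:~R * p 0 0 + y.2%:~R * p 0 1 - ip y q); last first.
  by apply/funext => p; rewrite /ip !mxE; ring.
move=> p.
have c0 : (fun x : 'rV[R]_2 => x 0 0) @ p --> p 0 0 by exact: coord_continuous.
have c1 : (fun x : 'rV[R]_2 => x 0 1) @ p --> p 0 1 by exact: coord_continuous.
have d0 := @cvgMl_tmp _ _ _ _ (fun x : 'rV[R]_2 => x 0 0) (y.1%:~R) (p 0 0) c0.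
have d1 := @cvgMl_tmp _ _ _ _ (fun x : 'rV[R]_2 => x 0 1) (y.2%:~R) (p 0 1) c1.
have Fp : Filter (nbhs p) by exact: nbhs_filter.
have d2 := cvgD (d0 Fp) (d1 Fp); have cq : (fun=> ip y q) @ p --> ip y q by exact: cvg_cst.
have d3 := @cvgB _ _ _ _ _ _ _ _ _ (d2 Fp) cq.
exact: (d3 Fp).
Qed.

Lemma component_eq C p : components Z C -> C p -> C = connected_component Z p.
Proof. by move=> [x _ <-]; exact: same_connected_component. Qed.

Lemma total_multE C (N : seq 'rV[R]_2) : components Z C -> uniq N ->
  (forall p, L p -> mult p != 0%N -> p \in N) ->
  total_stable_mult G L C = (\sum_(p <- N | p \in C) mult p)%N.
Proof.
move=> ZC uN LN; rewrite /total_stable_mult.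
have CZ := sub_components ZC.
rewrite (fsbigE [seq p <- N | p \in C]) ?filter_uniq //.
- by rewrite big_filter_cond; apply: eq_bigl => p; rewrite andbb.
- by move=> p /=; rewrite mem_filter => /andP[/set_mem].
- move=> p Cp; rewrite mem_filter mem_set //= => pN.
  apply/eqP; apply: contraNT pN; apply: LN.
  by have [] := CZ p Cp.
Qed.

Lemma sum_components (s : seq (set 'rV[R]_2)) (N : seq 'rV[R]_2) (P : pred 'rV[R]_2) :
  uniq s -> [set` s] = components Z -> (forall p, p \in N -> L p) ->
  (\sum_(p <- N | P p) mult p = \sum_(C <- s) \sum_(p <- N | P p && (p \in C)) mult p)%N.
Proof.
move=> us sE NL.
rewrite (exchange_big_dep P) /=; last by move=> C p _ /andP[].
rewrite big_seq_cond [RHS]big_seq_cond; apply: eq_bigr => p /andP[pN Pp].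
have [m0|m0] := pselect (mult p = 0%N); first by rewrite m0 big1.
have Zp : Z p.
  by split; [exact: NL|apply: (mult_support smooth l_ge0 (NL p pN)); exact/eqP].
have Cs : connected_component Z p \in s.
  by suff : [set` s] (connected_component Z p) by []; rewrite sE; exists p.
rewrite -big_filter (_ : [seq C <- s | _] = [:: connected_component Z p]) ?big_seq1 //.
apply: perm_small_eq => //.
apply: uniq_perm; rewrite ?filter_uniq // => C.
rewrite mem_filter !inE Pp /=; apply/andP/eqP => [[/set_mem Cp Cin]|->].
  by apply: component_eq => //; rewrite -sE.
by split=> //; apply/mem_set/connected_component_refl.
Qed.

(** Positive even numbers are at least 2, so at most three of them add up to 6. The order 4, 2,
    absent from [tritangent], is later repaired by reversing the list of components. *)
Lemma multiplicities_cases (v : seq nat) : all (fun k => (0 < k)%N && ~~ odd k) v ->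
  sumn v = 6%N -> v \in [:: [:: 2; 2; 2]; [:: 2; 4]; [:: 6]; [:: 4; 2]]%N.
Proof.
have two k : (0 < k)%N && ~~ odd k -> (1 < k)%N by case: k => [|[]].
case: v => [//|a [|a2 [|a3 [|a4 v]]]] /=.
- by move=> _; rewrite addn0 => ->.
- rewrite andbT => /andP[ha ha2]; rewrite addn0 => E.
  have := two _ ha; have := two _ ha2; move: ha ha2.
  have : (a <= 6)%N by rewrite -E leq_addr.
  have -> : a2 = (6 - a)%N by rewrite -E addKn.
  by clear E; do 7 (case: a => [//|a]).
- rewrite andbT => /and3P[/two ha /two ha2 /two ha3]; rewrite addn0 => E.
  have [-> -> ->] : [/\ a = 2, a2 = 2 & a3 = 2]%N by split; lia.
  by [].
- by move=> /and5P[/two ha /two ha2 /two ha3 /two ha4 _] E; exfalso; lia.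
Qed.

(** No component meets the cutting line, so each lies on one side of it, and the total on a side is
    a sum of even component totals. *)
Lemma cut_even (s : seq (set 'rV[R]_2)) (N : seq 'rV[R]_2) y q :
  uniq N -> (forall p, p \in N -> L p) -> (forall p, L p -> mult p != 0%N -> p \in N) ->
  uniq s -> [set` s] = components Z ->
  (forall C, C \in s -> ~~ odd (total_stable_mult G L C)) ->
  (forall p, Z p -> ip y (p - q) != 0) ->
  (2 %| (\sum_(p <- N | 0 < ip y (p - q)) (mult p)%:Z)%R)%Z.
Proof.
move=> uN NL LN us sE ev nz.
pose P p := 0 < ip y (p - q).
have -> : \sum_(p <- N | 0 < ip y (p - q)) (mult p)%:Z = ((\sum_(p <- N | P p) mult p)%N)%:Z.
  by rewrite (big_morph Posz PoszD erefl).
rewrite (sum_components _ us sE NL) dvdzE /= dvdn2 big_seq.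
apply: (big_ind (fun k => ~~ odd k)) => // [k m ek em|C Cs].
  by rewrite oddD (negbTE ek) (negbTE em).
have ZC : components Z C by rewrite -sE.
have [[p [Cp hp]]|no] := pselect (exists p, C p /\ 0 < ip y (p - q)).
  have := ev C Cs; rewrite (total_multE ZC uN LN); congr (~~ odd _).
  apply: eq_bigl => r; case: (boolP (r \in C)) => [/set_mem Cr|]; rewrite ?andbF ?andbT //.
  have nzC z : C z -> ip y (z - q) != 0 by move=> Cz; apply/nz/(sub_components ZC).
  apply/esym.
  exact: (connected_sign (connected_components ZC) (ip_continuous (y := y) (q := q)) nzC Cp Cr hp).
rewrite big_pred0 // => r; apply/negP => /andP[hr /set_mem Cr].
by apply: no; exists r.
Qed.

Lemma tritangent_even_cuts : tritangent G L <-> even_cuts c b w l.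
Proof.
have [N [uN [NL LN] N6 Nev [cutl cute]]] := support_seq smooth b w l_ge0.
split.
  move=> [s [us sE smem]].
  have ev C : C \in s -> ~~ odd (total_stable_mult G L C).
    move=> Cs; have : total_stable_mult G L C \in [seq total_stable_mult G L C | C <- s].
      exact: map_f.
    by move: smem; rewrite !inE => /or3P[] /eqP ->; rewrite !inE;
      do ?[move=> /orP[]]; move=> /eqP ->.
  split=> [lg t a lgs t0 Ma|t a t0 tl Ma].
    rewrite -(cutl _ _ _ lgs t0 Ma); apply: (cut_even uN NL LN us sE ev) => p [Lp Gp].
    have [cut_edge cut_legs] := leg_cut l_ge0 lgs t0.
    have [pE|pE|[lg' [u [lgs' u0 pE]]]|[u [u0 ul pE]]] := curve_points l_ge0 Lp.
    - by have := cut_edge 0 (lexx 0) l_ge0; rewrite scale0r addr0 -pE => /ltr0_neq0.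
    - by have := cut_edge l l_ge0 (lexx l); rewrite -pE => /ltr0_neq0.
    - have [neq eq] := cut_legs lg' u lgs' u0.
      have [lgE|lgn] := pselect (lg' = lg); last by rewrite pE; apply/ltr0_neq0/neq/eqP.
      rewrite pE lgE eq subr_eq0; apply/eqP => ut; move: Gp.
      by rewrite pE lgE ut /corner_locus /= Ma cards1.
    - by have := cut_edge u (ltW u0) (ltW ul); rewrite -pE => /ltr0_neq0.
  rewrite -(cute _ _ t0 tl Ma); apply: (cut_even uN NL LN us sE ev) => p [Lp Gp].
  have [cut_edge cut_legs] := edge_cut b w l_ge0 t0 tl.
  have [pE|pE|[lg' [u [lgs' u0 pE]]]|[u [u0 ul pE]]] := curve_points l_ge0 Lp.
  - have := cut_edge 0; rewrite scale0r addr0 -pE => ->.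
    by rewrite mulf_neq0 // sub0r oppr_eq0 gt_eqF.
  - by have := cut_edge l; rewrite -pE => ->; rewrite mulf_neq0 // subr_eq0 gt_eqF.
  - have /(nthP (w, (0, 0))) [i i4 lgE] := lgs'.
    have := cut_legs i u i4 u0; rewrite /= lgE -pE.
    by case: ifP => _ h; [apply: ltr0_neq0|apply: lt0r_neq0].
  - rewrite pE cut_edge mulf_neq0 // subr_eq0; apply/eqP => ut; move: Gp.
    by rewrite pE ut /corner_locus /= Ma cards1.
move=> ev.
pose s := undup [seq connected_component Z p | p <- N & p \in Z].
have us : uniq s by exact: undup_uniq.
have sE : [set` s] = components Z.
  apply/seteqP; split=> C.
    rewrite /= mem_undup => /mapP[p]; rewrite mem_filter => /andP[/set_mem Zp _] ->.
    by exists p.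
  move=> ZC; have [p Cp mp] := component_mult smooth l_ge0 ZC.
  rewrite /= mem_undup; apply/mapP; exists p; last exact: component_eq.
  rewrite mem_filter mem_set /=; last exact: (sub_components ZC).
  by apply: LN => //; have [] := sub_components ZC Cp.
have good C : C \in s -> (0 < total_stable_mult G L C)%N && ~~ odd (total_stable_mult G L C).
  move=> Cs; have ZC : components Z C by rewrite -sE.
  rewrite (total_multE ZC uN LN); apply/andP; split.
    have [p Cp mp] := component_mult smooth l_ge0 ZC.
    rewrite (big_rem p) /=; last by apply: LN => //; have [] := sub_components ZC Cp.
    by rewrite mem_set // addn_gt0 lt0n mp.
  (* Membership in a component is a saturated predicate. *)
  have := Nev (fun p => p \in C) _ ev; rewrite -(big_morph Posz PoszD erefl) dvdzE /= dvdn2.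
  apply=> x y xy.
  have seg p p' : C p -> (forall t, 0 <= t -> t <= 1 -> Z (p + t *: (p' - p))) -> C p'.
    exact: connected_component_segment ZC.
  apply/idP/idP => /set_mem Cp; apply/mem_set; first exact: seg Cp xy.
  apply: seg Cp _ => t t0 t1.
  have -> : y + t *: (x - y) = x + (1 - t) *: (y - x).
    by apply: rv2P; rewrite !mxE; ring.
  by apply: xy; lra.
have tot : sumn [seq total_stable_mult G L C | C <- s] = 6%N.
  rewrite sumnE big_map big_seq.
  rewrite (eq_bigr (fun C => \sum_(p <- N | p \in C) mult p)%N); last first.
    by move=> C Cs; rewrite (total_multE _ uN LN) // -sE.
  rewrite -big_seq -(sum_components predT us sE NL).
  have : (\sum_(p <- N) mult p)%N%:Z = 6 by rewrite (big_morph Posz PoszD erefl).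
  by case.
have := @multiplicities_cases [seq total_stable_mult G L C | C <- s] _ tot.
rewrite all_map => /(_ (introT allP good)).
rewrite !inE => /or4P[] /eqP E.
- by exists s; rewrite E !inE.
- by exists s; rewrite E !inE eqxx orbT.
- by exists s; rewrite E !inE eqxx !orbT.
- exists (rev s); split; first by rewrite rev_uniq.
    by rewrite -sE; apply/seteqP; split=> C /=; rewrite mem_rev.
  by rewrite map_rev E.
Qed.

End Equivalence.

(** * Tritangent classes are polyhedral *)

Section IntegralAffine.
Variable R : realType.
Implicit Types (z : 'rV[R]_(2 + 1)).

Definition v0 z : 'rV[R]_2 := lsubmx z.
Definition len z : R := rsubmx z 0 0.

Definition afn (k0 k1 k2 : int) (r : R) : affine R (2 + 1) :=
  (col_mx (\col_i (if i == 0 then k0%:~R else k1%:~R) : 'cV[rat]_2) k2%:~R%:M, - r).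

Lemma eval_afn k0 k1 k2 r z : eval_affine (afn k0 k1 k2 r) z =
  k0%:~R * v0 z 0 0 + k1%:~R * v0 z 0 1 + k2%:~R * len z + r.
Proof.
rewrite /eval_affine /= opprK map_col_mx -[z in LHS]hsubmxK mul_row_col mxE.
rewrite map_scalar_mx /= mul_mx_scalar !mxE big_ord_recl big_ord1 !mxE /= !rmorph_int.
rewrite /v0 /len !mxE (_ : lift ord0 ord0 = 1) //=; last exact: val_inj.
by ring.
Qed.

End IntegralAffine.

Section TritangentSet.
Variables (R : realType) (c : 'I_4 -> 'I_4 -> R).
Implicit Types (z : 'rV[R]_(2 + 1)) (a : 'I_4 * 'I_4) (t : R) (y : int * int) (k : bool).

(** [k] selects the upper vertex. The product of [sg b] and [len z] is the edge length when [b]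
    matches the sign of [len z]. *)
Definition piece_start b k z : 'rV[R]_2 := v0 z + (k%:R * ((sg b)%:~R * len z)) *: vec (edge_dir b).

(* Unknown [t]: the point at distance [t] on a leg ([e = false]) or on the bounded edge ([e = true])
   has [a] as its unique maximizer. *)
Definition cut_system b (e k : bool) y a : seq (affine R (2 + 1) * int) :=
  (if e then [:: (afn 0 0 (sg b) 0, -1)] else [::]) ++ (afn 0 0 0 0, 1) ::
  [seq (afn (a.1%:Z - a'.1%:Z) (a.2%:Z - a'.2%:Z)
          (k%:Z * (a.1%:Z - a'.1%:Z + sg b * (a.2%:Z - a'.2%:Z))) (c a.1 a.2 - c a'.1 a'.2),
        pairing y a - pairing y a') | a' <- enum [set~ a]%SET].

Lemma maximizers_eq1 p a : maximizers c p = [set a]%SET <->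
  forall a', a' != a -> monomial_value c p a' < monomial_value c p a.
Proof.
split=> [Ma a' a'a|lt].
  have : a \in maximizers c p by rewrite Ma set11.
  rewrite inE => /forallP /(_ a'); rewrite le_eqVlt => /orP[/eqP E|//].
  have : a' \in maximizers c p.
    rewrite inE; apply/forallP => b; rewrite E.
    have : a \in maximizers c p by rewrite Ma set11.
    by rewrite inE => /forallP.
  by rewrite Ma inE (negbTE a'a).
apply/setP => a'; rewrite !inE; apply/forallP/eqP => [/(_ a)|-> b].
  by apply: contraPeq => /lt; rewrite ltNge => /negP.
by have [->//|/lt/ltW] := eqVneq b a.
Qed.

Lemma cut_systemP b e k y a z t :
  (forall h, h \in cut_system b e k y a -> 0 < eval_affine h.1 z + t * h.2%:~R) <->
  [/\ 0 < t, e -> t < (sg b)%:~R * len z &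
      maximizers c (piece_start b k z + t *: vec y) = [set a]%SET].
Proof.
have diffE a' : eval_affine (afn (a.1%:Z - a'.1%:Z) (a.2%:Z - a'.2%:Z)
          (k%:Z * (a.1%:Z - a'.1%:Z + sg b * (a.2%:Z - a'.2%:Z))) (c a.1 a.2 - c a'.1 a'.2)) z
      + t * (pairing y a - pairing y a')%:~R =
    monomial_value c (piece_start b k z + t *: vec y) a -
    monomial_value c (piece_start b k z + t *: vec y) a'.
  rewrite eval_afn /monomial_value !addvE0 !addvE1 /pairing /piece_start /edge_dir /=.
  by case: (k); case: (b); rewrite /sg !(rmorphD, rmorphB, rmorphM, rmorphN, rmorph1, rmorph0) /=; ring.
split=> [pos|[t0 tl Ma] h].
  split.
  - have := pos (afn 0 0 0 0, 1); rewrite mem_cat in_cons eqxx orbT => /(_ isT).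
    by rewrite eval_afn /= !mul0r !add0r mulr1.
  - move=> eT; have := pos (afn 0 0 (sg b) 0, -1); rewrite mem_cat eT inE eqxx => /(_ isT).
    by rewrite eval_afn /= !mul0r !add0r addr0 mulrN1 subr_gt0.
  - apply/maximizers_eq1 => a' a'a; rewrite -subr_gt0 -diffE; apply: (pos (_, _)).
    rewrite mem_cat in_cons; apply/orP; right; apply/orP; right.
    by apply: map_f; rewrite mem_enum !inE.
rewrite mem_cat in_cons => /or3P[|/eqP ->|/mapP[a' + ->]].
- case: (e) tl => // /(_ isT) tl; rewrite inE => /eqP ->.
  by rewrite eval_afn /= !mul0r !add0r addr0 mulrN1 subr_gt0.
- by rewrite eval_afn /= !mul0r !add0r mulr1.
- rewrite mem_enum !inE => a'a; rewrite /= diffE subr_gt0.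
  by move/maximizers_eq1: Ma; apply.
Qed.

(** Each entry records whether the piece is the bounded edge, whether it starts at the upper vertex,
    and its direction. *)
Definition pieces b : seq (bool * bool * (int * int)) :=
  [:: (false, false, (- sg b, 0)); (false, false, (0, -1)); (false, true, (sg b, 0));
      (false, true, (0, 1)); (true, false, edge_dir b)].

Definition cut_walls b : seq (affine R (2 + 1)) :=
  flatten [seq eliminants (cut_system b p.1.1 p.1.2 p.2 a) |
             p <- pieces b, a <- enum [set: 'I_4 * 'I_4]%SET].

(** Meeting an open region is an open condition on the curve, so [x] inherits it from any [z] in its
    closed cell; forbidding it is therefore cell-closed. *)
Lemma cut_transfer b p a x z : p \in pieces b -> weaker_signs (cut_walls b) x z ->
  (exists t, [/\ 0 < t, p.1.1 -> t < (sg b)%:~R * len z &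
     maximizers c (piece_start b p.1.2 z + t *: vec p.2) = [set a]%SET]) ->
  exists t, [/\ 0 < t, p.1.1 -> t < (sg b)%:~R * len x &
     maximizers c (piece_start b p.1.2 x + t *: vec p.2) = [set a]%SET].
Proof.
move=> pb xz [t /cut_systemP tP].
suff [t' /cut_systemP ?] : exists t', forall h, h \in cut_system b p.1.1 p.1.2 p.2 a ->
    0 < eval_affine h.1 x + t' * h.2%:~R by exists t'.
apply: (@eliminated _ _ _ x z); last by exists t.
move=> h hin; apply: xz; apply/flattenP.
exists (eliminants (cut_system b p.1.1 p.1.2 p.2 a)) => //.
have ain : a \in enum [set: 'I_4 * 'I_4]%SET by rewrite mem_enum inE.
apply/allpairsP; exists (p, a). by [].
Qed.

Lemma legs_pieces b z lg : lg \in legs b (v0 z) ((sg b)%:~R * len z) <->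
  exists2 p, p \in pieces b /\ ~~ p.1.1 & lg = (piece_start b p.1.2 z, p.2).
Proof.
have E0 : piece_start b false z = v0 z by rewrite /piece_start mul0r scale0r addr0.
have E1 : piece_start b true z = v0 z + ((sg b)%:~R * len z) *: vec (edge_dir b).
  by rewrite /piece_start mul1r.
split=> [|[p [pb p1] ->]].
  rewrite !inE => /or4P[] /eqP ->; [pose p := (false, false, (- sg b, 0 : int)) |
    pose p := (false, false, (0 : int, - 1 : int)) |
    pose p := (false, true, (sg b, 0 : int)) | pose p := (false, true, (0 : int, 1 : int))];
  by exists p; rewrite /p /= ?E0 ?E1 // !inE eqxx ?orbT.
move: pb p1; rewrite [in p \in _]inE /pieces !in_cons in_nil orbF.
by move=> /or4P[||| /orP[]] /eqP -> // _; rewrite /= ?E0 ?E1 !inE eqxx ?orbT.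
Qed.

Lemma even_cuts_cell_closed b : cell_closed (cut_walls b)
  [set z | even_cuts c b (v0 z) ((sg b)%:~R * len z)].
Proof.
move=> x z xz [evl eve]; split=> [lg t a /legs_pieces[p [pb p1] ->] /= t0 Ma|t a t0 tl Ma].
  have [|t' [t'0 _ Ma']] := @cut_transfer b p a x z pb xz.
    by exists t; rewrite (negbTE p1).
  apply: (evl (piece_start b p.1.2 x, p.2) t' a _ t'0 Ma').
  by apply/legs_pieces; exists p.
have start u : piece_start b false u = v0 u by rewrite /piece_start mul0r scale0r addr0.
have [||t' [t'0 t'l Ma']] := @cut_transfer b (true, false, edge_dir b) a x z _ xz.
- by rewrite !inE eqxx !orbT.
- by exists t; rewrite /= start; split.
- by apply: (eve t' a t'0 (t'l isT)); rewrite -Ma' /= start.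
Qed.

Definition tritangent_walls : seq (affine R (2 + 1)) :=
  afn 0 0 1 0 :: cut_walls true ++ cut_walls false.

(** At length 0 both shapes have the same four legs and no edge interior. This lets both closed
    halves include [len = 0], although [tropical_11_curve] assigns it to one shape. *)
Lemma even_cuts_len0 b w : even_cuts c b w 0 -> even_cuts c (~~ b) w 0.
Proof.
move=> [evl _]; split=> [lg t a lgs|t a t0]; last by move=> /(lt_trans t0); rewrite ltxx.
apply: evl; move: lgs; rewrite !inE !scale0r !addr0 /sg; case: (b) => /=;
  by rewrite ?opprK => /or4P[] /eqP ->; rewrite !eqxx ?orbT.
Qed.

Lemma tritangent_setE : unimodular_newton_subdivision c ->
  [set z | tritangent (corner_locus c) (tropical_11_curve z)] =
  ([set z | 0 <= len z] `&` [set z | even_cuts c true (v0 z) (len z)]) `|`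
  ([set z | len z <= 0] `&` [set z | even_cuts c false (v0 z) (- len z)]).
Proof.
move=> smooth; apply/seteqP; split=> z /=; rewrite tropical_11_curveE -/(v0 z) -/(len z).
  case: ifP => [l0 /(tritangent_even_cuts smooth _ _ (ltW l0)) ev|/negbT].
    by left; split=> //; exact: ltW.
  rewrite -leNgt => l0 /(tritangent_even_cuts smooth) ev; right; split=> //.
  by apply: ev; rewrite oppr_ge0.
move=> [[l0 ev]|[l0 ev]].
  case: ifP => [l0'|/negbT]; first by apply/tritangent_even_cuts.
  rewrite -leNgt => l0'; have lE : len z = 0 by apply/eqP; rewrite eq_le l0 l0'.
  apply/tritangent_even_cuts; rewrite ?lE ?oppr0 //.
  by apply: (@even_cuts_len0 true); rewrite -lE.
by rewrite ltNge l0 /=; apply/tritangent_even_cuts; rewrite ?oppr_ge0.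
Qed.

Lemma tritangent_set_cell_closed : unimodular_newton_subdivision c ->
  cell_closed tritangent_walls [set z | tritangent (corner_locus c) (tropical_11_curve z)].
Proof.
move=> smooth; rewrite tritangent_setE //.
have lenE z : eval_affine (afn 0 0 1 0) z = len z :> R.
  by rewrite eval_afn !mul0r !add0r mul1r addr0.
have in0 : afn 0 0 1 0 \in tritangent_walls by rewrite mem_head.
have eqT : [set z | even_cuts c true (v0 z) (len z)] =
    [set z | even_cuts c true (v0 z) ((sg true)%:~R * len z)].
  by apply/seteqP; split=> z /=; rewrite mul1r.
have eqF : [set z | even_cuts c false (v0 z) (- len z)] =
    [set z | even_cuts c false (v0 z) ((sg false)%:~R * len z)].
  by apply/seteqP; split=> z /=; rewrite mulN1r.
apply: cell_closedU; apply: cell_closedI.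
- by move=> x z /(_ _ in0)[_]; rewrite /= !lenE.
- rewrite eqT; apply: (@cell_closed_sub _ _ (cut_walls true)); last exact: even_cuts_cell_closed.
  move=> h hh.
  by rewrite inE mem_cat hh orbT.
- by move=> x z /(_ _ in0)[+ _]; rewrite /= !lenE.
- rewrite eqF; apply: (@cell_closed_sub _ _ (cut_walls false)); last exact: even_cuts_cell_closed.
  move=> h hh.
  by rewrite inE mem_cat hh !orbT.
Qed.

End TritangentSet.

Lemma tritangent_class_polyhedral (R : realType) (G : set 'rV[R]_2) W :
  smooth_tropical_33_curve G -> tritangent_class G W ->
  connected W /\ rational_polyhedral_complex W.
Proof.
move=> [c [smooth ->]] GW; split; first exact: connected_components GW.
apply: cell_closed_rational_complex.
exact: component_cell_closed (tritangent_set_cell_closed smooth) GW.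
Qed.

(** * A tritangent class without coarsest structure *)

Section Example.
Variable R : realType.

Definition height (i j : nat) : int := nth 0 (nth [::]
  [:: [:: 0; 4; 7; 2]; [:: 3; 9; 11; 10]; [:: 1; 9; 14; 15]; [:: -6; 6; 13; 15]] i) j.

Definition example (i j : 'I_4) : R := (height i j)%:~R.

(* Two monomials can be maximal at the same point only if no other pair with
   the same midpoint has greater total height. *)
Definition compatible (a b : nat * nat) : bool :=
  all (fun i => all (fun j =>
    (a.1 + b.1 <= i + 3)%N && (i <= a.1 + b.1)%N && (a.2 + b.2 <= j + 3)%N && (j <= a.2 + b.2)%N ==>
    (height i j + height (a.1 + b.1 - i) (a.2 + b.2 - j) <= height a.1 a.2 + height b.1 b.2))
  (iota 0 4)) (iota 0 4).

Definition points : seq (nat * nat) := [seq (i, j) | i <- iota 0 4, j <- iota 0 4].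

Definition area (a b d : nat * nat) : int :=
  (b.1%:Z - a.1%:Z) * (d.2%:Z - a.2%:Z) - (b.2%:Z - a.2%:Z) * (d.1%:Z - a.1%:Z).

(* [if] rather than [==>], which call-by-value would evaluate in full. *)
Lemma compatible_triples : all (fun a => all (fun b => if compatible a b then
  all (fun d => if (area a b d != 0) then if compatible a d then if compatible b d then
    (absz (area a b d) == 1%N) &&
    all (fun e => if compatible a e then if compatible b e then
        if compatible d e then e \in [:: a; b; d] else true else true else true) points
    else true else true else true) points else true) points) points.
Proof. by vm_compute. Qed.

Definition node (a : 'I_4 * 'I_4) : nat * nat := (a.1 : nat, a.2 : nat).

Lemma node_points a : node a \in points.
Proof. by apply: allpairs_f; rewrite mem_iota ltn_ord. Qed.

Lemma node_inj : injective node.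
Proof. by move=> [i j] [i' j'] [/val_inj -> /val_inj ->]. Qed.

Lemma maximizers_compatible p a b : a \in maximizers example p -> b \in maximizers example p ->
  compatible (node a) (node b).
Proof.
rewrite !inE => /forallP Ma /forallP Mb.
suff main (i j : nat) : (i < 4)%N -> (j < 4)%N ->
    (a.1 + b.1 <= i + 3)%N -> (i <= a.1 + b.1)%N -> (a.2 + b.2 <= j + 3)%N -> (j <= a.2 + b.2)%N ->
    height i j + height (a.1 + b.1 - i) (a.2 + b.2 - j) <= height a.1 a.2 + height b.1 b.2.
  apply/allP => i; rewrite mem_iota => /andP[_ i4]; apply/allP => j; rewrite mem_iota => /andP[_ j4].
  by apply/implyP => /andP[/andP[/andP[h1 h2] h3] h4]; apply: main.
move=> i4 j4 h1 h2 h3 h4.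
have i'4 : (a.1 + b.1 - i < 4)%N by lia.
have j'4 : (a.2 + b.2 - j < 4)%N by lia.
have := Ma (Ordinal i4, Ordinal j4); have := Mb (Ordinal i'4, Ordinal j'4).
rewrite /monomial_value /example /= !natrB // !natrD.
rewrite -(ler_int R) !rmorphD /=. lra.
Qed.

(** Maximizers at a point are pairwise compatible, and the finite check shows that a compatible
    triple of nonzero area is unimodular and has no compatible extension. *)
Lemma example_smooth : unimodular_newton_subdivision example.
Proof.
move=> p [a [b [d [Ma Mb Md abd]]]].
have comp := @maximizers_compatible p.
have := allP compatible_triples _ (node_points a).
move=> /allP /(_ _ (node_points b)); rewrite (comp a b Ma Mb) => /allP /(_ _ (node_points d)).
have -> : area (node a) (node b) (node d) = area2 a b d by [].
rewrite abd (comp a d Ma Md) (comp b d Mb Md) => /andP[/eqP ar /allP sub].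
exists a, b, d; split=> //; apply/setP => e; rewrite !inE -orbA.
apply/idP/idP => [|/or3P[] /eqP ->]; [|by move: Ma; rewrite inE|by move: Mb; rewrite inE|
  by move: Md; rewrite inE].
move=> Me0; have Me : e \in maximizers example p by rewrite inE.
have := sub _ (node_points e); rewrite (comp a e Ma Me) (comp b e Mb Me) (comp d e Md Me) !inE.
by rewrite !(inj_eq node_inj).
Qed.

End Example.

(** * The regions met by the curves of the example class *)

Section ExampleClass.
Variable R : realType.
Implicit Types (X Y : R) (i j : nat).

Definition value i j X Y : R := (height i j)%:~R + i%:R * X + j%:R * Y.

Definition dominant i j X Y : Prop := forall i' j', (i' < 4)%N -> (j' < 4)%N ->
  (i', j') != (i, j) -> value i' j' X Y < value i j X Y.

Lemma dominantP p (a : 'I_4 * 'I_4) :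
  maximizers (@example R) p = [set a]%SET <-> dominant a.1 a.2 (p 0 0) (p 0 1).
Proof.
split=> [/maximizers_eq1 lt i j i4 j4 ne|dom].
  by apply: (lt (Ordinal i4, Ordinal j4)); apply: contra ne => /eqP <-.
apply/maximizers_eq1 => a' a'a; by apply: dom; rewrite ?ltn_ord.
Qed.

Ltac compare dom i j :=
  try (let H := fresh in have H := dom i j isT isT isT; rewrite /value /height /= in H).
Ltac compare_all dom :=
  compare dom 0%N 0%N; compare dom 0%N 1%N; compare dom 0%N 2%N; compare dom 0%N 3%N;
  compare dom 1%N 0%N; compare dom 1%N 1%N; compare dom 1%N 2%N; compare dom 1%N 3%N;
  compare dom 2%N 0%N; compare dom 2%N 1%N; compare dom 2%N 2%N; compare dom 2%N 3%N;
  compare dom 3%N 0%N; compare dom 3%N 1%N; compare dom 3%N 2%N; compare dom 3%N 3%N.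

(** In this and the next lemmas, an exponent of the wrong parity is refuted by comparing it with all
    others, which contradicts the bounds linearly. *)
Lemma dominant_left X Y i j : (i < 4)%N -> (j < 4)%N -> X < 0 -> 0 <= Y -> Y <= 2 ->
  dominant i j X Y -> ~~ odd i.
Proof.
case: i => [|[|[|[|//]]]] _; case: j => [|[|[|[|//]]]] _ //= h0 h1 h2 dom; exfalso.
all: compare_all dom; lra.
Qed.

Lemma dominant_down X Y i j : (i < 4)%N -> (j < 4)%N -> X = 0 ->
  dominant i j X Y -> ~~ odd j.
Proof.
case: i => [|[|[|[|//]]]] _; case: j => [|[|[|[|//]]]] _ //= h0 dom; exfalso.
all: compare_all dom; lra.
Qed.

Lemma dominant_right X Y i j : (i < 4)%N -> (j < 4)%N -> 0 < X -> -1 <= Y -> Y - X <= 2 ->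
  dominant i j X Y -> odd i.
Proof.
case: i => [|[|[|[|//]]]] _; case: j => [|[|[|[|//]]]] _ //= h0 h1 h2 dom; exfalso.
all: compare_all dom; lra.
Qed.

(** The bound [-3] belongs to the longest edge of negative slope, from height -1 up to height 2. *)
Lemma dominant_up X Y i j : (i < 4)%N -> (j < 4)%N -> -3 <= X -> 0 <= Y -> X <= Y ->
  dominant i j X Y -> odd j.
Proof.
case: i => [|[|[|[|//]]]] _; case: j => [|[|[|[|//]]]] _ //= h0 h1 h2 dom; exfalso.
all: compare_all dom; lra.
Qed.

Lemma dominant_edge_up X Y i j : (i < 4)%N -> (j < 4)%N -> 0 <= X -> 0 <= Y - X -> Y - X <= 2 ->
  dominant i j X Y -> ~~ odd (i + j).
Proof.
case: i => [|[|[|[|//]]]] _; case: j => [|[|[|[|//]]]] _ //= h0 h1 h2 dom; exfalso.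
all: compare_all dom; lra.
Qed.

Lemma dominant_edge_down X Y i j : (i < 4)%N -> (j < 4)%N -> X <= 0 -> -1 <= Y + X -> Y <= 2 ->
  dominant i j X Y -> odd (i + j).
Proof.
case: i => [|[|[|[|//]]]] _; case: j => [|[|[|[|//]]]] _ //= h0 h1 h2 dom; exfalso.
all: compare_all dom; lra.
Qed.

End ExampleClass.

Section TritangentExample.
Variable R : realType.
Implicit Types (X Y t l : R) (z : 'rV[R]_(2 + 1)) (w : 'rV[R]_2) (a : 'I_4 * 'I_4).
Notation ex := (@example R).
Notation steepest y := (top [set: 'I_4 * 'I_4] (pairing y)).

Ltac monomials a := case: a => [[[|[|[|[|//]]]] ?] [[|[|[|[|//]]]] ?]].

Lemma parity_left a : (2 %| steepest (-1, 0) - pairing (-1, 0) a)%Z = ~~ odd a.1.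
Proof. by rewrite steepest_left; monomials a. Qed.

Lemma parity_right a : (2 %| steepest (1, 0) - pairing (1, 0) a)%Z = odd a.1.
Proof. by rewrite steepest_right; monomials a. Qed.

Lemma parity_down a : (2 %| steepest (0, -1) - pairing (0, -1) a)%Z = ~~ odd a.2.
Proof. by rewrite steepest_down; monomials a. Qed.

Lemma parity_up a : (2 %| steepest (0, 1) - pairing (0, 1) a)%Z = odd a.2.
Proof. by rewrite steepest_up; monomials a. Qed.

Lemma parity_edge_up a :
  (2 %| steepest (1, 0) + steepest (0, 1) - pairing (1, 1) a)%Z = ~~ odd (a.1 + a.2).
Proof. by rewrite steepest_right steepest_up; monomials a. Qed.

Lemma parity_edge_down a :
  (2 %| steepest (-1, 0) + steepest (0, 1) - pairing (-1, 1) a)%Z = odd (a.1 + a.2).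
Proof. by rewrite steepest_left steepest_up; monomials a. Qed.

Lemma example_even_cuts_up w l : w 0 0 = 0 -> 0 <= w 0 1 -> w 0 1 <= 2 -> 0 <= l ->
  even_cuts ex true w l.
Proof.
move=> w0 w1 w2 l0; split=> [lg t a lgs t0|t a t0 tl] /dominantP; last first.
  rewrite !addvE0 !addvE1 w0 /= => dom; rewrite parity_edge_up.
  by apply: dominant_edge_up (ltn_ord _) (ltn_ord _) _ _ _ dom; lra.
move: lgs; rewrite !inE => /or4P[] /eqP -> /=; rewrite !addvE0 !addvE1 ?w0 /= => dom.
- rewrite parity_left; apply: dominant_left (ltn_ord _) (ltn_ord _) _ _ _ dom; lra.
- rewrite parity_down; apply: dominant_down (ltn_ord _) (ltn_ord _) _ dom; lra.
- rewrite parity_right; apply: dominant_right (ltn_ord _) (ltn_ord _) _ _ _ dom;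
  rewrite ?addvE0 ?addvE1 ?w0 /=; lra.
- rewrite parity_up; apply: dominant_up (ltn_ord _) (ltn_ord _) _ _ _ dom;
  rewrite ?addvE0 ?addvE1 ?w0 /=; lra.
Qed.

Lemma example_even_cuts_down w l : w 0 0 = 0 -> -1 <= w 0 1 -> w 0 1 <= 2 -> 0 <= l ->
  0 <= w 0 1 + l -> w 0 1 + l <= 2 -> even_cuts ex false w l.
Proof.
move=> w0 w1 w2 l0 wl0 wl2; split=> [lg t a lgs t0|t a t0 tl] /dominantP; last first.
  rewrite !addvE0 !addvE1 w0 /= => dom; rewrite parity_edge_down.
  by apply: dominant_edge_down (ltn_ord _) (ltn_ord _) _ _ _ dom; lra.
move: lgs; rewrite !inE => /or4P[] /eqP -> /=; rewrite !addvE0 !addvE1 ?w0 /= => dom.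
- rewrite parity_right; apply: dominant_right (ltn_ord _) (ltn_ord _) _ _ _ dom;
  rewrite ?addvE0 ?addvE1 ?w0 /=; lra.
- rewrite parity_down; apply: dominant_down (ltn_ord _) (ltn_ord _) _ dom; lra.
- rewrite parity_left; apply: dominant_left (ltn_ord _) (ltn_ord _) _ _ _ dom;
  rewrite ?addvE0 ?addvE1 ?w0 /=; lra.
- rewrite parity_up; apply: dominant_up (ltn_ord _) (ltn_ord _) _ _ _ dom;
  rewrite ?addvE0 ?addvE1 ?w0 /=; lra.
Qed.

(** One description of both halves: the last disjunct is decided by the larger of [v0 z 0 1] and
    [v0 z 0 1 - len z], which is the height where the left leg starts. *)
Definition example_class : set 'rV[R]_(2 + 1) := [set z |
  [/\ v0 z 0 0 = 0, -1 <= v0 z 0 1, v0 z 0 1 <= 2, v0 z 0 1 - len z <= 2 &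
      0 <= v0 z 0 1 \/ 0 <= v0 z 0 1 - len z]].

(** Every condition of the class is relaxed by one; in this margin the monomials of the lemmas below
    still witness each violation. *)
Definition example_nbhd : set 'rV[R]_(2 + 1) := [set z |
  [/\ -1 < v0 z 0 0 /\ v0 z 0 0 < 1, -2 < v0 z 0 1, v0 z 0 1 < 3, v0 z 0 1 - len z < 3 &
      -1 < v0 z 0 1 \/ -1 < v0 z 0 1 - len z]].

Notation tritangents := [set z : 'rV[R]_(2 + 1) | tritangent (corner_locus ex) (tropical_11_curve z)].

Lemma example_class_tritangent : example_class `<=` tritangents.
Proof.
move=> z [z0 z1 z2 zl z3]; rewrite (tritangent_setE (@example_smooth R)).
have [l0|l0] := leP 0 (len z); [left|right]; split=> //=.
- by apply: example_even_cuts_up => //; case: z3; lra.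
- exact: ltW.
- by apply: example_even_cuts_down => //; case: z3; lra.
Qed.

Ltac dominance :=
  move=> [|[|[|[|//]]]] [|[|[|[|//]]]] _ _ //= _; rewrite /value /height /=; lra.

(** The height is the midpoint of the edge over -6 <= y <= -5 between the regions of (1,1) and
    (2,1). *)
Lemma dominant_11 X : -1 < X -> X < 0 -> dominant 1 1 X (- (11 / 2)).
Proof. by move=> ? ?; dominance. Qed.

Lemma dominant_21 X : 0 < X -> X < 1 -> dominant 2 1 X (- (11 / 2)).
Proof. by move=> ? ?; dominance. Qed.

(** On this line (0,2) and (2,3) tie. For heights outside 0 to 2 the regions of (1,2) and (1,3) come
    in between. *)
Lemma dominant_12 Y : -1 < Y -> Y < 0 -> dominant 1 2 (- 4 - Y / 2) Y.
Proof. by move=> ? ?; dominance. Qed.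

Lemma dominant_13 Y : 2 < Y -> Y < 3 -> dominant 1 3 (- 4 - Y / 2) Y.
Proof. by move=> ? ?; dominance. Qed.

(** Halfway between the line [X = 0] and the line [X + Y = -1], where (2,2) and (3,3) tie. *)
Lemma dominant_22 Y : -2 < Y -> Y < -1 -> dominant 2 2 ((- 1 - Y) / 2) Y.
Proof. by move=> ? ?; dominance. Qed.

Section Cuts.
Variables (b : bool) (w : 'rV[R]_2) (l : R).
Hypothesis ev : even_cuts ex b w l.

Lemma leg_parity lg t X Y i j (i4 : (i < 4)%N) (j4 : (j < 4)%N) : lg \in legs b w l -> 0 < t ->
  dominant i j X Y -> lg.1 + t *: vec lg.2 = pt X Y ->
  (2 %| steepest lg.2 - pairing lg.2 (Ordinal i4, Ordinal j4))%Z.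
Proof.
move=> lgs t0 dom pE; apply: ev.1 lgs t0 _; apply/dominantP.
by rewrite pE ptE0 ptE1.
Qed.

Lemma down_cut X Y i j (i4 : (i < 4)%N) (j4 : (j < 4)%N) : X = w 0 0 -> Y < w 0 1 ->
  dominant i j X Y -> ~~ odd j.
Proof.
move=> XE Yw dom; rewrite -(parity_down (Ordinal i4, Ordinal j4)).
have down : (w, (0, -1) : int * int) \in legs b w l by rewrite !inE eqxx ?orbT.
apply: (leg_parity i4 j4 down (t := w 0 1 - Y) _ dom); first by lra.
by apply: rv2P; rewrite !mxE /= ?XE; ring.
Qed.

End Cuts.

Lemma left_cut b w l X Y i j (i4 : (i < 4)%N) (j4 : (j < 4)%N) : even_cuts ex b w l ->
  Y = (if b then w 0 1 else w 0 1 + l) -> X < (if b then w 0 0 else w 0 0 - l) ->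
  dominant i j X Y -> ~~ odd i.
Proof.
move=> ev YE Xw dom; rewrite -(parity_left (Ordinal i4, Ordinal j4)).
pose lg : 'rV[R]_2 * (int * int) := ((if b then w else w + l *: vec (edge_dir b)), (-1, 0)).
have left : lg \in legs b w l by rewrite /lg !inE; case: (b); rewrite /= eqxx ?orbT.
apply: (leg_parity ev i4 j4 left (t := (if b then w 0 0 else w 0 0 - l) - X) _ dom); first by lra.
by move: YE; rewrite /lg; case: (b) => /= YE; apply: rv2P; rewrite !mxE /= ?YE; ring.
Qed.

Lemma right_cut w l X Y i j (i4 : (i < 4)%N) (j4 : (j < 4)%N) : even_cuts ex false w l ->
  w 0 0 < X -> Y = w 0 1 -> dominant i j X Y -> odd i.
Proof.
move=> ev Xw YE dom; rewrite -(parity_right (Ordinal i4, Ordinal j4)).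
have right : (w, (1, 0) : int * int) \in legs false w l by exact: mem_head.
apply: (leg_parity ev i4 j4 right (t := X - w 0 0) _ dom); first by lra.
by apply: rv2P; rewrite !mxE /= ?YE; ring.
Qed.

(** The down leg forces the abscissa to 0, the left leg keeps its starting height between 0 and 2,
    and for [len z <= 0] the right leg from [v0] keeps the height of [v0] at least -1. *)
Lemma tritangent_near_class : tritangents `&` example_nbhd `<=` example_class.
Proof.
move=> z [+ [[x1 x2] y1 y2 u2 h]]; rewrite (tritangent_setE (@example_smooth R)) => T.
have [b [l' ev]] : exists b l', even_cuts ex b (v0 z) l'.
  by case: T => [[_ ?]|[_ ?]]; [exists true, (len z)|exists false, (- len z)].
have x0 : v0 z 0 0 = 0.
  have Y0 : - (11 / 2) < v0 z 0 1 by lra.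
  have [x_lt|x_gt|//] := ltgtP (v0 z 0 0) 0.
    by have := down_cut (i := 1) (j := 1) ev isT isT erefl Y0 (dominant_11 x1 x_lt).
  by have := down_cut (i := 2) (j := 1) ev isT isT erefl Y0 (dominant_21 x_gt x2).
case: T => /= [[l0 {}ev]|[l0 {}ev]].
  have y_gt : -1 < v0 z 0 1 by case: h; lra.
  have y_ge : 0 <= v0 z 0 1.
    rewrite leNgt; apply/negP => y0.
    suff : ~~ odd 1 by [].
    apply: (left_cut (i := 1) (j := 2) (X := - 4 - v0 z 0 1 / 2) isT isT ev erefl _
      (dominant_12 y_gt y0)).
    by rewrite x0 /=; lra.
  have y_le : v0 z 0 1 <= 2.
    rewrite leNgt; apply/negP => y3.
    suff : ~~ odd 1 by [].
    apply: (left_cut (i := 1) (j := 3) (X := - 4 - v0 z 0 1 / 2) isT isT ev erefl _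
      (dominant_13 y3 y2)).
    by rewrite x0 /=; lra.
  by split; [|lra| | lra |left].
have u_gt : -1 < v0 z 0 1 - len z by case: h; lra.
have u_ge : 0 <= v0 z 0 1 - len z.
  rewrite leNgt; apply/negP => y0.
  suff : ~~ odd 1 by [].
  apply: (left_cut (i := 1) (j := 2) (X := - 4 - (v0 z 0 1 - len z) / 2) isT isT ev erefl _
      (dominant_12 u_gt y0)).
  by rewrite x0 /=; lra.
have u_le : v0 z 0 1 - len z <= 2.
  rewrite leNgt; apply/negP => y3.
  suff : ~~ odd 1 by [].
  apply: (left_cut (i := 1) (j := 3) (X := - 4 - (v0 z 0 1 - len z) / 2) isT isT ev erefl _
      (dominant_13 y3 u2)).
  by rewrite x0 /=; lra.
suff y_ge : -1 <= v0 z 0 1 by split; [| | lra | | right].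
rewrite leNgt; apply/negP => y3.
suff : odd 2 by [].
apply: (right_cut (i := 2) (j := 2) (X := (- 1 - v0 z 0 1) / 2) isT isT ev _ erefl (dominant_22 y1 y3)).
by rewrite x0 /=; lra.
Qed.

Definition coordinates (x y l : R) : 'rV[R]_(2 + 1) := row_mx (pt x y) l%:M.

Lemma v0_coordinates x y l : v0 (coordinates x y l) = pt x y.
Proof. exact: row_mxKl. Qed.

Lemma len_coordinates x y l : len (coordinates x y l) = l.
Proof. by rewrite /len row_mxKr mxE. Qed.

Lemma v0_combination (z z' : 'rV[R]_(2 + 1)) t i :
  v0 (z + t *: (z' - z)) 0 i = v0 z 0 i + t * (v0 z' 0 i - v0 z 0 i).
Proof. by rewrite /v0 !mxE. Qed.

Lemma len_combination (z z' : 'rV[R]_(2 + 1)) t :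
  len (z + t *: (z' - z)) = len z + t * (len z' - len z).
Proof. by rewrite /len !mxE. Qed.

Lemma v0_continuous i : continuous (fun z : 'rV[R]_(2 + 1) => v0 z 0 i).
Proof.
rewrite (_ : (fun z => _) = fun z : 'rV[R]_(2 + 1) => z 0 (lshift 1 i)).
  exact: coord_continuous.
by apply/funext => z; rewrite /v0 mxE.
Qed.

Lemma len_continuous : continuous (@len R).
Proof.
rewrite (_ : @len R = fun z : 'rV[R]_(2 + 1) => z 0 (rshift 2 0)).
  exact: coord_continuous.
by apply/funext => z; rewrite /len mxE.
Qed.

End TritangentExample.

(** * The example class as a connected component *)

Section ExampleIsClass.
Variable R : realType.
Notation space := ('rV[R]_(2 + 1)).

Lemma star_connected (A : set space) x : A x ->
  (forall y, A y -> forall t, 0 <= t -> t <= 1 -> A (x + t *: (y - x))) -> connected A.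
Proof.
move=> Ax star.
have AC : components A (connected_component A x) by exists x.
have Cx : connected_component A x x by exact: connected_component_refl.
suff -> : A = connected_component A x by exact: connected_components AC.
apply/seteqP; split=> [y Ay|]; last exact: sub_components AC.
by apply: (connected_component_segment AC Cx) => t; apply: star.
Qed.

Lemma continuous_sub (f g : space -> R) : continuous f -> continuous g ->
  continuous (fun z => f z - g z).
Proof. by move=> cf cg z; apply: (@continuousB _ _ _ _ _ z); [exact: cf|exact: cg]. Qed.

Lemma closed_sublevel (f : space -> R) r : continuous f -> closed [set z | f z <= r].
Proof.
move=> cf; apply: (@preimage_closed _ _ f [set t | t <= r]) => [z _|]; first exact: cf.
exact: closed_le.
Qed.

Lemma closed_superlevel (f : space -> R) r : continuous f -> closed [set z | r <= f z].
Proof.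
move=> cf; apply: (@preimage_closed _ _ f [set t | r <= t]) => [z _|]; first exact: cf.
exact: closed_ge.
Qed.

Lemma open_sublevel (f : space -> R) r : continuous f -> open [set z | f z < r].
Proof.
by move=> cf; rewrite (_ : [set z | _] = ~` [set z | r <= f z]);
  [exact/closed_openC/closed_superlevel|apply/seteqP; split=> z /=; rewrite ltNge => /negP].
Qed.

Lemma open_superlevel (f : space -> R) r : continuous f -> open [set z | r < f z].
Proof.
by move=> cf; rewrite (_ : [set z | _] = ~` [set z | f z <= r]);
  [exact/closed_openC/closed_sublevel|apply/seteqP; split=> z /=; rewrite ltNge => /negP].
Qed.

Let x_cont := @v0_continuous R 0.
Let y_cont := @v0_continuous R 1.
Let u_cont := continuous_sub y_cont (@len_continuous R).

Lemma example_class_closed : closed (@example_class R).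
Proof.
rewrite (_ : @example_class R =
  [set z | v0 z 0 0 <= 0] `&` [set z | 0 <= v0 z 0 0] `&` [set z | -1 <= v0 z 0 1] `&`
  [set z | v0 z 0 1 <= 2] `&` [set z | v0 z 0 1 - len z <= 2] `&`
  ([set z | 0 <= v0 z 0 1] `|` [set z | 0 <= v0 z 0 1 - len z])).
  by repeat first [apply: closedI|apply: closedU|exact: closed_sublevel|exact: closed_superlevel].
apply/seteqP; split=> z [].
  by move=> /= -> ? ? ? ?; rewrite lexx.
move=> [[[[/= x1 x2] y1] y2] u2] h; split=> //.
by apply/eqP; rewrite eq_le x1.
Qed.

Lemma example_nbhd_open : open (@example_nbhd R).
Proof.
rewrite (_ : @example_nbhd R =
  [set z | v0 z 0 0 < 1] `&` [set z | -1 < v0 z 0 0] `&` [set z | -2 < v0 z 0 1] `&`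
  [set z | v0 z 0 1 < 3] `&` [set z | v0 z 0 1 - len z < 3] `&`
  ([set z | -1 < v0 z 0 1] `|` [set z | -1 < v0 z 0 1 - len z])).
  by repeat first [apply: openI|apply: openU|exact: open_sublevel|exact: open_superlevel].
apply/seteqP; split=> z; first by move=> [[]].
by move=> [[[[[/= x1 x2] y1] y2] u2] h].
Qed.

Lemma example_class_connected : connected (@example_class R).
Proof.
(* The class is not convex, but star-shaped about this point, which lies in both halves. *)
apply: (@star_connected _ (coordinates 0 1 0)).
  by rewrite /example_class /= v0_coordinates len_coordinates ptE0 ptE1; split; try lra; left; lra.
move=> z [z0 z1 z2 zl z3] t t0 t1; rewrite /example_class /= !v0_combination !len_combination.
rewrite v0_coordinates len_coordinates ptE0 ptE1 z0.
split; [lra|nra|nra|nra|].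
by case: z3 => z3; [left|right]; nra.
Qed.

Lemma example_class_isP : tritangent_class (corner_locus (@example R)) (@example_class R).
Proof.
apply: (@component_of_clopen _ _ _ _ (@example_nbhd R) (@example_class R) (coordinates 0 1 0)).
- exact: example_class_connected.
- by rewrite /example_class /= v0_coordinates len_coordinates ptE0 ptE1; split; try lra; left; lra.
- exact: example_class_tritangent.
- exact: example_nbhd_open.
- exact: example_class_closed.
- apply/seteqP; split; first exact: tritangent_near_class.
  move=> z Wz; split; first exact: example_class_tritangent.
  by case: Wz => ? ? ? ? h; case: h => h; split; lra.
- by [].
- by move=> z [? ? ? ? h]; case: h => h; split; lra.
Qed.

End ExampleIsClass.

(** * Gluing polyhedral complexes *)

Section Gluing.
Variables (R : realType) (n : nat).
Implicit Types (P Q : set 'rV[R]_n) (K : set (set 'rV[R]_n)).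

(** The hypothesis rewrites an intersection across the two complexes as an intersection inside
    either one, hence as a face on both sides. *)
Lemma glued_complex K K' : polyhedral_complex K -> polyhedral_complex K' ->
  (forall P Q, K P -> K' Q -> P `&` Q !=set0 ->
     (exists2 Q', K Q' & P `&` Q = P `&` Q') /\ (exists2 P', K' P' & P `&` Q = P' `&` Q)) ->
  polyhedral_complex (K `|` K').
Proof.
move=> cK cK' glue.
have cap P Q : K P -> K' Q -> P `&` Q !=set0 -> face (P `&` Q) P /\ face (P `&` Q) Q.
  move=> KP K'Q PQ0; have [[Q' KQ' QE] [P' KP' PE]] := glue P Q KP K'Q PQ0; split.
    by rewrite QE; apply: (complex_cap cK KP KQ' _).1; rewrite -QE.
  by rewrite PE; apply: (complex_cap cK' KP' K'Q _).2; rewrite -PE.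
split.
- by rewrite finite_setU; split; [exact: complex_finite cK|exact: complex_finite cK'].
- by move=> P [KP|KP]; [exact: complex_cell cK _ KP|exact: complex_cell cK' _ KP].
- move=> P F [KP|KP] FP; first by left; exact: complex_face cK _ _ KP FP.
  by right; exact: complex_face cK' _ _ KP FP.
- move=> P Q [KP|KP] [KQ|KQ] PQ0.
  + exact: (complex_cap cK).
  + exact: cap.
  + by rewrite setIC in PQ0 *; have [] := cap Q P KQ KP PQ0.
  + exact: (complex_cap cK').
Qed.

Lemma polyhedron_segment P x y t : polyhedron P -> P x -> P y -> 0 <= t -> t <= 1 ->
  P (x + t *: (y - x)).
Proof.
move=> [m [A [b ->]]] /= Px Py t0 t1 j.
rewrite mulmxDl -scalemxAl mulmxBl !mxE.
have := Px j; have := Py j; rewrite !mxE; nra.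
Qed.

End Gluing.

(** * Two structures without a common coarsening *)

Section NoCoarsest.
Variable R : realType.
Notation W := (@example_class R).
Notation space := ('rV[R]_(2 + 1)).
Implicit Types (z p : space) (P Q : set space).
Notation X z := (v0 z 0 0).
Notation Y z := (v0 z 0 1).
Notation cell_of := (@cell R (2 + 1)).

Definition plane (y l : R) : space := coordinates 0 y l.

Lemma planeE y l : (X (plane y l) = 0) * (Y (plane y l) = y) * (len (plane y l) = l).
Proof. by rewrite /plane v0_coordinates len_coordinates ptE0 ptE1. Qed.

Definition upper : set space := [set z | [/\ X z = 0, 0 <= len z, 0 <= Y z & Y z <= 2]].
Definition lower : set space :=
  [set z | [/\ X z = 0, len z <= 0, -1 <= Y z, 0 <= Y z - len z & Y z - len z <= 2]].

Definition upper_walls : seq (affine R (2 + 1)) :=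
  [:: afn 1 0 0 0; afn 0 0 1 0; afn 0 1 0 0; afn 0 1 0 (-2)].
Definition lower_walls : seq (affine R (2 + 1)) :=
  [:: afn 1 0 0 0; afn 0 0 1 0; afn 0 1 0 1; afn 0 1 (-1) 0; afn 0 1 (-1) (-2)].
(** The wall [len = 0] is absent, so the parallelogram around [plane 1 0] is a single cell that
    crosses it. *)
Definition total_walls : seq (affine R (2 + 1)) :=
  [:: afn 1 0 0 0; afn 0 1 0 0; afn 0 1 0 (-2); afn 0 1 (-1) 0; afn 0 1 (-1) (-2); afn 0 1 0 1].

Lemma weaker_sign_afn k0 k1 k2 r z z' : weaker_sign (afn k0 k1 k2 r) z z' =
  ((k0%:~R * X z + k1%:~R * Y z + k2%:~R * len z + r <= 0 ->
     k0%:~R * X z' + k1%:~R * Y z' + k2%:~R * len z' + r <= 0) /\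
  (0 <= k0%:~R * X z + k1%:~R * Y z + k2%:~R * len z + r ->
     0 <= k0%:~R * X z' + k1%:~R * Y z' + k2%:~R * len z' + r)).
Proof. by rewrite /weaker_sign !eval_afn. Qed.

Lemma weaker_signs_cons h hs z z' : weaker_signs (h :: hs) z z' =
  (weaker_sign h z z' /\ weaker_signs hs z z').
Proof.
apply/propext; split=> [s|[s0 s] h']; first by split=> [|h' hh]; apply: s; rewrite inE ?eqxx ?hh ?orbT.
by rewrite inE => /orP[/eqP ->|/s].
Qed.

Lemma weaker_signs_nil z z' : weaker_signs [::] z z' = True.
Proof. by rewrite propeqE; split. Qed.

Ltac unfold_signs := rewrite !weaker_signs_cons weaker_signs_nil !weaker_sign_afn
  ?(mulr0z, mulr1z, mulrNz, mul0r, mul1r, mulN1r, addr0, add0r).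
Ltac use_signs := repeat match goal with
  | H : is_true ?a -> is_true ?b |- _ =>
      let E := fresh in assert (E : is_true a) by lra; specialize (H E); clear E
  end.

Lemma total_cell_closed : cell_closed total_walls W.
Proof.
move=> z z'; rewrite /total_walls; unfold_signs.
move=> [[h1 h1'] [[_ h2'] [[h3 _] [[_ h4'] [[h5 _] [[_ h6'] _]]]]]] [z0 z1 z2 zl z3].
by case: z3 => z3; [clear h4'|clear h2']; use_signs; split; lra.
Qed.

Lemma upper_cell_closed : cell_closed upper_walls upper.
Proof.
move=> z z'; rewrite /upper_walls; unfold_signs.
move=> [[h1 h1'] [[_ h2'] [[_ h3'] [[h4 _] _]]]] [z0 z1 z2 z3].
by use_signs; split; lra.
Qed.

Lemma lower_cell_closed : cell_closed lower_walls lower.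
Proof.
move=> z z'; rewrite /lower_walls; unfold_signs.
move=> [[h1 h1'] [[h2 _] [[_ h3'] [[_ h4'] [[h5 _] _]]]]] [z0 z1 z2 z3 z4].
by use_signs; split; lra.
Qed.

(** [plane 1 1] lies in the relative interior of the upper half, so its cell is the whole half;
    [plane 0 (-1)] plays the same role for the lower half. *)
Lemma upper_subcell z : upper z -> cell_of upper_walls (plane 1 1) z.
Proof.
move=> [z0 z1 z2 z3]; rewrite /cell /= /upper_walls; unfold_signs; rewrite !planeE.
by do !split; move=> ?; lra.
Qed.

Lemma lower_subcell z : lower z -> cell_of lower_walls (plane 0 (-1)) z.
Proof.
move=> [z0 z1 z2 z3 z4]; rewrite /cell /= /lower_walls; unfold_signs; rewrite !planeE.
by do !split; move=> ?; lra.
Qed.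

Lemma total_subcell y l : 0 <= y -> y <= 2 -> 0 <= y - l -> y - l <= 2 ->
  cell_of total_walls (plane 1 0) (plane y l).
Proof.
move=> z0 z1 z2 z3; rewrite /cell /= /total_walls; unfold_signs; rewrite !planeE.
by do !split; move=> ?; lra.
Qed.

(** On [len = 0] the walls for [Y - len] coincide with those for [Y], and the wall [Y = -1] is not
    met, so both arrangements induce the same subdivision there. *)
Lemma cells_on_axis p : X p = 0 -> len p = 0 -> 0 <= Y p -> Y p <= 2 ->
  cell_of upper_walls p = cell_of lower_walls p.
Proof.
move=> X0 p0 p1 p2; apply/seteqP; split=> z; rewrite /cell /= /upper_walls /lower_walls;
  unfold_signs; rewrite X0 p0.
  move=> [[h1 h1'] [[h2 h2'] [[h3 h3'] [[h4 h4'] _]]]]; use_signs.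
  by do !split=> //; move=> ?; lra.
move=> [[h1 h1'] [[h2 h2'] [[h3 h3'] [[h4 h4'] [[h5 h5'] _]]]]]; use_signs.
by do !split=> //; move=> ?; lra.
Qed.

(* The hyperplane [len = 0] supports both halves, so it cuts a face out of every cell. *)
Lemma axis_face hs (A : set space) (s : R) P : cell_closed hs A ->
  s != 0 -> (forall z, A z -> 0 <= s * len z) -> cells_in hs A P -> (exists2 z, P z & len z = 0) ->
  exists p, [/\ A p, len p = 0, P p & P `&` [set z | len z = 0] = cell hs p].
Proof.
move=> cA s0 sA [q Aq <-] [z0 Pz0 z00].
have PA z : cell hs q z -> A z by move=> qz; apply: cA qz Aq.
have F : face (cell hs q `&` [set z | s * len z = 0]) (cell hs q).
  split; first by exists z0; split=> //=; rewrite z00 mulr0.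
  exists (col_mx 0 (- s)%:M).
  have E z : (z *m col_mx 0 (- s)%:M) 0 0 = - (s * len z).
    by rewrite -[z in LHS]hsubmxK mul_row_col mulmx0 add0r mul_mx_scalar mxE mulNr.
  apply/seteqP; split=> z /=; rewrite ?E => -[Pz].
    by move=> z_0; split=> // y /PA /sA; rewrite !E z_0 oppr0 oppr_le0.
  move=> mx; split=> //; have := mx _ Pz0; rewrite !E z00 mulr0 oppr0 oppr_ge0 => h.
  by apply/eqP; rewrite eq_le h sA //; apply: PA.
have [p Fp FE] := face_cell F.
have lenE z : s * len z = 0 <-> len z = 0.
  by split=> [/eqP|->]; [rewrite mulf_eq0 (negbTE s0) => /eqP|rewrite mulr0].
have [Pp /lenE p0] := Fp.
exists p; split=> //; first exact: PA.
by rewrite -FE; apply/seteqP; split=> z [Pz /lenE z_0].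
Qed.

Definition halves : set (set space) :=
  cells_in upper_walls upper `|` cells_in lower_walls lower.

(** Cells from different halves meet only in [len = 0], where the two subdivisions agree; this is
    the hypothesis for gluing. *)
Lemma halves_structure : complex_structure W halves.
Proof.
have [cU sU] := arrangement_structure upper_cell_closed.
have [cL sL] := arrangement_structure lower_cell_closed.
split; last first.
  have -> : Defs.support halves = upper `|` lower.
    rewrite -[in RHS]sU -[in RHS]sL; apply/seteqP; split=> z.
      by move=> [P [KP|KP] Pz]; [left|right]; exists P.
    by move=> [[P KP Pz]|[P KP Pz]]; exists P => //; [left|right].
  apply/seteqP; split=> z.
    by move=> [[z0 z1 z2 z3]|[z0 z1 z2 z3 z4]]; split; lra.
  move=> [z0 z1 z2 z3 z4]; have [l0|l0] := leP 0 (len z); [left|right];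
    split; case: z4; lra.
apply: glued_complex => // P Q KP KQ [z [Pz Qz]].
have subU z' : P z' -> upper z' by move=> Pz'; rewrite -sU; exists P.
have subL z' : Q z' -> lower z' by move=> Qz'; rewrite -sL; exists Q.
have axis z' : P z' -> Q z' -> len z' = 0.
  by move=> /subU[_ ? _ _] /subL[_ ? _ _ _]; lra.
have [p [[p1 p2 p3 p4] p0 Pp PE]] : exists p, [/\ upper p, len p = 0, P p &
    P `&` [set z | len z = 0] = cell_of upper_walls p].
  apply: (axis_face upper_cell_closed (oner_neq0 R)) KP _.
    by move=> z' [_ ? _ _]; rewrite mul1r.
  by exists z => //; exact: axis.
have [q [[q1 q2 q3 q4 q5] q0 Qq QE]] : exists q, [/\ lower q, len q = 0, Q q &
    Q `&` [set z | len z = 0] = cell_of lower_walls q].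
  apply: (@axis_face _ _ (-1) _ lower_cell_closed) KQ _; first by rewrite oppr_eq0 oner_eq0.
    by move=> z' [_ ? _ _]; rewrite mulN1r oppr_ge0.
  by exists z => //; exact: axis.
split.
  exists (Q `&` [set z | len z = 0]).
    have [Yq0 Yq2] : 0 <= Y q /\ Y q <= 2 by lra.
    by rewrite QE -(cells_on_axis q1 q0 Yq0 Yq2); exists q => //; split=> //; lra.
  by apply/seteqP; split=> z' [Pz' ]; [move=> Qz'; do !split=> //; exact: axis|move=> []].
exists (P `&` [set z | len z = 0]).
  by rewrite PE (cells_on_axis p1 p0 p3 p4); exists p => //; split=> //; lra.
by apply/seteqP; split=> z'; [move=> [Pz' Qz']; do !split=> //; exact: axis|move=> [[]]].
Qed.

Lemma linear_form (a : 'cV[R]_(2 + 1)) : exists k0 k1 k2 : R, forall z,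
  (z *m a) 0 0 = k0 * X z + k1 * Y z + k2 * len z.
Proof.
exists (a (lshift 1 0) 0), (a (lshift 1 1) 0), (a (rshift 2 0) 0) => z.
rewrite -[z in LHS]hsubmxK -[a in LHS]vsubmxK mul_row_col mxE.
rewrite !mxE big_ord_recl big_ord1 big_ord1 (_ : lift ord0 ord0 = 1); last exact: val_inj.
by rewrite /v0 /len !mxE; ring.
Qed.

(* Two cells of a complex in the plane [X = 0] that share a triangle are equal, since a linear
   functional that is constant on the triangle is constant on the plane. *)
Lemma share_triangle K P Q (y0 l0 y1 l1 y2 l2 : R) : polyhedral_complex K -> K P -> K Q ->
  (forall z, P z -> X z = 0) -> (y1 - y0) * (l2 - l0) - (y2 - y0) * (l1 - l0) != 0 ->
  (P `&` Q) (plane y0 l0) -> (P `&` Q) (plane y1 l1) -> (P `&` Q) (plane y2 l2) -> P `<=` Q.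
Proof.
move=> cK KP KQ P0 area PQ0 PQ1 PQ2 z Pz.
have [[_ [a aE]] _] := complex_cap cK KP KQ (ex_intro _ _ PQ0).
have [k0 [k1 [k2 kE]]] := linear_form a.
have eq_max z1 z2 : (P `&` Q) z1 -> (P `&` Q) z2 -> (z1 *m a) 0 0 = (z2 *m a) 0 0.
  by rewrite aE => -[P1 m1] [P2 m2]; apply/eqP; rewrite eq_le m2 // m1.
have E1 := eq_max _ _ PQ1 PQ0; have E2 := eq_max _ _ PQ2 PQ0.
rewrite !kE !planeE in E1 E2.
have e1 : k1 * (y1 - y0) + k2 * (l1 - l0) = 0.
  transitivity (k0 * 0 + k1 * y1 + k2 * l1 - (k0 * 0 + k1 * y0 + k2 * l0)); first by ring.
  by rewrite E1 subrr.
have e2 : k1 * (y2 - y0) + k2 * (l2 - l0) = 0.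
  transitivity (k0 * 0 + k1 * y2 + k2 * l2 - (k0 * 0 + k1 * y0 + k2 * l0)); first by ring.
  by rewrite E2 subrr.
have k10 : k1 = 0.
  apply: (mulIf area); rewrite mul0r; transitivity
    ((k1 * (y1 - y0) + k2 * (l1 - l0)) * (l2 - l0) - (k1 * (y2 - y0) + k2 * (l2 - l0)) * (l1 - l0)).
    by ring.
  by rewrite e1 e2 !mul0r subrr.
have k20 : k2 = 0.
  apply: (mulIf area); rewrite mul0r; transitivity
    ((k1 * (y2 - y0) + k2 * (l2 - l0)) * (y1 - y0) - (k1 * (y1 - y0) + k2 * (l1 - l0)) * (y2 - y0)).
    by ring.
  by rewrite e1 e2 !mul0r subrr.
suff : (P `&` Q) z by case.
by rewrite aE; split=> // z' Pz'; rewrite !kE (P0 _ Pz') (P0 _ Pz) k10 k20 !mul0r.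
Qed.

Lemma upper_plane y l : 0 <= l -> 0 <= y -> y <= 2 -> upper (plane y l).
Proof. by move=> *; split; rewrite ?planeE. Qed.

Lemma lower_plane y l : l <= 0 -> -1 <= y -> 0 <= y - l -> y - l <= 2 -> lower (plane y l).
Proof. by move=> *; split; rewrite ?planeE. Qed.

Lemma example_class_no_coarsest : ~ exists K, coarsest_structure W K.
Proof.
have upperp : upper (plane 1 1) by apply: upper_plane; lra.
have lowerp : lower (plane 0 (-1)) by apply: lower_plane; lra.
have totalp : W (plane 1 0) by split; rewrite ?planeE; lra.
(* Each triangle lies in one half and in the parallelogram, and has nonzero area, as
   [share_triangle] requires. *)
have upper_triangle : [/\ upper (plane 1 0), upper (plane 2 0) & upper (plane 1 1)].
  by split; apply: upper_plane; lra.
have lower_triangle : [/\ lower (plane 1 0), lower (plane 1 (-1)) & lower (plane 0 0)].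
  by split; apply: lower_plane; lra.
have total_quad : [/\ cell_of total_walls (plane 1 0) (plane 1 0),
    cell_of total_walls (plane 1 0) (plane 2 0), cell_of total_walls (plane 1 0) (plane 1 1),
    cell_of total_walls (plane 1 0) (plane 1 (-1)) & cell_of total_walls (plane 1 0) (plane 0 0)].
  by split; apply: total_subcell; lra.
have upper_area : (2 - 1) * (1 - 0) - (1 - 1) * (0 - 0) != 0 :> R by apply/eqP; lra.
have lower_area : (1 - 1) * (0 - 0) - (0 - 1) * (-1 - 0) != 0 :> R by apply/eqP; lra.
(* Nonconvexity: at the midpoint of these two points [Y] is -1/2 and [Y - len] is -1, so both
   disjuncts of the class fail. *)
have upper_end : upper (plane 0 2) by apply: upper_plane; lra.
have lower_end : lower (plane (-1) (-1)) by apply: lower_plane; lra.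
have [half0 half1] : 0 <= 1 / 2 :> R /\ 1 / 2 <= 1 :> R by lra.
have middle : ~ W (plane 0 2 + (1 / 2) *: (plane (-1) (-1) - plane 0 2)).
  by move=> [_ _ _ _]; rewrite !v0_combination !len_combination !planeE; lra.
move=> [K [[cK sK] refine]].
have inW P z : K P -> P z -> W z by move=> KP Pz; rewrite -sK; exists P.
have inX P z : K P -> P z -> X z = 0 by move=> KP /(inW P z KP)[].
have [Qu KQu Qu_sub] : exists2 Q, K Q & upper `<=` Q.
  have [] := refine _ halves_structure (cell_of upper_walls (plane 1 1)).
    by left; exists (plane 1 1).
  by move=> Q KQ sub; exists Q => // z /upper_subcell; exact: sub.
have [Ql KQl Ql_sub] : exists2 Q, K Q & lower `<=` Q.
  have [] := refine _ halves_structure (cell_of lower_walls (plane 0 (-1))).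
    by right; exists (plane 0 (-1)).
  by move=> Q KQ sub; exists Q => // z /lower_subcell; exact: sub.
have [Q KQ Q_sub] : exists2 Q, K Q & cell_of total_walls (plane 1 0) `<=` Q.
  have [] := refine _ (arrangement_structure total_cell_closed) (cell_of total_walls (plane 1 0)).
    by exists (plane 1 0).
  by move=> Q KQ sub; exists Q.
have [q10 q20 q11 q1m q00] := total_quad.
have QuQ : Qu `<=` Q.
  have [u10 u20 u11] := upper_triangle.
  by apply: (share_triangle cK KQu KQ (inX _ ^~ KQu) upper_area); split; auto.
have QlQ : Ql `<=` Q.
  have [l10 l1m l00] := lower_triangle.
  by apply: (share_triangle cK KQl KQ (inX _ ^~ KQl) lower_area); split; auto.
have [Q_poly _] := complex_cell cK KQ.
apply: middle; apply: (inW _ _ KQ); apply: polyhedron_segment => //.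
  by apply/QuQ/Qu_sub.
by apply/QlQ/Ql_sub.
Qed.

End NoCoarsest.

Theorem theorem1p2 (R : realType) :
  (forall G : set 'rV[R]_2, smooth_tropical_33_curve G ->
   forall W : set 'rV[R]_(2 + 1), tritangent_class G W ->
     connected W /\ rational_polyhedral_complex W) /\
  (exists2 G : set 'rV[R]_2, smooth_tropical_33_curve G &
   exists2 W : set 'rV[R]_(2 + 1), tritangent_class G W &
     ~ exists K, coarsest_structure W K).
Proof.
split; first by move=> G smoothG W GW; exact: tritangent_class_polyhedral smoothG GW.
exists (corner_locus (@example R)); first by exists (@example R); split=> //; exact: example_smooth.
by exists (@example_class R); [exact: example_class_isP|exact: example_class_no_coarsest].
Qed.
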